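(* Let $d\ge 1$, $\gamma>1$, $\beta\in\mathbb{R}$, $\sigma>d/2$, $\lambda=2\sigma/d$, and let $m$ be a measurable symbol on $\mathbb{R}^d$ of at most polynomial growth satisfying the localized logarithmic Miyachi condition of order $(\gamma,\beta,\sigma)$ (defined in the context) with constant $C_m$. Then there is a constant $C$, depending only on $d,\gamma,\beta,\sigma,\lambda$, on $C_m$ and on the fixed cutoffs (and not on $f$ or $x$), such that for every Schwartz function $f$ and every $x\in\mathbb{R}^d$, $$ g_{\log,\gamma,\beta}(T_m f)(x)\le C\, g^{*}_{\log,\gamma,0,\lambda}(f)(x). $$
   Context: Fourier multipliers: $T_m f=\mathcal F^{-1}(m\widehat f)$, initially on Schwartz functions. Scales: $R_0\ge e^2$ is a fixed number, chosen sufficiently large depending on the structural constants. For $R\ge R_0$ put $\rho(R)=R/(\log R)^{\gamma-1}$, and for $0<t<e^{-1}$ put $a_\gamma(t)=t(\log(1/t))^{\gamma-1}$. Log-subdyadic balls: for a Euclidean ball $B$ with radius $r(B)$ let $R_B=\operatorname{dist}(B,0)$. $B$ is log-subdyadic (of order $\gamma$) if $R_B\ge R_0$ and $c_0\rho(R_B)\le r(B)\le C_0\rho(R_B)$, with fixed structural constants $0<c_0<C_0<\infty$. Adapted bumps: let $N$ be a fixed integer, sufficiently large compared with the Sobolev exponents used. A normalized bump adapted to $B$ is $\Psi_B\in C_c^\infty(\mathbb{R}^d)$ with $\operatorname{supp}\Psi_B\subset C_1B$ (fixed dilation constant $C_1$) and $|D^\nu\Psi_B|\le C_\nu r(B)^{-|\nu|}$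 for $|\nu|\le N$, with fixed constants $C_\nu$; constants in statements are uniform over this class. Localized logarithmic Miyachi condition of order $(\gamma,\beta,\sigma)$, $\sigma>d/2$: for every log-subdyadic ball $B$, every adapted normalized bump $\Psi_B$ and every $0\le\theta\le\sigma$, $$(\log R_B)^\beta\rho(R_B)^\theta|B|^{-1/2}\|m\Psi_B\|_{\dot H^\theta}\le C_m,$$ with $C_m$ independent of $B$, $\Psi_B$ ($\dot H^\theta$ is the homogeneous Sobolev space). Littlewood–Paley function and truncation: $\phi$ is a fixed radial Schwartz function with $\operatorname{supp}\widehat\phi\subset\{1/2\le|\xi|\le2\}$ and $\int_0^\infty\widehat\phi(t\xi)\frac{dt}{t}=1$ for $\xi\ne0$; $\phi_t(x)=t^{-d}\phi(x/t)$. Fix $k_0$ with $2^{k_0}\ge R_0$ and an integer $k_1\ge k_0+2$ with $t_0=2^{-k_1}<e^{-1}$. Square functions: for $\beta\in\mathbb{R}$, $$g_{\log,\gamma,\beta}(f)(x)=\Big(\int_0^{t_0}\int_{|y-x|\le a_\gamma(t)}|f*\phi_t(y)|^2\frac{dy}{a_\gamma(t)^d}(\log(1/t))^{2\beta}\frac{dt}{t}\Big)^{1/2},$$ and for $\lambda>1$, $$g^{*}_{\log,\gamma,\beta,\lambda}(f)(x)=\Big(\int_0^{t_0}\int_{\mathbb{R}^d}|f*\phi_t(y)|^2\Big(1+\frac{|x-y|}{a_\gamma(t)}\Big)^{-d\lambda}\frac{dy}{a_\gamma(t)^d}(\log(1/t))^{2\beta}\frac{dt}{t}\Big)^{1/2}.$$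 These only involve $0<t<t_0$, so the estimate depends only on the high-frequency portion of $m$ detected by $\widehat{\phi_t}$. *)

(* Defs.v *)
(* Points of R^d are row vectors 'rV[R]_d, complex scalars are elements of R[i]. *)
From HB Require Import structures.
From mathcomp Require Import all_boot all_order all_algebra.
From mathcomp Require Import all_classical all_reals all_analysis.
From mathcomp Require Import complex.

Set Implicit Arguments.
Unset Strict Implicit.
Unset Printing Implicit Defensive.
Import Order.TTheory GRing.Theory Num.Theory.
Import numFieldNormedType.Exports.
Import complex.

Local Open Scope classical_set_scope.
Local Open Scope ring_scope.
Local Open Scope complex_scope.

(* Borel sets of R^n, generated by the coordinates as for tuples in the library. *)
Definition rV_display : measure_display -> measure_display.
Proof. exact. Qed.

Section rV_measurable.
Context {R : realType} (n : nat).

Let coord (i : 'I_n) (x : 'rV[R]_n) : R := x ord0 i.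

Let rV_set0 : g_sigma_preimage coord set0.
Proof. exact: sigma_algebra0. Qed.

Let rV_setC A : g_sigma_preimage coord A -> g_sigma_preimage coord (~` A).
Proof. exact: sigma_algebraC. Qed.

Let rV_bigcup (F : _^nat) : (forall i, g_sigma_preimage coord (F i)) ->
  g_sigma_preimage coord (\bigcup_i (F i)).
Proof. exact: sigma_algebra_bigcup. Qed.

HB.instance Definition _ := @isMeasurable.Build
  (rV_display default_measure_display) 'rV[R]_n
  (g_sigma_preimage coord) rV_set0 rV_setC rV_bigcup.

End rV_measurable.

Section lebesgue_rV.
Context {R : realType}.

Definition consrV n (p : 'rV[R]_n * R) : 'rV[R]_n.+1 :=
  \row_j (if unlift ord0 j is Some k then p.1 ord0 k else p.2).

Lemma measurable_coordrV n (i : 'I_n) :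
  measurable_fun setT (fun x : 'rV[R]_n => x ord0 i).
Proof.
move=> _ Y mY; rewrite setTI; apply: sub_sigma_algebra => /=.
rewrite -bigcup_seq/=; exists i => /=; first by rewrite mem_index_enum.
by exists Y => //; rewrite setTI.
Qed.

Lemma measurable_fun_rV d (T : measurableType d) n (f : T -> 'rV[R]_n) :
  (forall i, measurable_fun setT (fun x => f x ord0 i)) ->
  measurable_fun setT f.
Proof.
move=> mf _ A mA; rewrite setTI; move: A mA.
have sm : sigma_algebra setT [set A : set 'rV[R]_n | measurable (f @^-1` A)].
  split=> /=.
  - by rewrite preimage_set0.
  - by move=> A mA; rewrite setTD -preimage_setC; exact: measurableC.
  - by move=> F mF; rewrite preimage_bigcup; exact: bigcupT_measurable.
apply: smallest_sub => // A.
rewrite -bigcup_seq => -[i _ [B mB <-]] /=.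
by rewrite setTI -[X in measurable X]setTI; exact: mf.
Qed.

Lemma measurable_consrV n : measurable_fun setT (@consrV n).
Proof.
apply: measurable_fun_rV => i; rewrite /consrV.
under eq_fun do rewrite mxE.
case: unliftP => [k _|_].
  exact: (measurableT_comp (measurable_coordrV k) measurable_fst).
exact: measurable_snd.
Qed.

Definition lebesgue_rVS n (mu : {measure set 'rV[R]_n -> \bar R}) :=
  pushforward (mu \x lebesgue_measure)%E (@consrV n).

HB.instance Definition _ n mu := Measure.copy (@lebesgue_rVS n mu)
  (measure_function_pushforward__canonical__measure_function_Measure
    (mu \x lebesgue_measure)%E (@measurable_consrV n)).

(* Lebesgue measure on R^n (Borel sets), as an iterated product measure. *)
Fixpoint lebesgue_rV (n : nat) : {measure set 'rV[R]_n -> \bar R} :=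
  match n with
  | 0 => dirac (0 : 'rV[R]_0)
  | k.+1 => lebesgue_rVS (lebesgue_rV k)
  end.

End lebesgue_rV.

Section euclidean.
Context {R : realType} {d : nat}.
Implicit Types x y c : 'rV[R]_d.

Definition dotrV x y : R := \sum_(i < d) x ord0 i * y ord0 i.

(* The norm `|x| of 'rV[R]_d in the library is the sup norm. *)
Definition enorm x : R := Num.sqrt (dotrV x x).

Definition eball c (r : R) : set 'rV[R]_d := [set x | enorm (x - c) < r].

Definition dist0 (A : set 'rV[R]_d) : R := inf (enorm @` A).

End euclidean.

Section complex_functions.
Context {R : realType}.

Definition expi (a : R) : R[i] := cos a +i* sin a.

Definition cintegral disp (T : measurableType disp)
    (mu : {measure set T -> \bar R}) (D : set T) (f : T -> R[i]) : R[i] :=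
  (\int[mu]_(x in D) Re (f x)) +i* (\int[mu]_(x in D) Im (f x)).

Context {d : nat}.
Implicit Types f g : 'rV[R]_d -> R[i].

Definition supp f : set 'rV[R]_d := closure [set x | f x != 0].

Definition partial (i : 'I_d) f : 'rV[R]_d -> R[i] := fun x =>
  ('D_(delta_mx ord0 i) (fun y => Re (f y)) x)
  +i* ('D_(delta_mx ord0 i) (fun y => Im (f y)) x).

(* C^oo: every iterated partial derivative, in any order, is differentiable. *)
Definition smooth f : Prop := forall (s : seq 'I_d) (x : 'rV[R]_d),
  differentiable (fun y => Re (foldr partial f s y)) x /\
  differentiable (fun y => Im (foldr partial f s y)) x.

Definition mderiv (nu : {ffun 'I_d -> nat}) f : 'rV[R]_d -> R[i] :=
  foldr (fun i g => iter (nu i) (partial i) g) f (enum 'I_d).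

Definition mdeg (nu : {ffun 'I_d -> nat}) : nat := \sum_(i < d) nu i.

Definition schwartz f : Prop := smooth f /\
  forall (k : nat) (nu : {ffun 'I_d -> nat}), exists M : R,
    forall x, (1 + enorm x) ^+ k * Normc.normc (mderiv nu f x) <= M.

Definition radial f : Prop := forall x y, enorm x = enorm y -> f x = f y.

(* Lebesgue (not only Borel) measurability: a.e. equal to a Borel function. *)
Definition lebesgue_measurable f : Prop := exists g,
  [/\ measurable_fun setT (fun x => Re (g x)),
      measurable_fun setT (fun x => Im (g x)) &
      {ae lebesgue_rV d, forall x, f x = g x}].

Definition polynomial_growth f : Prop := exists (A : R) (k : nat),
  {ae lebesgue_rV d, forall x, Normc.normc (f x) <= A * (1 + enorm x) ^+ k}.

Definition fourier f : 'rV[R]_d -> R[i] := fun xi =>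
  cintegral (lebesgue_rV d) setT (fun x => f x * expi (- (2 * pi * dotrV x xi))).

Definition inv_fourier f : 'rV[R]_d -> R[i] := fun x =>
  cintegral (lebesgue_rV d) setT (fun xi => f xi * expi (2 * pi * dotrV x xi)).

Definition convolution f g : 'rV[R]_d -> R[i] := fun y =>
  cintegral (lebesgue_rV d) setT (fun z => f z * g (y - z)).

Definition multiplier (m : 'rV[R]_d -> R[i]) f : 'rV[R]_d -> R[i] :=
  inv_fourier (fun xi => m xi * fourier f xi).

(* Homogeneous Sobolev norm of order theta, possibly +oo; only applied to
   integrable f, for which the integral [fourier f] is the Fourier transform. *)
Definition hsobolev (theta : R) f : \bar R :=
  ((\int[lebesgue_rV d]_xi
     ((enorm xi `^ theta * Normc.normc (fourier f xi)) ^+ 2)%:E) `^ 2^-1)%E.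

Definition dilation f (t : R) : 'rV[R]_d -> R[i] := fun x =>
  (t ^- d)%:C * f (t^-1 *: x).

Definition lp_function (phi : 'rV[R]_d -> R[i]) : Prop :=
  [/\ schwartz phi, radial phi,
      supp (fourier phi) `<=` [set xi | 2^-1 <= enorm xi <= 2] &
      forall xi, xi != 0 ->
        cintegral lebesgue_measure `]0, +oo[
          (fun t : R => fourier phi (t *: xi) / t%:C) = 1].

End complex_functions.

Section log_miyachi.
Context {R : realType} {d : nat}.
Variable gamma : R.

Definition rho (r : R) : R := r / ln r `^ (gamma - 1).

Definition a_scale (t : R) : R := t * ln t^-1 `^ (gamma - 1).

(* The ball B is given by its centre c and its radius r. *)
Definition log_subdyadic (R0 c0 C0 : R) (c : 'rV[R]_d) (r : R) : Prop :=
  let RB := dist0 (eball c r) in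
  [/\ 0 < r, R0 <= RB & c0 * rho RB <= r <= C0 * rho RB].

Definition adapted_bump (C1 : R) (Cnu : {ffun 'I_d -> nat} -> R) (N : nat)
    (c : 'rV[R]_d) (r : R) (Psi : 'rV[R]_d -> R[i]) : Prop :=
  [/\ smooth Psi, compact (supp Psi), supp Psi `<=` eball c (C1 * r) &
      forall nu : {ffun 'I_d -> nat}, (mdeg nu <= N)%N ->
        forall x, Normc.normc (mderiv nu Psi x) <= Cnu nu * r ^- mdeg nu].

Definition log_miyachi (beta sigma R0 c0 C0 C1 : R)
    (Cnu : {ffun 'I_d -> nat} -> R) (N : nat) (Cm : R)
    (m : 'rV[R]_d -> R[i]) : Prop :=
  forall (c : 'rV[R]_d) (r : R) (Psi : 'rV[R]_d -> R[i]) (theta : R),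
    log_subdyadic R0 c0 C0 c r -> adapted_bump C1 Cnu N c r Psi ->
    0 <= theta <= sigma ->
    let RB := dist0 (eball c r) in
    ((ln RB `^ beta * rho RB `^ theta)%:E
      * lebesgue_rV d (eball c r) `^ (- 2^-1)
      * hsobolev theta (fun xi => m xi * Psi xi)%R <= Cm%:E)%E.

Variables (phi : 'rV[R]_d -> R[i]) (t0 : R).

Definition g_log (beta : R) (f : 'rV[R]_d -> R[i]) (x : 'rV[R]_d) : \bar R :=
  ((\int[lebesgue_measure]_(t in `]0%R, t0[)
     \int[lebesgue_rV d]_(y in [set y | (enorm (y - x) <= a_scale t)%R])
       (Normc.normc (convolution f (dilation phi t) y) ^+ 2 / a_scale t ^+ d
         * ln t^-1 `^ (2 * beta) / t)%:E) `^ 2^-1)%E.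

Definition g_log_star (beta lambda : R) (f : 'rV[R]_d -> R[i])
    (x : 'rV[R]_d) : \bar R :=
  ((\int[lebesgue_measure]_(t in `]0%R, t0[)
     \int[lebesgue_rV d]_y
       (Normc.normc (convolution f (dilation phi t) y) ^+ 2
         * (1 + enorm (x - y) / a_scale t) `^ (- (d%:R * lambda))
         / a_scale t ^+ d
         * ln t^-1 `^ (2 * beta) / t)%:E) `^ 2^-1)%E.

End log_miyachi.

(* Main.v *)
(** Fix a scale t, put a = a_gamma(t), translate x to 0, and let E be the
    translate of f * phi_t, so that T_m f * phi_t becomes the inverse Fourier
    transform G of m E^.  Let h be a smooth bump, h_a(z) = h(a z), and
    U(xi) = int m(eta) E^(eta) h_a(xi - eta)^2 d eta.

    - The inverse transform of U is G times that of h_a^2, which is at least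
      c a^-d on the ball |y| <= a.  So by the L^2 bound for the Fourier transform
      a^-2d int_{|y| <= a} |G|^2 is controlled by int |U|^2.
    - By the multiplication formula U(xi) is the integral of
      FT(m h_a(xi - .)) b_xi, where b_xi has Fourier transform h_a(xi - .) E^.
      Cauchy-Schwarz with the weight (1 + |y|/a)^(2 sigma) splits off a factor
      bounded by the Miyachi condition with theta = 0 and theta = sigma; it is
      only needed for |xi| comparable to 1/t, where a log-subdyadic ball of
      radius comparable to 1/a is centred at xi.
    - For fixed y, b_xi(y) is the inverse transform in xi of
      z |-> H_a(z) E(y - z), where H_a has Fourier transform h_a.  The L^2 bound
      in xi, Tonelli and the submultiplicativity of the weight bound the
      remaining factor by a^-d int |E|^2 (1 + |y|/a)^(-2 sigma).

    The L^2 bound int |u^|^2 <= C int |u|^2 for integrable u suffices and follows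
    from the positive Fejer kernel, whose Fourier transform is explicit. *)

(* The window enters [U] squared because it must localise twice: one factor stays with m, where the
   Miyachi condition can be tested, the other goes to E^, where it produces b_xi. Its width [eps]
   obeys three bounds: the window must fit in the dilate C1 B of a log-subdyadic ball B of radius c0
   rho; the phase 2 pi y.eta must stay small for |y| <= a, so that no cancellation occurs in the
   inverse transform of h_a^2; and |xi| may move by at most 1/(8t) from the annulus seen by phi_t.
   As the constants [Cnu] of a normalized bump are prescribed, the window is tested after
   multiplication by a small constant.

   Two obstacles shape the rest. The inner integrals are not shown to be measurable in t, and m is
   only almost everywhere equal to a Borel function; hence the inequalities for integrals of
   arbitrary nonnegative functions and the passage to a Borel version of m. And T_m f is not known
   to be integrable, so its convolution with phi_t is computed by the multiplication formula. The
   mass of the Fejer kernel is carried along as a positive constant. *)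
Require Import Defs.
From mathcomp Require Import all_boot all_order all_algebra.
From mathcomp Require Import all_classical all_reals all_analysis.
From HB Require Import structures.
From mathcomp Require Import measurable_realfun.
From mathcomp Require Import complex.
From mathcomp Require Import ring lra.

Set Implicit Arguments.
Unset Strict Implicit.
Unset Printing Implicit Defensive.
Import Order.TTheory GRing.Theory Num.Theory.
Import numFieldNormedType.Exports.
Import complex.

Local Open Scope classical_set_scope.
Local Open Scope ring_scope.
Local Open Scope complex_scope.
Local Notation normc := Normc.normc.

(** * Lebesgue measure on row vectors *)

(* [lebesgue_measure] lives on [measurableTypeR R]; this copy lives on the
   canonical measurable structure of [R], as needed to form products. *)
Definition leb1 {R : realType} : set R -> \bar R := lebesgue_measure.

Section leb1_measure.
Context {R : realType}.

Let leb1_0 : @leb1 R set0 = 0%E. Proof. exact: measure0. Qed.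

Let leb1_ge0 (A : set R) : (0 <= leb1 A)%E. Proof. exact: measure_ge0. Qed.

Let leb1_sigma_additive : semi_sigma_additive (@leb1 R).
Proof. exact: (@measure_semi_sigma_additive _ _ _ (@lebesgue_measure R)). Qed.

HB.instance Definition _ := isMeasure.Build _ R R (@leb1 R)
  leb1_0 leb1_ge0 leb1_sigma_additive.

Let leb1_sigma_finite : sigma_finite setT (@leb1 R).
Proof. exact: (@sigma_finiteT _ _ _ (@lebesgue_measure R)). Qed.

HB.instance Definition _ := Measure_isSigmaFinite.Build _ R R (@leb1 R)
  leb1_sigma_finite.

End leb1_measure.

Section lebesgue_line.
Context {R : realType}.
Notation mu := (@leb1 R).

Lemma measurable_affine (c v : R) : measurable_fun setT (fun s : R => c * s + v).
Proof. by apply: measurable_funD => //; apply: measurable_funM. Qed.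

Lemma preimage_affine_itvoc (c v a b : R) : c != 0 ->
  (`|c|%:E * mu ((fun s : R => (c * s + v)%R) @^-1` `]a, b]) = mu `]a, b])%E.
Proof.
move=> c0; rewrite /leb1 [lebesgue_measure `]a, b]]lebesgue_measure_itv/= lte_fin.
have [c_gt0|c_lt0|c0'] := ltgtP 0 c; last by rewrite -c0' eqxx in c0.
- have -> : (fun s : R => (c * s + v)%R) @^-1` `]a, b] = `](a - v) / c, (b - v) / c]%classic.
    by apply/seteqP; split => s /=; rewrite !in_itv/= ltr_pdivrMr// ler_pdivlMr// ltrBlDr lerBrDr (mulrC s).
  rewrite lebesgue_measure_itv/= lte_fin ltr_pM2r ?invr_gt0// ltrD2r.
  case: ifPn => ab; last by rewrite mule0.
  rewrite -!EFinD -EFinM; congr EFin; rewrite gtr0_norm//; field.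
  by rewrite gt_eqF.
- have -> : (fun s : R => (c * s + v)%R) @^-1` `]a, b] = `[(b - v) / c, (a - v) / c[%classic.
    by apply/seteqP; split => s /=; rewrite !in_itv/= ltr_ndivlMr// ler_ndivrMr// ltrBlDr lerBrDr (mulrC s) andbC.
  rewrite lebesgue_measure_itv/= lte_fin ltr_nM2r ?invr_lt0// ltrD2r.
  case: ifPn => ab; last by rewrite mule0.
  rewrite -!EFinD -EFinM; congr EFin; rewrite ltr0_norm//; field.
  by rewrite lt_eqF.
Qed.

(** Uniqueness of Lebesgue measure: the rescaled pushforward has the right value on half-open
    intervals. For [c < 0] their preimages are open at the other end, which changes no length. *)
Lemma leb1_affine (c v : R) (A : set R) : c != 0 -> measurable A ->
  (`|c|%:E * pushforward mu (fun s : R => c * s + v)%R A = mu A)%E.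
Proof.
move=> c0 mA.
have nc : 0 <= `|c| by [].
have mf : measurable_fun setT
    (fun s : measurableTypeR R => (c * s + v : measurableTypeR R)).
  exact: measurable_affine.
pose nu : {measure set (measurableTypeR R) -> \bar R} := mscale (NngNum nc)
  (measure_function_pushforward__canonical__measure_function_Measure
    (@lebesgue_measure R) mf).
apply/esym/(lebesgue_measure_unique (mu := nu)) => //.
move=> X [[a b] _ <-] /=; rewrite /nu/= /mscale/= /pushforward/=.
exact/esym/preimage_affine_itvoc.
Qed.

Lemma ge0_integral_leb1_affine (c v : R) (f : R -> \bar R) : c != 0 ->
  measurable_fun setT f -> (forall s, 0 <= f s)%E ->
  (`|c|%:E * \int[mu]_s f (c * s + v)%R = \int[mu]_s f s)%E.
Proof.
move=> c0 mf f0.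
have nc : 0 <= `|c| by [].
have mphi : measurable_fun setT (fun s : R => (c * s + v : R)).
  exact: measurable_affine.
have := @ge0_integral_pushforward _ _ (R) (R) R _ mphi mu setT f measurableT mf (fun y _ => f0 y).
rewrite preimage_setT => <-.
have := @ge0_integral_mscale _ (R) R
  (measure_function_pushforward__canonical__measure_function_Measure mu mphi)
  setT measurableT (NngNum nc) f mf (fun x _ => f0 x).
move=> /= <-.
by apply: eq_measure_integral => A mA _; exact: leb1_affine.
Qed.

End lebesgue_line.

(** A bare set function convertible to [lebesgue_rV n], to which the measure and sigma-finite
    structures are attached as instances. *)
Definition leb (R : realType) (n : nat) : set 'rV[R]_n -> \bar R := lebesgue_rV n.
Arguments leb {R} n _.

Section lebesgue_rV_theory.
Context {R : realType}.
Notation mu := (@leb1 R).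

HB.instance Definition _ n := Measure.copy (@leb R n) (lebesgue_rV n).

Definition unconsrV n (x : 'rV[R]_n.+1) : 'rV[R]_n * R :=
  (\row_i x ord0 (lift ord0 i), x ord0 ord0).

Lemma consrVK n : cancel (@consrV R n) (@unconsrV n).
Proof.
move=> [p s]; rewrite /unconsrV /consrV mxE unlift_none; congr pair.
by apply/rowP => i; rewrite !mxE liftK.
Qed.

Lemma measurable_unconsrV n : measurable_fun setT (@unconsrV n).
Proof.
apply/measurable_fun_pairP; split => /=; last exact: measurable_coordrV.
apply: measurable_fun_rV => i /=.
by under eq_fun do rewrite mxE; exact: measurable_coordrV.
Qed.

(** Products of two exhausting sequences, transported by the inverse map [unconsrV], exhaust the
    space by sets of finite measure. *)
Lemma pushforward_consrV_sigma_finite n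
    (m1 : {sigma_finite_measure set 'rV[R]_n -> \bar R}) :
  sigma_finite setT (pushforward (m1 \x mu)%E (@consrV R n)).
Proof.
have /sigma_finiteP[F [FT ndF Foo]] := sigma_finiteT m1.
have /sigma_finiteP[G [GT ndG Goo]] := @sigma_finiteT _ _ _ mu.
exists (fun k => @unconsrV n @^-1` (F k `*` G k)).
  apply/seteqP; split => // x _.
  have [i _ Fi] : (\bigcup_i F i) (unconsrV x).1 by rewrite -FT.
  have [j _ Gj] : (\bigcup_i G i) (unconsrV x).2 by rewrite -GT.
  exists (maxn i j) => //; split.
  - by move: Fi; apply/subsetPset/ndF/leq_maxl.
  - by move: Gj; apply/subsetPset/ndG/leq_maxr.
move=> k; have [mF Fk] := Foo k; have [mG Gk] := Goo k; split.
  rewrite -[X in measurable X]setTI; apply: measurable_unconsrV => //.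
  exact: measurableX.
rewrite /pushforward -comp_preimage.
rewrite (_ : unconsrV (n:=n) \o consrV (n:=n) = id) ?preimage_id; last first.
  by apply/funext => p /=; rewrite consrVK.
by rewrite product_measure1E// lte_mul_pinfty// ge0_fin_numE.
Qed.

Lemma leb_sigma_finite n : sigma_finite setT (@leb R n).
Proof.
elim: n => [|n IHn].
  exists (fun=> setT); first by rewrite bigcup_const.
  by move=> i; split => //; rewrite /leb/= diracE in_setT ltry.
pose m1 : {sigma_finite_measure set 'rV[R]_n -> \bar R} :=
  HB.pack (leb n) (Measure_isSigmaFinite.Build _ _ _ (leb n) IHn).
exact: (pushforward_consrV_sigma_finite m1).
Qed.

HB.instance Definition _ n := Measure_isSigmaFinite.Build _ _ _ (@leb R n) (leb_sigma_finite n).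

(** Transfer along [consrV], then Tonelli: the coordinate of index 0 is split off as the inner
    variable. *)
Lemma ge0_integral_lebS n (f : 'rV[R]_n.+1 -> \bar R) :
  measurable_fun setT f -> (forall x, 0 <= f x)%E ->
  (\int[leb n.+1]_x f x = \int[leb n]_p \int[mu]_s f (consrV (p, s)))%E.
Proof.
move=> mf f0.
have mc : measurable_fun setT (f \o @consrV R n).
  by apply: measurableT_comp => //; exact: measurable_consrV.
rewrite -(fubini_tonelli1 (m1 := @leb R n) (m2 := mu) (f \o @consrV R n))//; last by move=> ?; exact: f0.
rewrite -[setT in RHS](preimage_setT (@consrV R n)).
rewrite -(@ge0_integral_pushforward _ _ _ _ R _ (@measurable_consrV R n) (leb n \x mu)%E setT f)//.
Qed.

Lemma measurable_scalerD n (c : R) (v : 'rV[R]_n) :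
  measurable_fun setT (fun x : 'rV[R]_n => c *: x + v).
Proof.
apply: measurable_fun_rV => i; under eq_fun do rewrite !mxE.
apply: measurable_funD => //; apply: measurable_funM => //.
exact: measurable_coordrV.
Qed.

(** Induction on the dimension: one factor [|c|] is absorbed by the inner integral over the
    split-off coordinate, the others by the outer integral. *)
Lemma ge0_integral_leb_affine n (c : R) (v : 'rV[R]_n) (f : 'rV[R]_n -> \bar R) :
  c != 0 -> measurable_fun setT f -> (forall s, 0 <= f s)%E ->
  ((`|c| ^+ n)%:E * \int[leb n]_s f (c *: s + v)%R = \int[leb n]_s f s)%E.
Proof.
move=> c0; elim: n v f => [|n IHn] v f mf f0.
  by rewrite expr0 mul1e; apply: eq_integral => x _; congr f; apply/rowP => -[].
have mfc : measurable_fun setT (fun x : 'rV[R]_n.+1 => f (c *: x + v)).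
  by apply: measurableT_comp => //; exact: measurable_scalerD.
rewrite !ge0_integral_lebS//; last first.
pose v' : 'rV[R]_n := (unconsrV v).1; pose v0 := v ord0 ord0.
have mf2 : measurable_fun setT (fun p : 'rV[R]_n * R => f (consrV p)).
  by apply: measurableT_comp => //; exact: measurable_consrV.
pose g (p : 'rV[R]_n) : \bar R := (\int[mu]_s f (consrV (p, s)))%E.
have g0 p : (0 <= g p)%E by apply: integral_ge0 => s _; exact: f0.
have mg : measurable_fun setT g.
  by apply: (measurable_fun_fubini_tonelli_F (m2 := mu) (fun p => f (consrV p))) => // p; exact: f0.
transitivity (\int[leb n]_p g p)%E; last by [].
rewrite -(IHn v' g mg g0) exprSr EFinM -muleA.
have E p : (`|c|%:E * \int[mu]_s f (c *: consrV (p, s) + v)%R = g (c *: p + v')%R)%E.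
  rewrite /g -(@ge0_integral_leb1_affine R c v0 (fun s => f (consrV (c *: p + v', s))))//; last first.
    apply: (@measurableT_comp _ _ _ _ _ _ (fun p => f (consrV p)) _ (fun s => (_, s))) => //.
    exact: pair1_measurable.
  congr (_ * _)%E; apply: eq_integral => s _; congr f; apply/rowP => i.
  by rewrite !mxE; case: unliftP => [j ->|->] /=; rewrite ?mxE.
rewrite -ge0_integralZl//; last 2 first.
- apply: (measurable_fun_fubini_tonelli_F (m2 := mu) (fun p => f (c *: consrV p + v))) => //.
  by apply: (measurableT_comp mfc); exact: measurable_consrV.
- by move=> x _; apply: integral_ge0 => s _; exact: f0.
by congr (_ * _)%E; apply: eq_integral => p _; exact: E.
Qed.

Lemma ge0_integral_prod n (f : 'I_n -> R -> R) :
  (forall i, measurable_fun setT (f i)) -> (forall i s, 0 <= f i s) ->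
  (\int[leb n]_x (\prod_(i < n) f i (x ord0 i))%:E = \prod_(i < n) \int[mu]_s (f i s)%:E)%E.
Proof.
elim: n f => [|n IHn] f mf f0.
  rewrite big_ord0; under eq_integral do rewrite big_ord0.
  rewrite (integral_cst (leb 0) measurableT 1) mul1e.
  by rewrite -[LHS]/(dirac (0 : 'rV[R]_0) setT) diracE in_setT.
have mp k (h : 'I_k -> R -> R) : (forall i, measurable_fun setT (h i)) ->
    measurable_fun setT (fun x : 'rV[R]_k => \prod_(i < k) h i (x ord0 i)).
  move=> mh; apply: measurable_prod => i _.
  by apply: measurableT_comp => //; exact: measurable_coordrV.
rewrite ge0_integral_lebS//; last 2 first.
- by apply/measurable_EFinP; exact: (mp _ f).
- by move=> x; rewrite lee_fin; apply: prodr_ge0.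
rewrite big_ord_recl -IHn//.
rewrite -ge0_integralZl//; last 3 first.
- by apply/measurable_EFinP; exact: (mp _ (fun i => f (lift ord0 i))).
- by move=> x _; rewrite lee_fin; apply: prodr_ge0.
- by apply: integral_ge0 => s _; rewrite lee_fin.
apply: eq_integral => p _.
rewrite muleC -ge0_integralZl//; last 3 first.
- exact/measurable_EFinP.
- by move=> s _; rewrite lee_fin.
- by rewrite lee_fin; apply: prodr_ge0.
apply: eq_integral => s _; rewrite -EFinM; congr EFin.
rewrite big_ord_recl mulrC !mxE unlift_none; congr (_ * _).
by apply: eq_bigr => i _; rewrite !mxE liftK.
Qed.

Lemma measurable_ball_rV n (c : 'rV[R]_n) (e : R) : measurable (ball c e).
Proof.
have [e0|e0] := leP e 0.
  suff -> : ball c e = set0 by [].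
  by apply/seteqP; split => // x [] /(le_lt_trans e0); rewrite ltxx.
have -> : ball c e = \bigcap_(i in [set: 'I_n])
    ((fun x : 'rV[R]_n => x ord0 i) @^-1` ball (c ord0 i) e).
  apply/seteqP; split=> x /=; first by move=> [_ cx] i _; exact: cx.
  by move=> cx; split => // i j; rewrite !ord1; exact: cx.
apply: fin_bigcap_measurable => // i _.
by rewrite -[X in measurable X]setTI; apply: measurable_coordrV => //; exact: measurable_ball.
Qed.

(** The sigma-algebra is generated by the coordinates, so open sets must be reached by countable
    operations: an open set is the union of the sup-norm balls with rational centre and radius
    1/(k+1) that it contains. *)
Lemma open_measurable_rV n (O : set 'rV[R]_n) : open O -> measurable O.
Proof.
move=> oO.
pose F (q : 'rV[rat]_n * nat) : set 'rV[R]_n :=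
  let B := ball (map_mx (@ratr R) q.1) q.2.+1%:R^-1 in
  if `[< B `<=` O >] then B else set0.
have -> : O = \bigcup_q F q.
  apply/seteqP; split => [x Ox|x [q _]]; last first.
    by rewrite /F; case: ifPn => // /asboolP BO /BO.
  have /nbhs_ballP[e /= e0 xeO] : nbhs x O by rewrite nbhsE/=; exists O.
  pose k := Num.truncn (2 / e).
  have ke : k.+1%:R^-1 + k.+1%:R^-1 < e.
    by rewrite -mulr2n -[X in X < _]mulr_natl ltr_pdivrMr// mulrC -ltr_pdivrMr// truncnS_gt.
  have k0 : 0 < k.+1%:R^-1 :> R by rewrite invr_gt0.
  have /choice[q qx] (i : 'I_n) : exists q : rat, ball (x ord0 i) k.+1%:R^-1 (ratr q).
    have [|q] := @rat_in_itvoo R (x ord0 i - k.+1%:R^-1) (x ord0 i + k.+1%:R^-1).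
      by rewrite ltrBlDr -addrA ltrDl addr_gt0.
    by move=> qx; exists q; rewrite ball_itv/= .
  pose Q := \row_i q i.
  have xQ : ball x k.+1%:R^-1 (map_mx (@ratr R) Q).
    by split => // i j; rewrite !mxE ord1; exact: qx.
  have QO : ball (map_mx (@ratr R) Q) k.+1%:R^-1 `<=` O.
    move=> y Qy; apply: xeO; apply: (le_ball (ltW ke)).
    exact: ball_triangle xQ Qy.
  exists (Q, k) => //; rewrite /F/= asboolT//.
  exact: ball_sym.
apply: countable_bigcupT_measurable => // q; rewrite /F.
by case: ifPn => // _; exact: measurable_ball_rV.
Qed.

Lemma continuous_measurable_rV n (f : 'rV[R]_n -> R) :
  continuous f -> measurable_fun setT f.
Proof.
move=> /continuousP cf; apply: (measurability _ (RGenOpens.measurableE R)) => //.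
move=> _ [_ [a [b ->] <-]]; rewrite setTI.
by apply: open_measurable_rV; apply: cf; exact: interval_open.
Qed.

End lebesgue_rV_theory.

(** * Complex-valued integrals *)

Section complex_norm.
Context {R : realType}.
Implicit Types z w : R[i].

Lemma normc_ge0 z : 0 <= normc z.
Proof. by case: z => a b; exact: sqrtr_ge0. Qed.

Lemma normc_sqrtE z : normc z = Num.sqrt (Re z ^+ 2 + Im z ^+ 2).
Proof. by case: z. Qed.

Lemma sqr_normcE z : normc z ^+ 2 = Re z ^+ 2 + Im z ^+ 2.
Proof. by rewrite normc_sqrtE sqr_sqrtr// addr_ge0// sqr_ge0. Qed.

Lemma normc_conjc z : normc z^* = normc z.
Proof. by case: z => a b /=; rewrite sqrrN. Qed.

Lemma normc_realc (a : R) : normc a%:C = `|a|.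
Proof. by rewrite normc_sqrtE/= expr0n/= addr0 sqrtr_sqr. Qed.

Lemma normc_expi (a : R) : normc (expi a) = 1.
Proof. by rewrite normc_sqrtE/= cos2Dsin2 sqrtr1. Qed.

Lemma abs_Re_le z : `|Re z| <= normc z.
Proof. by rewrite normc_sqrtE -sqrtr_sqr ler_wsqrtr// lerDl sqr_ge0. Qed.

Lemma abs_Im_le z : `|Im z| <= normc z.
Proof. by rewrite normc_sqrtE -sqrtr_sqr ler_wsqrtr// lerDr sqr_ge0. Qed.

Lemma Re_le_normc z : Re z <= normc z.
Proof. exact: le_trans (ler_norm _) (abs_Re_le z). Qed.

Lemma normc_le_ReIm z : normc z <= `|Re z| + `|Im z|.
Proof.
rewrite normc_sqrtE -[leRHS](@ger0_norm R); last by rewrite addr_ge0.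
rewrite -sqrtr_sqr ler_wsqrtr// sqrrD !real_normK ?num_real//.
by rewrite addrAC lerDl mulrn_wge0// mulr_ge0.
Qed.

Lemma normcX z n : normc (z ^+ n) = normc z ^+ n.
Proof. by elim: n => [|n IH]; rewrite ?Normc.normc1// !exprS Normc.normcM IH. Qed.

Lemma normc_prod n (f : 'I_n -> R[i]) :
  normc (\prod_(i < n) f i) = \prod_(i < n) normc (f i).
Proof.
elim: n f => [|n IH] f; first by rewrite !big_ord0 Normc.normc1.
by rewrite !big_ord_recl Normc.normcM IH.
Qed.

Lemma normc_opp (z : R[i]) : normc (- z) = normc z.
Proof. exact: (@complex.normcN R z). Qed.

Lemma ler_normcD (z w : R[i]) : normc (z + w) <= normc z + normc w.
Proof. exact: (@le_normcD R z w). Qed.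

Lemma expiD (a b : R) : expi (a + b) = expi a * expi b.
Proof. by rewrite /expi cosD sinD; simpc; congr (_ +i* _); ring. Qed.

Lemma expi0 : expi (0 : R) = 1.
Proof. by rewrite /expi cos0 sin0. Qed.

Lemma conj_expi (a : R) : (expi a)^* = expi (- a).
Proof. by rewrite /expi/= cosN sinN. Qed.

Lemma Re_mulc z w : Re (z * w) = Re z * Re w - Im z * Im w.
Proof. by case: z w => a b [c e]. Qed.

Lemma Im_mulc z w : Im (z * w) = Re z * Im w + Im z * Re w.
Proof. by case: z w => a b [c e] /=; rewrite (mulrC b). Qed.

Lemma Re_addc z w : Re (z + w) = Re z + Re w.
Proof. by case: z w => a b [c e]. Qed.

Lemma Im_addc z w : Im (z + w) = Im z + Im w.
Proof. by case: z w => a b [c e]. Qed.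

Lemma Re_oppc z : Re (- z) = - Re z. Proof. by case: z. Qed.
Lemma Im_oppc z : Im (- z) = - Im z. Proof. by case: z. Qed.

Lemma mulc_conj z : z * z^* = (normc z ^+ 2)%:C.
Proof. by rewrite sqr_normcE; case: z => a b; simpc; congr (_ +i* _); ring. Qed.

End complex_norm.

(** * Integrals of nonnegative functions that may fail to be measurable *)

Section integral_nonmeasurable.
Context d (T : measurableType d) (R : realType).
Variable mu : {measure set T -> \bar R}.
Import HBNNSimple.
Local Open Scope ereal_scope.

(* The integral of a nonnegative function is a supremum over simple functions
   below it, so monotonicity and scaling need no measurability. *)
Lemma ge0_le_integralT (f g : T -> \bar R) :
  (forall x, 0 <= f x) -> (forall x, f x <= g x) ->
  \int[mu]_x f x <= \int[mu]_x g x.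
Proof.
move=> f0 fg; have g0 x : 0 <= g x by exact: le_trans (fg x).
rewrite !ge0_integralTE//; apply: le_ereal_sup => _ [h hf <-]; exists h => //= x.
exact: le_trans (hf x) (fg x).
Qed.

Lemma ge0_le_integralS (D : set T) (f g : T -> \bar R) :
  (forall x, D x -> 0 <= f x) -> (forall x, D x -> f x <= g x) ->
  \int[mu]_(x in D) f x <= \int[mu]_(x in D) g x.
Proof.
move=> f0 fg; rewrite integral_mkcond [leRHS]integral_mkcond.
apply: ge0_le_integralT => x; rewrite !patchE; case: ifPn => // /set_mem.
  exact: f0.
exact: fg.
Qed.

Lemma ge0_integralZl_le (c : R) (f : T -> \bar R) : (0 < c)%R ->
  (forall x, 0 <= f x) ->
  \int[mu]_x (c%:E * f x) <= c%:E * \int[mu]_x f x.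
Proof.
move=> c0 f0; rewrite !ge0_integralTE//; last first.
  by move=> x; rewrite mule_ge0// lee_fin ltW.
apply: ge_ereal_sup => _ [h hf <-].
have ci0 : (0 <= c^-1)%R by rewrite invr_ge0 ltW.
pose h' : {nnsfun T >-> R} := scale_nnsfun h ci0.
have -> : sintegral mu h = c%:E * sintegral mu h'.
  rewrite -sintegralrM; apply: eq_sintegral => x /=.
  by rewrite mulrA divff ?mul1r// gt_eqF.
rewrite lee_pmul2l//; apply: ereal_sup_ubound; exists h' => //= x.
rewrite -(@lee_pmul2l _ c%:E)// -EFinM mulrA divff ?gt_eqF// mul1r.
exact: hf.
Qed.

Lemma ge0_integralZl_leS (D : set T) (c : R) (f : T -> \bar R) : (0 < c)%R ->
  (forall x, D x -> 0 <= f x) ->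
  \int[mu]_(x in D) (c%:E * f x) <= c%:E * \int[mu]_(x in D) f x.
Proof.
move=> c0 f0; rewrite integral_mkcond [X in _ * X]integral_mkcond.
apply: le_trans (ge0_integralZl_le c0 _); last first.
  by move=> x; rewrite patchE; case: ifPn => // /set_mem; exact: f0.
apply: ge0_le_integralT => x; rewrite !patchE; case: ifPn => //.
- by move=> /set_mem Dx; rewrite mule_ge0 ?f0// lee_fin ltW.
- by move=> _; rewrite mule0.
Qed.

(** A simple function below [f] keeps its integral when it is set to 0 on the exceptional null set,
    and the result lies below [g]. *)
Let ge0_ae_eq_integral_le (f g : T -> \bar R) :
  (forall x, 0 <= f x) -> (forall x, 0 <= g x) ->
  {ae mu, forall x, f x = g x} -> \int[mu]_x f x <= \int[mu]_x g x.
Proof.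
move=> f0 g0 [N [mN N0 fgN]]; rewrite !ge0_integralTE//.
apply: ge_ereal_sup => _ [h hf <-].
pose h' : {nnsfun T >-> R} := mul_nnsfun h (indic_nnsfun R (measurableC mN)).
have hh' : sintegral mu h = sintegral mu h'.
  rewrite -!integralT_nnsfun.
  apply: ge0_ae_eq_integral => //.
  - exact/measurable_EFinP.
  - exact/measurable_EFinP.
  - by move=> x _; rewrite lee_fin.
  - by move=> x _; rewrite lee_fin.
  exists N; split => // x /=; apply: contra_notP => Nx _ /=.
  by rewrite mindicE mem_set//= mulr1.
rewrite hh'; apply: ereal_sup_ubound; exists h' => //= x.
rewrite mindicE; case: (boolP (x \in ~` N)) => xN; last by rewrite mulr0.
rewrite mulr1; have <- : f x = g x; last exact: hf.
by move/set_mem: xN => xN; apply: contrapT => fgx; apply: xN; exact: fgN.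
Qed.

Lemma ae_eq_integralT (f g : T -> \bar R) :
  {ae mu, forall x, f x = g x} -> \int[mu]_x f x = \int[mu]_x g x.
Proof.
move=> fg.
have gf : {ae mu, forall x, g x = f x}.
  by apply: filterS fg.
have key (u v : T -> \bar R) : (forall x, 0 <= u x) -> (forall x, 0 <= v x) ->
    {ae mu, forall x, u x = v x} -> {ae mu, forall x, v x = u x} ->
    \int[mu]_x u x = \int[mu]_x v x.
  by move=> u0 v0 uv vu; apply/eqP; rewrite eq_le !ge0_ae_eq_integral_le.
rewrite integralE [RHS]integralE; congr (_ - _); apply: key => //.
- by apply: filterS fg => x fgx; rewrite !funeposE fgx.
- by apply: filterS gf => x fgx; rewrite !funeposE fgx.
- by apply: filterS fg => x fgx; rewrite !funenegE fgx.
- by apply: filterS gf => x fgx; rewrite !funenegE fgx.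
Qed.

End integral_nonmeasurable.

Section cintegral_theory.
Context d (T : measurableType d) (R : realType).
Implicit Types (f g : T -> R[i]) (mu : {measure set T -> \bar R}).

Definition cmeasurable f :=
  measurable_fun setT (fun x => Re (f x)) /\
  measurable_fun setT (fun x => Im (f x)).

Definition cintegrable mu f :=
  cmeasurable f /\ (\int[mu]_x (normc (f x))%:E < +oo)%E.

Lemma cmeasurable_normc f : cmeasurable f ->
  measurable_fun setT (fun x => normc (f x)).
Proof.
move=> [mr mi]; under eq_fun do rewrite normc_sqrtE.
apply: (@measurableT_comp _ _ _ _ _ _ (@Num.sqrt R)).
  by apply: continuous_measurable_fun; exact: sqrt_continuous.
by apply: measurable_funD; exact: measurable_funX.
Qed.

Lemma cmeasurable_cst (z : R[i]) : cmeasurable (fun=> z).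
Proof. by split; exact: measurable_cst. Qed.

Lemma cmeasurable_real (u : T -> R) :
  measurable_fun setT u -> cmeasurable (fun x => (u x)%:C).
Proof. by move=> mu; split => //=; exact: measurable_cst. Qed.

Lemma cmeasurableM f g : cmeasurable f -> cmeasurable g ->
  cmeasurable (fun x => f x * g x).
Proof.
move=> [fr fi] [gr gi]; split.
  under eq_fun do rewrite Re_mulc.
  by apply: measurable_funB; exact: measurable_funM.
under eq_fun do rewrite Im_mulc.
by apply: measurable_funD; exact: measurable_funM.
Qed.

Lemma cmeasurableD f g : cmeasurable f -> cmeasurable g ->
  cmeasurable (fun x => f x + g x).
Proof.
move=> [fr fi] [gr gi]; split.
  by under eq_fun do rewrite Re_addc; exact: measurable_funD.
by under eq_fun do rewrite Im_addc; exact: measurable_funD.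
Qed.

Lemma cmeasurableN f : cmeasurable f -> cmeasurable (fun x => - f x).
Proof.
move=> [fr fi]; split.
  by under eq_fun do rewrite Re_oppc; exact: measurableT_comp.
by under eq_fun do rewrite Im_oppc; exact: measurableT_comp.
Qed.

Lemma cmeasurable_conj f : cmeasurable f -> cmeasurable (fun x => (f x)^*).
Proof.
move=> [fr fi]; split.
  by rewrite (_ : (fun x => _) = (fun x => Re (f x)))//; apply/funext => x; case: (f x).
rewrite (_ : (fun x => _) = (fun x => - Im (f x))); last by apply/funext => x; case: (f x).
exact: measurableT_comp.
Qed.

Lemma cmeasurable_expi (u : T -> R) :
  measurable_fun setT u -> cmeasurable (fun x => expi (u x)).
Proof.
move=> mu; split => /=.
  apply: (measurableT_comp (f := cos)) => //.
  by apply: continuous_measurable_fun; exact: continuous_cos.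
apply: (measurableT_comp (f := sin)) => //.
by apply: continuous_measurable_fun; exact: continuous_sin.
Qed.

Context (mu : {measure set T -> \bar R}).

Lemma cintegrable_Re f : cintegrable mu f -> mu.-integrable setT (fun x => (Re (f x))%:E).
Proof.
move=> [[fr fi] fo]; apply/integrableP; split; first exact/measurable_EFinP.
apply: le_lt_trans fo; apply: ge0_le_integralT => x; first exact: abse_ge0.
by rewrite lee_fin abs_Re_le.
Qed.

Lemma cintegrable_Im f : cintegrable mu f -> mu.-integrable setT (fun x => (Im (f x))%:E).
Proof.
move=> [[fr fi] fo]; apply/integrableP; split; first exact/measurable_EFinP.
apply: le_lt_trans fo; apply: ge0_le_integralT => x; first exact: abse_ge0.
by rewrite lee_fin abs_Im_le.
Qed.

Lemma cintegrable_normc f : cintegrable mu f ->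
  mu.-integrable setT (fun x => (normc (f x))%:E).
Proof.
move=> [mf fo]; apply/integrableP; split.
  exact/measurable_EFinP/cmeasurable_normc.
apply: le_lt_trans fo; apply: ge0_le_integralT => x; first exact: abse_ge0.
by rewrite lee_fin ger0_norm// normc_ge0.
Qed.

Lemma cintegrable_le f g : cmeasurable f -> cintegrable mu g ->
  (forall x, normc (f x) <= normc (g x)) -> cintegrable mu f.
Proof.
move=> mf [mg go] fg; split => //; apply: le_lt_trans go.
by apply: ge0_le_integralT => x; rewrite lee_fin// normc_ge0.
Qed.

Lemma cintegrable_bounded_mul f g (M : R) : cmeasurable f -> cintegrable mu g ->
  (forall x, normc (f x) <= M) -> cintegrable mu (fun x => f x * g x).
Proof.
move=> mf [mg go] fM; split; first exact: cmeasurableM.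
apply: (@le_lt_trans _ _ (\int[mu]_x ((`|M| + 1)%:E * (normc (g x))%:E))%E).
  apply: ge0_le_integralT => x; rewrite -?EFinM lee_fin ?normc_ge0//.
  rewrite Normc.normcM ler_wpM2r ?normc_ge0// (le_trans (fM x))//.
  by rewrite (le_trans (ler_norm _))// lerDl.
apply: (le_lt_trans (ge0_integralZl_le _ _ _)).
- by rewrite ltr_wpDl.
- by move=> x; rewrite lee_fin normc_ge0.
by rewrite lte_mul_pinfty// lee_fin addr_ge0.
Qed.

Lemma cintegrable_conj f : cintegrable mu f -> cintegrable mu (fun x => (f x)^*).
Proof.
move=> [mf fo]; split; first exact: cmeasurable_conj.
by under eq_integral do rewrite normc_conjc.
Qed.

Lemma cintegrableN f : cintegrable mu f -> cintegrable mu (fun x => - f x).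
Proof.
move=> [mf fo]; split; first exact: cmeasurableN.
by under eq_integral do rewrite normc_opp.
Qed.

Lemma cintegrableD f g : cintegrable mu f -> cintegrable mu g ->
  cintegrable mu (fun x => f x + g x).
Proof.
move=> [mf fo] [mg go]; split; first exact: cmeasurableD.
apply: (@le_lt_trans _ _ (\int[mu]_x ((normc (f x))%:E + (normc (g x))%:E))%E).
  by apply: ge0_le_integralT => x; rewrite -?EFinD lee_fin ?normc_ge0// ler_normcD.
rewrite ge0_integralD//; last 4 first.
- by move=> x _; rewrite lee_fin normc_ge0.
- exact/measurable_EFinP/cmeasurable_normc.
- by move=> x _; rewrite lee_fin normc_ge0.
- exact/measurable_EFinP/cmeasurable_normc.
exact: lte_add_pinfty.
Qed.

Lemma cintegrableZ (z : R[i]) f : cintegrable mu f -> cintegrable mu (fun x => z * f x).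
Proof. by move=> fi; exact: cintegrable_bounded_mul (cmeasurable_cst z) fi (fun _ => lexx _). Qed.

Lemma cintegralE f : cintegral mu setT f =
  (\int[mu]_x Re (f x)) +i* (\int[mu]_x Im (f x)).
Proof. by []. Qed.

Lemma cintegralZ (z : R[i]) f : cintegrable mu f ->
  cintegral mu setT (fun x => z * f x) = z * cintegral mu setT f.
Proof.
move=> fi; have fr := cintegrable_Re fi; have fm := cintegrable_Im fi.
have ir (a : R) : mu.-integrable setT (EFin \o (fun x => a * Re (f x))).
  exact: (integrableZl measurableT a fr).
have ii (a : R) : mu.-integrable setT (EFin \o (fun x => a * Im (f x))).
  exact: (integrableZl measurableT a fm).
apply/eqP; rewrite eq_complex Re_mulc Im_mulc !cintegralE/=; apply/andP; split; apply/eqP.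
  under eq_Rintegral do rewrite Re_mulc.
  by rewrite RintegralB ?RintegralZl//.
under eq_Rintegral do rewrite Im_mulc.
by rewrite RintegralD ?RintegralZl//.
Qed.

Lemma cintegralD f g : cintegrable mu f -> cintegrable mu g ->
  cintegral mu setT (fun x => f x + g x) = cintegral mu setT f + cintegral mu setT g.
Proof.
move=> fi gi.
apply/eqP; rewrite eq_complex Re_addc Im_addc !cintegralE/=; apply/andP; split; apply/eqP.
  under eq_Rintegral do rewrite Re_addc.
  by rewrite RintegralD//; exact: cintegrable_Re.
under eq_Rintegral do rewrite Im_addc.
by rewrite RintegralD//; exact: cintegrable_Im.
Qed.

Lemma cintegral_conj f : cintegrable mu f ->
  cintegral mu setT (fun x => (f x)^*) = (cintegral mu setT f)^*.
Proof.
move=> fi; rewrite !cintegralE/=.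
have -> : \int[mu]_x Re (f x)^* = \int[mu]_x Re (f x).
  by apply: eq_Rintegral => x _; case: (f x).
have -> : \int[mu]_x Im (f x)^* = \int[mu]_x (-1 * Im (f x)).
  by apply: eq_Rintegral => x _; case: (f x) => a b /=; rewrite mulN1r.
by rewrite RintegralZl ?mulN1r//; exact: cintegrable_Im.
Qed.

(** Rotation: multiplying [f] by the conjugate of its integral z makes the integral real, so |z|^2
    is at most |z| times the integral of |f|. *)
Lemma normc_cintegral_le f : cintegrable mu f ->
  ((normc (cintegral mu setT f))%:E <= \int[mu]_x (normc (f x))%:E)%E.
Proof.
move=> fi; set z := cintegral mu setT f.
have [z0|z0] := eqVneq (normc z) 0.
  by rewrite z0; apply: integral_ge0 => x _; rewrite lee_fin normc_ge0.
have zp : 0 < normc z by rewrite lt_neqAle eq_sym z0 normc_ge0.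
have gi := cintegrableZ z^* fi.
have : normc z ^+ 2 = \int[mu]_x Re (z^* * f x).
  rewrite -[RHS]/(Re (cintegral mu setT (fun x => z^* * f x))) cintegralZ//.
  by rewrite -/z mulrC mulc_conj.
move=> E; rewrite -(@lee_pmul2l _ (normc z)%:E)// -EFinM -expr2 E.
have fm : measurable_fun setT (fun x => (normc (f x))%:E).
  by apply/measurable_EFinP/cmeasurable_normc; case: fi.
rewrite -ge0_integralZl//; last 2 first.
- by move=> x _; rewrite lee_fin normc_ge0.
- by rewrite lee_fin normc_ge0.
rewrite /Rintegral fineK; last exact/integrable_fin_num/cintegrable_Re.
apply: le_integral => //.
- exact: cintegrable_Re.
- apply: integrableZl => //; exact: cintegrable_normc.
- by move=> x _; rewrite -EFinM lee_fin (le_trans (Re_le_normc _))// Normc.normcM normc_conjc.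
Qed.

Lemma normc_cintegral_le_mul f (g : T -> R) : cmeasurable f ->
  mu.-integrable setT (EFin \o g) -> (forall x, normc (f x) <= g x) ->
  normc (cintegral mu setT f) <= \int[mu]_x g x.
Proof.
move=> mf gi fg.
have fo : (\int[mu]_x (normc (f x))%:E <= \int[mu]_x (g x)%:E)%E.
  by apply: ge0_le_integralT => x; rewrite lee_fin// normc_ge0.
rewrite -lee_fin (le_trans (normc_cintegral_le _))//.
  split => //; apply: (le_lt_trans fo); exact: integrable_lty.
by rewrite (le_trans fo)// /Rintegral fineK//; exact: integrable_fin_num.
Qed.

Lemma Rintegral_dominated_cvg (f_ : nat -> T -> R) (f g : T -> R) :
  (forall n, measurable_fun setT (f_ n)) -> measurable_fun setT f ->
  (forall x, f_ ^~ x @ \oo --> f x) ->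
  mu.-integrable setT (EFin \o g) -> (forall n x, `|f_ n x| <= g x) ->
  (fun n => \int[mu]_x f_ n x) @ \oo --> \int[mu]_x f x.
Proof.
move=> mf_ mf cf ig fg.
have [||||| fi _ H] := @dominated_convergence _ _ _ mu setT measurableT
  (fun n x => (f_ n x)%:E) (fun x => (f x)%:E) (EFin \o g).
- by move=> n; exact/measurable_EFinP.
- exact/measurable_EFinP.
- by apply: aeW => x _; apply/cvg_EFin; [exact: nearW|exact: cf].
- by [].
- by apply: aeW => x n _; rewrite lee_fin.
apply/fine_cvg; rewrite /Rintegral fineK//; exact: integrable_fin_num.
Qed.

End cintegral_theory.

Lemma cmeasurable_comp d (T : measurableType d) d' (T' : measurableType d')
    (R : realType) (h : T' -> T) (f : T -> R[i]) :
  measurable_fun setT h -> cmeasurable f -> cmeasurable (fun x => f (h x)).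
Proof.
by move=> mh [fr fi]; split; [exact: (measurableT_comp fr mh)|exact: (measurableT_comp fi mh)].
Qed.

(** * Fubini for real and complex integrands *)

Section cfubini.
Context d1 d2 (T1 : measurableType d1) (T2 : measurableType d2) (R : realType).
Variable m2 : {sigma_finite_measure set T2 -> \bar R}.

(** The positive and negative parts have measurable integrals by Tonelli, and [fine] is measurable,
    so sections that are not integrable do no harm. *)
Lemma measurable_Rintegral_section (k : T1 * T2 -> R) :
  measurable_fun setT k -> measurable_fun setT (fun x => \int[m2]_y k (x, y)).
Proof.
move=> mk; rewrite /Rintegral; apply: (measurableT_comp (fine_measurable measurableT)).
under eq_fun do rewrite integralE.
have mE : measurable_fun setT (EFin \o k) by exact/measurable_EFinP.
apply: emeasurable_funB.
- have := measurable_fun_fubini_tonelli_F (m2 := m2) (EFin \o k)^\+%E (measurable_funepos mE) (funepos_ge0 _).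
  congr measurable_fun; apply/funext => x; apply: eq_integral => y _.
  by rewrite !funeposE.
- have := measurable_fun_fubini_tonelli_F (m2 := m2) (EFin \o k)^\-%E (measurable_funeneg mE) (funeneg_ge0 _).
  congr measurable_fun; apply/funext => x; apply: eq_integral => y _.
  by rewrite !funenegE.
Qed.

Lemma cmeasurable_cintegral (k : T1 * T2 -> R[i]) : cmeasurable k ->
  cmeasurable (fun x => cintegral m2 setT (fun y => k (x, y))).
Proof.
move=> [kr ki]; split => /=.
  exact: (measurable_Rintegral_section kr).
exact: (measurable_Rintegral_section ki).
Qed.
End cfubini.

Section cfubini2.
Context d1 d2 (T1 : measurableType d1) (T2 : measurableType d2) (R : realType).
Variable m1 : {sigma_finite_measure set T1 -> \bar R}.
Variable m2 : {sigma_finite_measure set T2 -> \bar R}.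

(** Almost every section is integrable, and there [fine] loses nothing; its default value only
    matters on a null set. *)
Lemma Rintegral_fubini_F (k : T1 * T2 -> R) :
  (m1 \x m2)%E.-integrable setT (EFin \o k) ->
  (\int[m1]_x (\int[m2]_y k (x, y))%:E = \int[m1 \x m2]_z (k z)%:E)%E.
Proof.
move=> ik; have mk : measurable_fun setT k by apply/measurable_EFinP; exact: measurable_int ik.
rewrite -(integral12_prod_meas1 ik); apply: ae_eq_integral => //.
- by apply/measurable_EFinP; exact: measurable_Rintegral_section.
- exact: (measurable_fubini_F ik).
- have := integrable_ae measurableT (integrable_fubini_F ik).
  by apply: filterS => x /(_ I) xf _; rewrite /Rintegral fineK.
Qed.

Lemma Rintegral_fubini_G (k : T1 * T2 -> R) :
  (m1 \x m2)%E.-integrable setT (EFin \o k) ->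
  (\int[m2]_y (\int[m1]_x k (x, y))%:E = \int[m1 \x m2]_z (k z)%:E)%E.
Proof.
move=> ik; have mk : measurable_fun setT k by apply/measurable_EFinP; exact: measurable_int ik.
rewrite -(integral21_prod_meas1 ik); apply: ae_eq_integral => //.
- apply/measurable_EFinP.
  apply: (@measurable_Rintegral_section _ _ T2 T1 R m1 (fun z => k (z.2, z.1))).
  apply: (measurableT_comp mk); apply: measurable_fun_pair.
    exact: measurable_snd.
  exact: measurable_fst.
- exact: (measurable_fubini_G ik).
- have := ae_integrable2 ik.
  by apply: filterS => y iy _; rewrite /Rintegral fineK//; exact: integrable_fin_num.
Qed.

Lemma Rintegral_fubini (k : T1 * T2 -> R) :
  (m1 \x m2)%E.-integrable setT (EFin \o k) ->
  \int[m1]_x (\int[m2]_y k (x, y)) = \int[m2]_y (\int[m1]_x k (x, y)).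
Proof.
by move=> ik; rewrite {1}/Rintegral Rintegral_fubini_F// -Rintegral_fubini_G.
Qed.

Lemma cintegral_fubini (k : T1 * T2 -> R[i]) : cmeasurable k ->
  (\int[m1]_x \int[m2]_y (normc (k (x, y)))%:E < +oo)%E ->
  cintegral m1 setT (fun x => cintegral m2 setT (fun y => k (x, y))) =
  cintegral m2 setT (fun y => cintegral m1 setT (fun x => k (x, y))).
Proof.
move=> mk ko; have [mr mi] := mk.
have ir : (m1 \x m2)%E.-integrable setT (EFin \o (fun z => Re (k z))).
  apply/integrable12ltyP; first exact/measurable_EFinP.
  apply: le_lt_trans ko; apply: ge0_le_integralT => x.
    by apply: integral_ge0 => y _; exact: abse_ge0.
  by apply: ge0_le_integralT => y; rewrite ?abse_ge0//= lee_fin abs_Re_le.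
have ii : (m1 \x m2)%E.-integrable setT (EFin \o (fun z => Im (k z))).
  apply/integrable12ltyP; first exact/measurable_EFinP.
  apply: le_lt_trans ko; apply: ge0_le_integralT => x.
    by apply: integral_ge0 => y _; exact: abse_ge0.
  by apply: ge0_le_integralT => y; rewrite ?abse_ge0//= lee_fin abs_Im_le.
rewrite !cintegralE/=; congr (_ +i* _).
  exact: (Rintegral_fubini ir).
exact: (Rintegral_fubini ii).
Qed.

End cfubini2.

(** * Fourier transforms *)

Section measurable_euclidean.
Context {R : realType} d (T : measurableType d) (n : nat).

Lemma measurable_fun_rVD (u v : T -> 'rV[R]_n) :
  measurable_fun setT u -> measurable_fun setT v ->
  measurable_fun setT (fun t => u t + v t).
Proof.
move=> mu mv; apply: measurable_fun_rV => i; under eq_fun do rewrite mxE.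
by apply: measurable_funD; apply: (measurableT_comp (@measurable_coordrV R n i)).
Qed.

Lemma measurable_fun_rVZ (c : R) (u : T -> 'rV[R]_n) :
  measurable_fun setT u -> measurable_fun setT (fun t => c *: u t).
Proof.
move=> mu; apply: measurable_fun_rV => i; under eq_fun do rewrite mxE.
by apply: measurable_funM => //; apply: (measurableT_comp (@measurable_coordrV R n i)).
Qed.

Lemma measurable_fun_rVB (u v : T -> 'rV[R]_n) :
  measurable_fun setT u -> measurable_fun setT v ->
  measurable_fun setT (fun t => u t - v t).
Proof.
move=> mu mv; apply: measurable_fun_rVD => //.
by under eq_fun do rewrite -scaleN1r; exact: measurable_fun_rVZ.
Qed.

Lemma measurable_fun_dotrV (u v : T -> 'rV[R]_n) :
  measurable_fun setT u -> measurable_fun setT v ->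
  measurable_fun setT (fun t => dotrV (u t) (v t)).
Proof.
move=> mu mv; apply: measurable_sum => i.
by apply: measurable_funM; apply: (measurableT_comp (@measurable_coordrV R n i)).
Qed.

Lemma measurable_fun_enorm (u : T -> 'rV[R]_n) :
  measurable_fun setT u -> measurable_fun setT (fun t => enorm (u t)).
Proof.
move=> mu; apply: (@measurableT_comp _ _ _ _ _ _ (@Num.sqrt R)).
  by apply: continuous_measurable_fun; exact: sqrt_continuous.
exact: measurable_fun_dotrV.
Qed.

End measurable_euclidean.

(** * Scalar product and Euclidean norm *)

Section dot_theory.
Context {R : realType} {n : nat}.
Implicit Types x y z : 'rV[R]_n.

Lemma dotrVC x y : dotrV x y = dotrV y x.
Proof. by apply: eq_bigr => i _; rewrite mulrC. Qed.

Lemma dotrVDl x y z : dotrV (x + y) z = dotrV x z + dotrV y z.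
Proof. by rewrite -big_split; apply: eq_bigr => i _; rewrite mxE mulrDl. Qed.

Lemma dotrVZl (c : R) x y : dotrV (c *: x) y = c * dotrV x y.
Proof. by rewrite mulr_sumr; apply: eq_bigr => i _; rewrite mxE mulrA. Qed.

Lemma dotrVNl x y : dotrV (- x) y = - dotrV x y.
Proof. by rewrite -scaleN1r dotrVZl mulN1r. Qed.

Lemma dotrVDr x y z : dotrV x (y + z) = dotrV x y + dotrV x z.
Proof. by rewrite dotrVC dotrVDl !(dotrVC x). Qed.

Lemma dotrVZr (c : R) x y : dotrV x (c *: y) = c * dotrV x y.
Proof. by rewrite dotrVC dotrVZl (dotrVC x). Qed.

Lemma dotrVNr x y : dotrV x (- y) = - dotrV x y.
Proof. by rewrite dotrVC dotrVNl (dotrVC x). Qed.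

Lemma dotrV_ge0 x : 0 <= dotrV x x.
Proof. by apply: sumr_ge0 => i _; rewrite -expr2 sqr_ge0. Qed.

Lemma enorm_ge0 x : 0 <= enorm x. Proof. exact: sqrtr_ge0. Qed.

Lemma sqr_enorm x : enorm x ^+ 2 = dotrV x x.
Proof. by rewrite sqr_sqrtr// dotrV_ge0. Qed.

Lemma abs_dotrV_le x y : `|dotrV x y| <= enorm x * enorm y.
Proof.
rewrite -(@ler_pXn2r _ 2)// ?nnegrE ?mulr_ge0 ?enorm_ge0//.
rewrite exprMn !sqr_enorm real_normK ?num_real//.
(* This square is [dotrV y y] times the defect in the Cauchy-Schwarz inequality, so the case where
   [dotrV y y] vanishes is treated apart. *)
have := dotrV_ge0 (dotrV y y *: x - dotrV x y *: y).
rewrite !(dotrVDl, dotrVDr, dotrVNl, dotrVNr, dotrVZl, dotrVZr) (dotrVC y x) => H.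
have [y0|y0] := eqVneq (dotrV y y) 0.
  suff -> : dotrV x y = 0 by rewrite expr0n mulr_ge0 ?dotrV_ge0.
  apply: big1 => i _; suff -> : y ord0 i = 0 by rewrite mulr0.
  apply/eqP; rewrite -sqrf_eq0 expr2; apply/eqP; apply: (psumr_eq0P _ y0) => //.
  by move=> j _; rewrite -expr2 sqr_ge0.
have yp : 0 < dotrV y y by rewrite lt_neqAle eq_sym y0 dotrV_ge0.
rewrite -subr_ge0 -(pmulr_rge0 _ yp); move: H; congr (0 <= _); ring.
Qed.

Lemma ler_enormD x y : enorm (x + y) <= enorm x + enorm y.
Proof.
rewrite -(@ler_pXn2r _ 2)// ?nnegrE ?addr_ge0 ?enorm_ge0//.
rewrite sqrrD !sqr_enorm dotrVDl !dotrVDr (dotrVC y x).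
have := le_trans (ler_norm _) (abs_dotrV_le x y); lra.
Qed.

Lemma enormZ (c : R) x : enorm (c *: x) = `|c| * enorm x.
Proof. by rewrite /enorm dotrVZl dotrVZr mulrA -expr2 sqrtrM ?sqr_ge0// sqrtr_sqr. Qed.

Lemma enormN x : enorm (- x) = enorm x.
Proof. by rewrite -scaleN1r enormZ normrN1 mul1r. Qed.

Lemma enorm0 : enorm (0 : 'rV[R]_n) = 0.
Proof. by rewrite -(scale0r 0) enormZ normr0 mul0r. Qed.

Lemma abs_coord_le x i : `|x ord0 i| <= enorm x.
Proof.
rewrite -(@ler_pXn2r _ 2)// ?nnegrE ?enorm_ge0// sqr_enorm real_normK ?num_real//.
rewrite /dotrV (bigD1 i)//= -expr2 lerDl sumr_ge0// => j _.
by rewrite -expr2 sqr_ge0.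
Qed.

Lemma enorm_le_sum x : enorm x <= \sum_(i < n) `|x ord0 i|.
Proof.
rewrite -(@ler_pXn2r _ 2)// ?nnegrE ?enorm_ge0 ?sumr_ge0// sqr_enorm expr2 mulr_suml.
apply: ler_sum => i _; rewrite -expr2 -real_normK ?num_real// expr2.
by rewrite ler_wpM2l// (bigD1 i)//= lerDl sumr_ge0.
Qed.

(** Obtained through the l^1 norm, hence [n] instead of its square root. This is the source of the
    product [n%:R * eps] in all later conditions on the window. *)
Lemma enorm_le_coord x (M : R) : (forall i, `|x ord0 i| <= M) -> enorm x <= n%:R * M.
Proof.
move=> xM; rewrite (le_trans (enorm_le_sum x))// (le_trans (ler_sum _ (fun i _ => xM i)))//.
by rewrite sumr_const card_ord mulr_natl.
Qed.

End dot_theory.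

Section cintegral_affine.
Context {R : realType} {n : nat}.
Notation mu := (@leb R n).

Lemma Rintegral_affine (c : R) (v : 'rV[R]_n) (f : 'rV[R]_n -> R) : c != 0 ->
  mu.-integrable setT (EFin \o f) ->
  `|c| ^+ n * \int[mu]_x f (c *: x + v) = \int[mu]_x f x.
Proof.
move=> c0 fi; have mf := measurable_int _ fi.
have mA := @measurable_scalerD R n c v.
rewrite /Rintegral integralE [in RHS]integralE.
have fp := integrable_pos_fin_num measurableT fi.
have fn := integrable_neg_fin_num measurableT fi.
have cn : (`|c| ^+ n != 0) by rewrite expf_eq0 normr_eq0 (negbTE c0) andbF.
have cp : (0 < `|c| ^+ n) by rewrite exprn_gt0// normr_gt0.
have key (g : 'rV[R]_n -> \bar R) : measurable_fun setT g -> (forall x, 0 <= g x)%E ->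
    (\int[mu]_x g x)%E \is a fin_num ->
    (\int[mu]_x g (c *: x + v)%R = (`|c| ^- n)%:E * \int[mu]_x g x)%E.
  move=> mg g0 gfin; rewrite -(@ge0_integral_leb_affine R n c v g)// muleA -EFinM.
  by rewrite mulVf// mul1e.
have E1 : (\int[mu]_x (fun x => (f (c *: x + v)%R)%:E)^\+ x = (`|c| ^- n)%:E * \int[mu]_x (EFin \o f)^\+ x)%E.
  rewrite -key//; last exact: measurable_funepos.
  by apply: eq_integral => x _; rewrite !funeposE.
have E2 : (\int[mu]_x (fun x => (f (c *: x + v)%R)%:E)^\- x = (`|c| ^- n)%:E * \int[mu]_x (EFin \o f)^\- x)%E.
  rewrite -key//; last exact: measurable_funeneg.
  by apply: eq_integral => x _; rewrite !funenegE.
rewrite E1 E2 -(fineK fp) -(fineK fn) -!EFinM -!EFinB /= -mulrBr mulrA divff// mul1r.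
by [].
Qed.

Lemma cintegrable_affine (c : R) (v : 'rV[R]_n) (f : 'rV[R]_n -> R[i]) : c != 0 ->
  cintegrable mu f -> cintegrable mu (fun x => f (c *: x + v)).
Proof.
move=> c0 [mf fo]; split.
  by apply: cmeasurable_comp mf; exact: measurable_scalerD.
move: fo; rewrite -(@ge0_integral_leb_affine R n c v)//; last 2 first.
- exact/measurable_EFinP/cmeasurable_normc.
- by move=> x; rewrite lee_fin normc_ge0.
have cp : (0 < `|c| ^+ n) by rewrite exprn_gt0// normr_gt0.
have : (0 <= \int[mu]_s (normc (f (c *: s + v)%R))%:E)%E.
  by apply: integral_ge0 => x _; rewrite lee_fin normc_ge0.
case: (X in (_ <= X)%E) => [r||]//=; first by move=> _ _; exact: ltry.
by move=> _; rewrite gt0_muley// lte_fin.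
Qed.

Lemma cintegral_affine (c : R) (v : 'rV[R]_n) (f : 'rV[R]_n -> R[i]) : c != 0 ->
  cintegrable mu f ->
  (`|c| ^+ n)%:C * cintegral mu setT (fun x => f (c *: x + v)) = cintegral mu setT f.
Proof.
move=> c0 fi; rewrite !cintegralE; simpc; congr (_ +i* _).
  exact: (Rintegral_affine v c0 (cintegrable_Re fi)).
exact: (Rintegral_affine v c0 (cintegrable_Im fi)).
Qed.

Lemma cintegralN (f : 'rV[R]_n -> R[i]) : cintegrable mu f ->
  cintegral mu setT (fun x => f (- x)) = cintegral mu setT f.
Proof.
move=> fi; rewrite -[RHS](@cintegral_affine (-1) 0)// ?oppr_eq0 ?oner_eq0//.
rewrite normrN1 expr1n mul1r; congr cintegral; apply/funext => x.
by rewrite scaleN1r addr0.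
Qed.

Lemma cintegral_shift (v : 'rV[R]_n) (f : 'rV[R]_n -> R[i]) : cintegrable mu f ->
  cintegral mu setT (fun x => f (x + v)) = cintegral mu setT f.
Proof.
move=> fi; rewrite -[RHS](@cintegral_affine 1 v)// ?oner_eq0// normr1 expr1n mul1r.
by congr cintegral; apply/funext => x; rewrite scale1r.
Qed.

Lemma cintegrable_shift (v : 'rV[R]_n) (f : 'rV[R]_n -> R[i]) : cintegrable mu f ->
  cintegrable mu (fun x => f (x + v)).
Proof.
move=> /(cintegrable_affine v (oner_neq0 _)); congr cintegrable.
by apply/funext => x; rewrite scale1r.
Qed.

Lemma cintegrable_opp (f : 'rV[R]_n -> R[i]) : cintegrable mu f ->
  cintegrable mu (fun x => f (- x)).
Proof.
have n1 : (-1 : R) != 0 by rewrite oppr_eq0 oner_eq0.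
move=> /(cintegrable_affine 0 n1); congr cintegrable.
by apply/funext => x; rewrite scaleN1r addr0.
Qed.

Lemma ge0_integral_reflect (v : 'rV[R]_n) (f : 'rV[R]_n -> \bar R) :
  measurable_fun setT f -> (forall x, 0 <= f x)%E ->
  (\int[mu]_x f (v - x)%R = \int[mu]_x f x)%E.
Proof.
move=> mf f0; have n1 : (-1 : R) != 0 by rewrite oppr_eq0 oner_eq0.
rewrite -(ge0_integral_leb_affine v n1 mf f0).
rewrite normrN1 expr1n mul1e; apply: eq_integral => x _.
by rewrite scaleN1r addrC.
Qed.

Lemma ge0_integral_shift (v : 'rV[R]_n) (f : 'rV[R]_n -> \bar R) :
  measurable_fun setT f -> (forall x, 0 <= f x)%E ->
  (\int[mu]_x f (x + v)%R = \int[mu]_x f x)%E.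
Proof.
move=> mf f0; rewrite -(@ge0_integral_leb_affine R n 1 v f)// ?oner_neq0//.
by rewrite normr1 expr1n mul1e; apply: eq_integral => x _; rewrite scale1r.
Qed.

End cintegral_affine.

Section fourier_theory.
Context {R : realType} {n : nat}.
Notation mu := (@leb R n).
Implicit Types (f g u v : 'rV[R]_n -> R[i]).

Lemma fourierE f xi : fourier f xi =
  cintegral mu setT (fun x => f x * expi (- (2 * pi * dotrV x xi))).
Proof. by []. Qed.

(** Lets the theory of [fourier] serve the inverse transform as well. *)
Lemma inv_fourierE f x : inv_fourier f x = fourier f (- x).
Proof.
rewrite /inv_fourier /fourier; congr cintegral; apply/funext => xi.
by rewrite dotrVNr mulrN opprK dotrVC.
Qed.

Lemma measurable_phase d (T : measurableType d) (c : R) (h k : T -> 'rV[R]_n) :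
  measurable_fun setT h -> measurable_fun setT k ->
  measurable_fun setT (fun t => c * (2 * pi * dotrV (h t) (k t))).
Proof.
move=> mh mk; apply: measurable_funM => //; apply: measurable_funM => //.
exact: measurable_fun_dotrV.
Qed.

Lemma cmeasurable_fourier_kernel d (T : measurableType d) (h k : T -> 'rV[R]_n) :
  measurable_fun setT h -> measurable_fun setT k ->
  cmeasurable (fun t => expi (- (2 * pi * dotrV (h t) (k t))) : R[i]).
Proof.
move=> mh mk; apply: cmeasurable_expi.
by under eq_fun do rewrite -mulN1r; exact: measurable_phase.
Qed.

Lemma cmeasurable_inv_fourier_kernel d (T : measurableType d) (h k : T -> 'rV[R]_n) :
  measurable_fun setT h -> measurable_fun setT k ->
  cmeasurable (fun t => expi (2 * pi * dotrV (h t) (k t)) : R[i]).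
Proof.
move=> mh mk; apply: cmeasurable_expi.
by under eq_fun do rewrite -[2 * _ * _]mul1r; exact: measurable_phase.
Qed.

Lemma cintegrable_expi f (a : 'rV[R]_n -> R) : cintegrable mu f ->
  measurable_fun setT a -> cintegrable mu (fun x => f x * expi (a x)).
Proof.
move=> fi ma; apply: (cintegrable_le _ fi).
  by apply: cmeasurableM; [case: fi|exact: cmeasurable_expi].
by move=> x; rewrite Normc.normcM normc_expi mulr1.
Qed.

Lemma cintegrable_fourier_integrand f xi : cintegrable mu f ->
  cintegrable mu (fun x => f x * expi (- (2 * pi * dotrV x xi))).
Proof.
move=> fi; apply: cintegrable_expi => //.
by under eq_fun do rewrite -mulN1r; exact: measurable_phase.
Qed.

Definition norm1 f : R := \int[mu]_x normc (f x).

Lemma norm1_ge0 f : 0 <= norm1 f.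
Proof. by apply: Rintegral_ge0 => x _; exact: normc_ge0. Qed.

Lemma norm1E f : cintegrable mu f -> (norm1 f)%:E = (\int[mu]_x (normc (f x))%:E)%E.
Proof.
move=> fi; rewrite /norm1 /Rintegral fineK//.
by apply: integrable_fin_num => //; exact: cintegrable_normc.
Qed.

Lemma normc_fourier_le f xi : cintegrable mu f -> normc (fourier f xi) <= norm1 f.
Proof.
move=> fi; rewrite -lee_fin norm1E// fourierE.
apply: le_trans (normc_cintegral_le (cintegrable_fourier_integrand _ fi)) _.
by apply: ge0_le_integralT => x; rewrite lee_fin ?normc_ge0// Normc.normcM normc_expi mulr1.
Qed.

Lemma cmeasurable_fourier f : cmeasurable f -> cmeasurable (fourier f).
Proof.
move=> mf.
apply: (@cmeasurable_cintegral _ _ _ _ R mu (fun z : 'rV[R]_n * 'rV[R]_n =>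
  f z.2 * expi (- (2 * pi * dotrV z.2 z.1)))).
apply: cmeasurableM; first exact: (cmeasurable_comp measurable_snd mf).
by apply: cmeasurable_fourier_kernel; [exact: measurable_snd|exact: measurable_fst].
Qed.

Lemma integral_normcM u v : cintegrable mu u -> cintegrable mu v ->
  (\int[mu]_x \int[mu]_y (normc (u x) * normc (v y))%:E = (norm1 u * norm1 v)%:E)%E.
Proof.
move=> ui vi.
have mv : measurable_fun setT (fun x => (normc (v x))%:E).
  by apply/measurable_EFinP/cmeasurable_normc; case: vi.
have mu' : measurable_fun setT (fun x => (normc (u x))%:E).
  by apply/measurable_EFinP/cmeasurable_normc; case: ui.
under eq_integral.
  move=> x _; under eq_integral do rewrite EFinM.
  rewrite ge0_integralZl//; last 2 first.
  - by move=> y _; rewrite lee_fin normc_ge0.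
  - by rewrite lee_fin normc_ge0.
  rewrite -norm1E// muleC; over.
rewrite ge0_integralZl//; last 2 first.
- by move=> y _; rewrite lee_fin normc_ge0.
- by rewrite lee_fin norm1_ge0.
by rewrite -norm1E// -EFinM mulrC.
Qed.

Lemma cintegral_fubini_prod u v (k : 'rV[R]_n * 'rV[R]_n -> R[i]) :
  cintegrable mu u -> cintegrable mu v -> cmeasurable k ->
  (forall x y, normc (k (x, y)) <= normc (u x) * normc (v y)) ->
  cintegral mu setT (fun x => cintegral mu setT (fun y => k (x, y))) =
  cintegral mu setT (fun y => cintegral mu setT (fun x => k (x, y))).
Proof.
move=> ui vi mk kuv; apply: cintegral_fubini => //.
rewrite (@le_lt_trans _ _ (norm1 u * norm1 v)%:E)%E ?ltry// -integral_normcM//.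
apply: ge0_le_integralT => x.
  by apply: integral_ge0 => y _; rewrite lee_fin normc_ge0.
by apply: ge0_le_integralT => y; rewrite lee_fin ?normc_ge0.
Qed.

Lemma fourier_multiplication u v : cintegrable mu u -> cintegrable mu v ->
  cintegral mu setT (fun x => fourier u x * v x) =
  cintegral mu setT (fun x => u x * fourier v x).
Proof.
move=> ui vi.
transitivity (cintegral mu setT (fun x => cintegral mu setT (fun y =>
    v x * (u y * expi (- (2 * pi * dotrV y x)))))).
  congr cintegral; apply/funext => x; rewrite cintegralZ; first by rewrite mulrC fourierE.
  exact: cintegrable_fourier_integrand.
have [mu' mv] : cmeasurable u /\ cmeasurable v by case: ui; case: vi.
rewrite (@cintegral_fubini_prod v u (fun z => v z.1 * (u z.2 * expi (- (2 * pi * dotrV z.2 z.1)))))//; last 2 first.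
- apply: cmeasurableM; first exact: (cmeasurable_comp measurable_fst mv).
  apply: cmeasurableM; first exact: (cmeasurable_comp measurable_snd mu').
  by apply: cmeasurable_fourier_kernel; [exact: measurable_snd|exact: measurable_fst].
- by move=> x y /=; rewrite !Normc.normcM normc_expi mulr1.
congr cintegral; apply/funext => y /=.
rewrite fourierE -cintegralZ; last exact: cintegrable_fourier_integrand.
congr cintegral; apply/funext => x.
by rewrite mulrCA (dotrVC y).
Qed.

Lemma cmeasurable_convolution u v : cmeasurable u -> cmeasurable v ->
  cmeasurable (convolution u v).
Proof.
move=> mu' mv.
apply: (@cmeasurable_cintegral _ _ _ _ R mu (fun z : 'rV[R]_n * 'rV[R]_n =>
  u z.2 * v (z.1 - z.2))).
apply: cmeasurableM; first exact: (cmeasurable_comp measurable_snd mu').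
apply: (cmeasurable_comp _ mv).
by apply: measurable_fun_rVB; [exact: measurable_fst|exact: measurable_snd].
Qed.

Lemma integral_normc_shift u v : cintegrable mu u -> cintegrable mu v ->
  (\int[mu]_y \int[mu]_x (normc (u y) * normc (v (x - y)%R))%:E < +oo)%E.
Proof.
move=> ui vi; apply: (@le_lt_trans _ _ (norm1 u * norm1 v)%:E)%E; last exact: ltry.
rewrite -(integral_normcM ui vi).
have mv : measurable_fun setT (fun x => (normc (v x))).
  by apply/cmeasurable_normc; case: vi.
rewrite le_eqVlt; apply/orP; left; apply/eqP; apply: eq_integral => y _.
apply: (ge0_integral_shift (- y) (f := fun x => (normc (u y) * normc (v x))%:E)).
  by apply/measurable_EFinP; exact: measurable_funM.
by move=> x; rewrite lee_fin mulr_ge0 ?normc_ge0.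
Qed.

(** Tonelli gives integrable sections for almost every [y] only, while the bound on the convolution
    is used at every [y]; hence the last hypothesis, which holds as soon as one factor is
    bounded. *)
Lemma cintegrable_convolution u v : cintegrable mu u -> cintegrable mu v ->
  (forall y, cintegrable mu (fun z => u z * v (y - z))) ->
  cintegrable mu (convolution u v).
Proof.
move=> ui vi uvi; have [mu' mv] : cmeasurable u /\ cmeasurable v by case: ui; case: vi.
split; first exact: cmeasurable_convolution.
apply: le_lt_trans (integral_normc_shift ui vi).
rewrite (fubini_tonelli (m1 := mu) (m2 := mu) (fun z => (normc (u z.1) * normc (v (z.2 - z.1)%R))%:E)); last 2 first.
- apply/measurable_EFinP; apply: measurable_funM.
    exact: (cmeasurable_normc (cmeasurable_comp measurable_fst mu')).
  apply: (cmeasurable_normc (cmeasurable_comp _ mv)).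
  by apply: measurable_fun_rVB; [exact: measurable_snd|exact: measurable_fst].
- by move=> z; rewrite lee_fin mulr_ge0 ?normc_ge0.
apply: ge0_le_integralT => x; first by rewrite lee_fin normc_ge0.
rewrite (le_trans (normc_cintegral_le (uvi x)))//.
by apply: ge0_le_integralT => y; rewrite lee_fin ?normc_ge0// Normc.normcM.
Qed.

Lemma fourier_convolution u v xi : cintegrable mu u -> cintegrable mu v ->
  (forall y, cintegrable mu (fun z => u z * v (y - z))) ->
  fourier (convolution u v) xi = fourier u xi * fourier v xi.
Proof.
move=> ui vi uvi; have [mu' mv] : cmeasurable u /\ cmeasurable v by case: ui; case: vi.
pose e (x : 'rV[R]_n) : R[i] := expi (- (2 * pi * dotrV x xi)).
transitivity (cintegral mu setT (fun y => cintegral mu setT (fun z => e y * (u z * v (y - z))))).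
  by rewrite fourierE; congr cintegral; apply/funext => y; rewrite cintegralZ// mulrC.
pose k (w : 'rV[R]_n * 'rV[R]_n) := e w.2 * (u w.1 * v (w.2 - w.1)).
have mk : cmeasurable k.
  apply: cmeasurableM.
    by apply: cmeasurable_fourier_kernel; [exact: measurable_snd|exact: measurable_cst].
  apply: cmeasurableM; first exact: (cmeasurable_comp measurable_fst mu').
  apply: (cmeasurable_comp _ mv).
  by apply: measurable_fun_rVB; [exact: measurable_snd|exact: measurable_fst].
have <- := @cintegral_fubini _ _ _ _ R mu mu k mk; last first.
  apply: le_lt_trans (integral_normc_shift ui vi).
  apply: ge0_le_integralT => x.
    by apply: integral_ge0 => y _; rewrite lee_fin normc_ge0.
  apply: ge0_le_integralT => y; rewrite lee_fin ?normc_ge0//.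
  by rewrite !Normc.normcM normc_expi mul1r.
rewrite mulrC fourierE -cintegralZ; last exact: cintegrable_fourier_integrand.
congr cintegral; apply/funext => z; rewrite /k/=.
transitivity (cintegral mu setT (fun y => (fun y => u z * e z * (v y * e y)) (y + - z))).
  congr cintegral; apply/funext => y.
  have -> : e y = e z * e (y - z).
    by rewrite /e -expiD; congr expi; rewrite dotrVDl dotrVNl; ring.
  by ring.
have vei := cintegrable_fourier_integrand xi vi.
rewrite (@cintegral_shift R n (- z) (fun y => u z * e z * (v y * e y))); last exact: cintegrableZ.
by rewrite cintegralZ// -fourierE mulrCA mulrA mulrC mulrA; congr (_ * _); rewrite mulrC.
Qed.

Lemma fourier_shift f (a xi : 'rV[R]_n) : cintegrable mu f ->
  fourier (fun x => f (x + a)) xi = expi (2 * pi * dotrV a xi) * fourier f xi.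
Proof.
move=> fi; have fei := cintegrable_fourier_integrand xi fi.
rewrite fourierE.
transitivity (cintegral mu setT (fun x => (fun y => expi (2 * pi * dotrV a xi) *
    (f y * expi (- (2 * pi * dotrV y xi)))) (x + a))).
  congr cintegral; apply/funext => x; rewrite mulrCA -expiD; congr (_ * expi _).
  by rewrite dotrVDl; ring.
rewrite (@cintegral_shift R n a (fun y => expi (2 * pi * dotrV a xi) *
    (f y * expi (- (2 * pi * dotrV y xi))))); last exact: cintegrableZ.
by rewrite cintegralZ.
Qed.

Lemma fourier_modulation f (a xi : 'rV[R]_n) :
  fourier (fun x => f x * expi (2 * pi * dotrV x a)) xi = fourier f (xi - a).
Proof.
rewrite !fourierE; congr cintegral; apply/funext => x.
rewrite -mulrA -expiD; congr (_ * expi _).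
by rewrite dotrVDr dotrVNr; ring.
Qed.

Lemma fourier_dilation f (t : R) xi : 0 < t -> cintegrable mu f ->
  fourier (dilation f t) xi = fourier f (t *: xi).
Proof.
move=> t0 fi; have ti0 : t^-1 != 0 by rewrite invr_eq0 gt_eqF.
have fei := cintegrable_fourier_integrand (t *: xi) fi.
rewrite !fourierE -[RHS](cintegral_affine 0 ti0 fei).
have ffi := cintegrable_affine 0 ti0 fei.
rewrite -(cintegralZ _ ffi); congr cintegral; apply/funext => x.
rewrite /dilation addr0 -mulrA; congr (_ * (_ * expi _)).
  by rewrite ger0_norm ?invr_ge0 ?ltW// exprVn.
congr (- (_ * _)); rewrite dotrVZl dotrVZr mulrA mulVf ?mul1r//.
by rewrite gt_eqF.
Qed.

Lemma cintegrable_dilation f (t : R) : 0 < t -> cintegrable mu f ->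
  cintegrable mu (dilation f t).
Proof.
move=> t0 fi; have ti0 : t^-1 != 0 by rewrite invr_eq0 gt_eqF.
have := cintegrableZ ((t ^- n)%:C) (cintegrable_affine 0 ti0 fi).
by congr cintegrable; apply/funext => x; rewrite /dilation addr0.
Qed.

End fourier_theory.

(** * The triangle function *)

Section triangle.
Context {R : realType}.
Notation mu := (@lebesgue_measure R).

Definition triangle (s : R) : R := Num.max 0 (1 - `|s|).

Lemma triangle_ge0 s : 0 <= triangle s. Proof. by rewrite le_max lexx. Qed.

Lemma triangle_le1 s : triangle s <= 1.
Proof. by rewrite ge_max ler01/= gerBl. Qed.

Lemma triangle0 : triangle 0 = 1.
Proof. by rewrite /triangle normr0 subr0 max_r. Qed.

Lemma continuous_triangle : continuous triangle.
Proof.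
move=> s; apply: (@continuous_max R R (fun=> 0) (fun s => 1 - `|s|)).
  by move=> ?; exact: cvg_cst.
move=> ?; by apply: cvgB; [exact: cvg_cst|exact: norm_continuous].
Qed.

Lemma measurable_triangle : measurable_fun setT triangle.
Proof. exact: continuous_measurable_fun continuous_triangle. Qed.

Lemma Rintegral_FTC (F f : R -> R) (a b : R) : a < b -> continuous f ->
  (forall s : R, is_derive s 1 F (f s)) ->
  \int[mu]_(s in `[a, b]) f s = F b - F a.
Proof.
move=> ab cf dF; have cF s : {for s, continuous F}.
  by apply: differentiable_continuous; apply/derivable1_diffP; exact: ex_derive.
rewrite /Rintegral (@continuous_FTC2 _ f F)//.
- by apply: continuous_subspaceT => s; exact: cf.
- split => [s _||]; first exact: ex_derive.
    by apply: cvg_at_right_filter; exact: cF.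
  by apply: cvg_at_left_filter; exact: cF.
- by move=> s _; rewrite derive1E; exact: derive_val.
Qed.

(** The triangle represents the second difference: when [q] is the second derivative of [p],
    integration by parts on each side of the kink at 0 leaves only values of [p]. *)
Lemma triangle_integral (p p' q : R -> R) : continuous q ->
  (forall s : R, is_derive s 1 p (p' s)) -> (forall s : R, is_derive s 1 p' (q s)) ->
  \int[mu]_s (triangle s * q s) = p 1 + p (-1) - 2 * p 0.
Proof.
move=> cq dp dp'.
have ctq : continuous (fun s => triangle s * q s).
  by move=> s; apply: cvgM; [exact: continuous_triangle|exact: cq].
have -> : \int[mu]_s (triangle s * q s) = \int[mu]_(s in `[-1, 1]) (triangle s * q s).
  rewrite [RHS]Rintegral_mkcond; apply: eq_Rintegral => s _.
  rewrite patchE; case: ifPn => //; rewrite notin_setE/= in_itv/= => /negP.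
  rewrite -ler_norml -ltNge => s1.
  by rewrite /triangle max_l ?mul0r// subr_le0 ltW.
have -> : `[-1, 1]%classic = `[-1, 0[ `|` `[0, 1] :> set R.
  apply/seteqP; split => s /=; rewrite !in_itv/=.
    by case: (ltP s 0) => s0 /andP[-> ->]; [left|right].
  by move=> [/andP[-> s0]|/andP[s0 ->]]; lra.
rewrite Rintegral_setU//=; last 2 first.
- rewrite (_ : _ `|` _ = `[-1, 1]%classic).
    apply: continuous_compact_integrable; first exact: segment_compact.
    by apply: continuous_subspaceT => s; exact: ctq.
  apply/seteqP; split => s /=; rewrite !in_itv/=.
    by move=> [/andP[-> s0]|/andP[s0 ->]]; lra.
  by case: (ltP s 0) => s0 /andP[-> ->]; [left|right].
- apply/disj_setPS => s /= []; rewrite !in_itv/= => /andP[_ s0] /andP[s0' _].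
  by move: (lt_le_trans s0 s0'); rewrite ltxx.
rewrite Rintegral_itv_bndo_bndc; last first.
  have iI : mu.-integrable `[-1, 0]%classic (EFin \o (fun s => triangle s * q s)).
    apply: continuous_compact_integrable; first exact: segment_compact.
    by apply: continuous_subspaceT => s; exact: ctq.
  apply: (integrableS _ _ _ iI) => //.
  by move=> s /=; rewrite !in_itv/= => /andP[-> /ltW].
have cp' : continuous p'.
  move=> s; apply: differentiable_continuous; apply/derivable1_diffP.
  by have [] := dp' s.
transitivity (\int[mu]_(s in `[-1, 0]) ((1 + s) * q s) + \int[mu]_(s in `[0, 1]) ((1 - s) * q s)).
  congr (_ + _); apply: eq_Rintegral => s; rewrite inE/= in_itv/= => /andP[s1 s2].
    by rewrite /triangle ler0_norm// opprK max_r//; lra.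
  by rewrite /triangle ger0_norm// max_r//; lra.
(* Antiderivatives found by integrating by parts; the terms [p' 0] coming from the two halves
   cancel. *)
have d1 (s : R) : is_derive s 1 (fun s => (1 + s) * p' s - p s) ((1 + s) * q s).
  have := dp s; have := dp' s => dp's dps.
  by apply: is_derive_eq; rewrite /GRing.scale/=; ring.
have d2 (s : R) : is_derive s 1 (fun s => (1 - s) * p' s + p s) ((1 - s) * q s).
  have := dp s; have := dp' s => dp's dps.
  by apply: is_derive_eq; rewrite /GRing.scale/=; ring.
rewrite (Rintegral_FTC _ _ d1)//; last first.
  by move=> s; apply: cvgM; [apply: cvgD; [exact: cvg_cst|exact: cvg_id]|exact: cq].
rewrite (Rintegral_FTC _ _ d2)//; last first.
  by move=> s; apply: cvgM; [apply: cvgB; [exact: cvg_cst|exact: cvg_id]|exact: cq].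
by ring.
Qed.

Lemma triangle_cos (w : R) : w != 0 ->
  \int[mu]_s (triangle s * cos (w * s)) = (2 - 2 * cos w) / w ^+ 2.
Proof.
move=> w0.
have cq : continuous (fun s : R => cos (w * s)).
  by move=> s; apply: continuous_comp; [exact: mulrl_continuous|exact: continuous_cos].
have dp (s : R) : is_derive s 1 (fun s : R => - w ^- 2 * cos (w * s)) (w^-1 * sin (w * s)).
  by apply: is_derive_eq; rewrite /GRing.scale/=; field.
have dp' (s : R) : is_derive s 1 (fun s => w^-1 * sin (w * s)) (cos (w * s)).
  by apply: is_derive_eq; rewrite /GRing.scale/=; field.
rewrite (triangle_integral cq dp dp') mulr1 mulrN1 mulr0 cosN cos0; field.
exact: w0.
Qed.

Lemma triangle_sin (w : R) : \int[mu]_s (triangle s * sin (w * s)) = 0.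
Proof.
have [->|w0] := eqVneq w 0.
  by under eq_Rintegral do rewrite mul0r sin0 mulr0; rewrite Rintegral_cst// mul0r.
have cq : continuous (fun s : R => sin (w * s)).
  by move=> s; apply: continuous_comp; [exact: mulrl_continuous|exact: continuous_sin].
have dp (s : R) : is_derive s 1 (fun s : R => - w ^- 2 * sin (w * s)) (- w^-1 * cos (w * s)).
  by apply: is_derive_eq; rewrite /GRing.scale/=; field.
have dp' (s : R) : is_derive s 1 (fun s => - w^-1 * cos (w * s)) (sin (w * s)).
  by apply: is_derive_eq; rewrite /GRing.scale/=; field.
by rewrite (triangle_integral cq dp dp') mulr1 mulrN1 mulr0 sinN sin0; ring.
Qed.

End triangle.

Section leb1_lebesgue_measure.
Context {R : realType}.

Lemma ge0_integral_leb1E (f : R -> \bar R) : measurable_fun setT f ->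
  (forall x, 0 <= f x)%E ->
  (\int[leb1]_x f x = \int[@lebesgue_measure R]_x f x)%E.
Proof.
move=> mf f0.
have mid : measurable_fun setT (fun s : measurableTypeR R => (s : R)).
  by move=> _ A mA; rewrite setTI.
have := @ge0_integral_pushforward _ _ (measurableTypeR R) R R _ mid lebesgue_measure setT f measurableT mf (fun y _ => f0 y).
rewrite preimage_setT => <-.
by apply: eq_measure_integral => A mA _.
Qed.

Lemma Rintegral_leb1E (f : R -> R) : measurable_fun setT f ->
  \int[leb1]_x f x = \int[@lebesgue_measure R]_x f x.
Proof.
move=> mf; rewrite /Rintegral integralE [in RHS]integralE.
have mE : measurable_fun setT (EFin \o f) by exact/measurable_EFinP.
congr (fine (_ - _)).
  rewrite (ge0_integral_leb1E (f := (EFin \o f)^\+%E))//; exact: measurable_funepos.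
rewrite (ge0_integral_leb1E (f := (EFin \o f)^\-%E))//; exact: measurable_funeneg.
Qed.

End leb1_lebesgue_measure.

(** * Integrals and Fourier transforms of products over the coordinates *)

Section tensor.
Context {R : realType}.
Notation mu1 := (@leb1 R).

Lemma Rintegral_lebS n (f : 'rV[R]_n.+1 -> R) :
  (@leb R n.+1).-integrable setT (EFin \o f) ->
  \int[leb n.+1]_x f x = \int[leb n]_p (\int[mu1]_s f (consrV (p, s))).
Proof.
move=> fi; have mf : measurable_fun setT f by apply/measurable_EFinP; exact: measurable_int fi.
have mfc : measurable_fun setT (fun z : 'rV[R]_n * R => f (consrV z)).
  by apply: measurableT_comp => //; exact: measurable_consrV.
pose g (z : 'rV[R]_n * R) := f (consrV z).
have gi : (leb n \x mu1)%E.-integrable setT (EFin \o g).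
  apply/integrable12ltyP; first exact/measurable_EFinP.
  have /integrableP[_] := fi.
  rewrite ge0_integral_lebS//; apply: measurableT_comp => //.
  exact/measurable_EFinP.
rewrite [RHS]/Rintegral (Rintegral_fubini_F gi) /Rintegral; congr fine.
have mc := @measurable_consrV R n.
rewrite -[setT in RHS](preimage_setT (@consrV R n)).
have fi' : (pushforward (leb n \x mu1)%E (@consrV R n)).-integrable setT (EFin \o f) by exact: fi.
symmetry; rewrite -(@integral_pushforward _ _ _ _ R _ mc (leb n \x mu1)%E setT (EFin \o f))//.
exact/measurable_EFinP.
Qed.

Lemma cintegral_lebS n (f : 'rV[R]_n.+1 -> R[i]) : cintegrable (leb n.+1) f ->
  cintegral (leb n.+1) setT f =
  cintegral (leb n) setT (fun p => cintegral mu1 setT (fun s => f (consrV (p, s)))).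
Proof.
move=> fi; rewrite !cintegralE/=; congr (_ +i* _).
  exact: (Rintegral_lebS (cintegrable_Re fi)).
exact: (Rintegral_lebS (cintegrable_Im fi)).
Qed.

Lemma cmeasurable_prod d (T : measurableType d) n (f : 'I_n -> T -> R[i]) :
  (forall i, cmeasurable (f i)) -> cmeasurable (fun x => \prod_(i < n) f i x).
Proof.
elim: n f => [|n IH] f mf.
  by under eq_fun do rewrite big_ord0; exact: cmeasurable_cst.
under eq_fun do rewrite big_ord_recl.
by apply: cmeasurableM => //; exact: IH.
Qed.

Lemma cintegrable_prod n (f : 'I_n -> R -> R[i]) :
  (forall i, cintegrable mu1 (f i)) ->
  cintegrable (leb n) (fun x => \prod_(i < n) f i (x ord0 i)).
Proof.
move=> fi; split.
  apply: cmeasurable_prod => i; apply: (cmeasurable_comp _ (proj1 (fi i))).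
  exact: measurable_coordrV.
under eq_integral do rewrite normc_prod.
rewrite (ge0_integral_prod (f := fun i s => normc (f i s))); last 2 first.
- by move=> i; apply: cmeasurable_normc; case: (fi i).
- by move=> i s; exact: normc_ge0.
suff : ((\prod_(i < n) \int[mu1]_s (normc (f i s))%:E)%E \is a fin_num).
  by move=> /fin_numP[_]; rewrite ltey.
elim/big_ind : _ => // [x y|i _]; first exact: fin_numM.
rewrite ge0_fin_numE; first by case: (fi i).
by apply: integral_ge0 => s _; rewrite lee_fin normc_ge0.
Qed.

Lemma cintegral_prod n (f : 'I_n -> R -> R[i]) :
  (forall i, cintegrable mu1 (f i)) ->
  cintegral (leb n) setT (fun x => \prod_(i < n) f i (x ord0 i)) =
  \prod_(i < n) cintegral mu1 setT (f i).
Proof.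
elim: n f => [|n IH] f fi.
  rewrite big_ord0 cintegralE.
  under eq_Rintegral do rewrite big_ord0.
  under [X in _ +i* X]eq_Rintegral do rewrite big_ord0.
  have l0 : @leb R 0 setT = 1%E by rewrite /leb/= diracE in_setT.
  rewrite !Rintegral_cst// mul0r mul1r.
  by rewrite -[X in fine X]/(@leb R 0 setT) l0.
rewrite cintegral_lebS; last exact: cintegrable_prod.
rewrite big_ord_recl -IH// -cintegralZ; last first.
  exact: (cintegrable_prod (fun i => fi (lift ord0 i))).
congr cintegral; apply/funext => p.
rewrite mulrC -cintegralZ//; congr cintegral; apply/funext => s.
rewrite big_ord_recl mulrC !mxE unlift_none; congr (_ * _).
by apply: eq_bigr => i _; rewrite !mxE liftK.
Qed.

Lemma expi_sum n (a : 'I_n -> R) : expi (\sum_(i < n) a i) = \prod_(i < n) expi (a i).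
Proof.
elim: n a => [|n IH] a; first by rewrite !big_ord0 expi0.
by rewrite !big_ord_recl expiD IH.
Qed.

Definition fourier1 (f : R -> R[i]) (x : R) : R[i] :=
  cintegral mu1 setT (fun s => f s * expi (- (2 * pi * (s * x)))).

Lemma cintegrable_fourier1 (f : R -> R[i]) (x : R) : cintegrable mu1 f ->
  cintegrable mu1 (fun s => f s * expi (- (2 * pi * (s * x)))).
Proof.
move=> fi; apply: (cintegrable_le _ fi) => [|s].
  apply: cmeasurableM; first by case: fi.
  apply: cmeasurable_expi; under eq_fun do rewrite mulrCA -mulrN.
  by apply: measurable_funM => //; exact: measurable_cst.
by rewrite Normc.normcM normc_expi mulr1.
Qed.

Lemma fourier_prod n (f : 'I_n -> R -> R[i]) (xi : 'rV[R]_n) :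
  (forall i, cintegrable mu1 (f i)) ->
  fourier (fun x => \prod_(i < n) f i (x ord0 i)) xi =
  \prod_(i < n) fourier1 (f i) (xi ord0 i).
Proof.
move=> fi.
rewrite -(@cintegral_prod n (fun i s => f i s * expi (- (2 * pi * (s * xi ord0 i))))); last first.
  by move=> i; exact: cintegrable_fourier1.
rewrite fourierE; congr cintegral; apply/funext => x.
rewrite big_split/=; congr (_ * _); rewrite -expi_sum; congr expi.
by rewrite sumrN /dotrV mulr_sumr.
Qed.

End tensor.

(** * The Fejer kernel *)

Section fejer.
Context {R : realType}.
Notation mu1 := (@leb1 R).

(** Serves as the majorant everywhere: it is integrable on the line, and its product over the
    coordinates is integrable in every dimension. *)
Definition cauchyw (x : R) : R := (1 + x ^+ 2)^-1.

Lemma oneDsqr_gt0 (x : R) : 0 < 1 + x ^+ 2.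
Proof. by rewrite ltr_pwDl// sqr_ge0. Qed.

Lemma cauchyw_gt0 x : 0 < cauchyw x.
Proof. by rewrite invr_gt0 oneDsqr_gt0. Qed.

Lemma continuous_cauchyw : continuous cauchyw.
Proof. exact: continuous_oneDsqrV. Qed.

Lemma measurable_cauchyw : measurable_fun setT cauchyw.
Proof. exact: continuous_measurable_fun continuous_cauchyw. Qed.

Lemma integral_cauchyw_lty : (\int[mu1]_x (cauchyw x)%:E < +oo)%E.
Proof.
rewrite ge0_integral_leb1E; last 2 first.
- by apply/measurable_EFinP; exact: measurable_cauchyw.
- by move=> x; rewrite lee_fin ltW// cauchyw_gt0.
rewrite ge0_symfun_integralT//.
- rewrite -set_itvcy integral0y_oneDsqr -EFinM; exact: ltry.
- by move=> x; exact/ltW/cauchyw_gt0.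
- exact: continuous_cauchyw.
- by move=> x /=; rewrite /cauchyw sqrrN.
Qed.

Lemma integral_triangle_lty : (\int[mu1]_s (triangle s)%:E < +oo)%E.
Proof.
apply: (@le_lt_trans _ _ (\int[mu1]_s (\1_(`[-1, 1]%classic : set R) s)%:E)%E).
  apply: ge0_le_integralT => s; rewrite lee_fin ?triangle_ge0// indicE.
  case: (boolP (s \in _)) => [_|]; first exact: triangle_le1.
  rewrite notin_setE/= in_itv/= -ler_norml => /negP; rewrite -ltNge => s1.
  by rewrite /triangle max_l// subr_le0 ltW.
rewrite integral_indic// setIT [X in (X < _)%E](lebesgue_measure_itv `[-1, 1])/= lte_fin.
by rewrite ifT -?EFinD ?ltry//; lra.
Qed.

Lemma integrable_triangle : mu1.-integrable setT (EFin \o (@triangle R)).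
Proof.
apply/integrableP; split; first by apply/measurable_EFinP; exact: measurable_triangle.
apply: le_lt_trans integral_triangle_lty; apply: ge0_le_integralT => s; first exact: abse_ge0.
by rewrite /= ger0_norm ?triangle_ge0.
Qed.

Definition ctriangle (s : R) : R[i] := (triangle s)%:C.

Lemma cintegrable_ctriangle : cintegrable mu1 ctriangle.
Proof.
split; first exact: (cmeasurable_real measurable_triangle).
apply: le_lt_trans integral_triangle_lty; apply: ge0_le_integralT => s.
  by rewrite lee_fin normc_ge0.
by rewrite normc_realc ger0_norm ?triangle_ge0.
Qed.

(** The Fejer kernel (sin(pi x) / (pi x))^2, kept as a cosine integral so that x = 0 is no
    exception; [fejerE] has a closed form. *)
Definition fejer (x : R) : R := \int[mu1]_s (triangle s * cos (2 * pi * x * s)).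

Lemma fourier1_triangle x : fourier1 ctriangle x = (fejer x)%:C.
Proof.
rewrite /fourier1 cintegralE; congr (_ +i* _).
  apply: eq_Rintegral => s _; rewrite Re_mulc/= mul0r subr0 cosN; congr (_ * cos _); ring.
transitivity (\int[mu1]_s (triangle s * sin (- (2 * pi * x) * s))).
  apply: eq_Rintegral => s _; rewrite Im_mulc/= mul0r addr0; congr (_ * sin _); ring.
rewrite Rintegral_leb1E ?triangle_sin//.
apply: measurable_funM; first exact: measurable_triangle.
by apply: (measurableT_comp (f := sin)); [apply: continuous_measurable_fun; exact: continuous_sin|exact: measurable_funM].
Qed.

Lemma fejerE x : x != 0 -> fejer x = (2 - 2 * cos (2 * pi * x)) / (2 * pi * x) ^+ 2.
Proof.
move=> x0; rewrite /fejer Rintegral_leb1E; last first.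
  apply: measurable_funM; first exact: measurable_triangle.
  by apply: (measurableT_comp (f := cos)); [apply: continuous_measurable_fun; exact: continuous_cos|exact: measurable_funM].
apply: triangle_cos.
by rewrite !mulf_neq0// gt_eqF// pi_gt0.
Qed.

Lemma fejer_ge0 x : 0 <= fejer x.
Proof.
have [->|x0] := eqVneq x 0.
  apply: Rintegral_ge0 => s _; rewrite mulr0 mul0r cos0 mulr1; exact: triangle_ge0.
by rewrite fejerE// divr_ge0 ?sqr_ge0//; have := cos_le1 (2 * pi * x); lra.
Qed.

Lemma fejer_le2 x : fejer x <= 2.
Proof.
have h : normc (fourier1 ctriangle x) <= \int[mu1]_s triangle s.
  apply: normc_cintegral_le_mul; last 2 first.
  - exact: integrable_triangle.
  - by move=> s; rewrite Normc.normcM normc_expi mulr1 normc_realc ger0_norm ?triangle_ge0.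
  by case: (cintegrable_fourier1 x cintegrable_ctriangle).
move: h; rewrite fourier1_triangle normc_realc ger0_norm ?fejer_ge0// => /le_trans; apply.
rewrite -lee_fin /Rintegral fineK; last exact: integrable_fin_num integrable_triangle.
apply: (@le_trans _ _ (\int[mu1]_s (\1_(`[-1, 1]%classic : set R) s)%:E)%E).
  apply: ge0_le_integralT => s; rewrite lee_fin ?triangle_ge0// indicE.
  case: (boolP (s \in _)) => [_|]; first exact: triangle_le1.
  rewrite notin_setE/= in_itv/= -ler_norml => /negP; rewrite -ltNge => s1.
  by rewrite /triangle max_l// subr_le0 ltW.
rewrite integral_indic// setIT [X in (X <= _)%E](lebesgue_measure_itv `[-1, 1])/= lte_fin.
by rewrite ifT -?EFinD ?lee_fin//; lra.
Qed.

(** Up to x^2 = 1 the bound of [fejer_le2] suffices; beyond, the numerator in [fejerE] is at most 4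
    and the denominator at least 16 x^2. *)
Lemma fejer_le x : fejer x <= 4 * cauchyw x.
Proof.
rewrite /cauchyw ler_pdivlMr ?oneDsqr_gt0//.
have [x1|x1] := leP (x ^+ 2) 1.
  rewrite (@le_trans _ _ (2 * 2))//; last lra.
  by apply: ler_pM; rewrite ?fejer_ge0 ?fejer_le2 ?(ltW (oneDsqr_gt0 _))//; lra.
have x0 : x != 0 by apply/eqP => x0; move: x1; rewrite x0 expr0n/= ltr10.
rewrite fejerE// mulrAC ler_pdivrMr; last first.
  by rewrite exprn_even_gt0//= !mulf_neq0// gt_eqF// pi_gt0.
have p2 : (2 : R) <= pi by exact: pi_ge2.
have := cos_geN1 (2 * pi * x); set c := cos _ => c1.
rewrite (@le_trans _ _ (4 * (1 + x ^+ 2)))//.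
  by rewrite ler_wpM2r ?(ltW (oneDsqr_gt0 _))//; lra.
rewrite ler_wpM2l// exprMn (@le_trans _ _ (2 * x ^+ 2))//; first lra.
rewrite ler_wpM2r ?sqr_ge0// exprMn.
by rewrite (@le_trans _ _ (2 ^+ 2 * 2 ^+ 2))//; [lra|apply: ler_wpM2l; [lra|rewrite ler_pXn2r// nnegrE; lra]].
Qed.

Lemma measurable_fejer : measurable_fun setT fejer.
Proof.
apply: (@measurable_Rintegral_section _ _ _ _ R mu1 (fun z : R * R => triangle z.2 * cos (2 * pi * z.1 * z.2))).
apply: measurable_funM.
  by apply: (measurableT_comp measurable_triangle); exact: measurable_snd.
apply: (measurableT_comp (f := cos)).
  by apply: continuous_measurable_fun; exact: continuous_cos.
apply: measurable_funM; last exact: measurable_snd.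
by apply: measurable_funM => //; exact: measurable_fst.
Qed.

Lemma integral_fejer_lty : (\int[mu1]_x (fejer x)%:E < +oo)%E.
Proof.
apply: (@le_lt_trans _ _ (\int[mu1]_x (4%:E * (cauchyw x)%:E))%E).
  apply: ge0_le_integralT => x; rewrite -?EFinM lee_fin ?fejer_ge0//.
  exact: fejer_le.
rewrite ge0_integralZl//; last 2 first.
- by apply/measurable_EFinP; exact: measurable_cauchyw.
- by move=> x _; rewrite lee_fin ltW// cauchyw_gt0.
by rewrite lte_mul_pinfty// integral_cauchyw_lty.
Qed.

Lemma integral_fejer_gt0 : (0 < \int[mu1]_x (fejer x)%:E)%E.
Proof.
(* For x between 1/4 and 1/2 the cosine in [fejerE] is nonpositive, so the numerator is at least 2,
   and the denominator is at most pi^2. *)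
pose c : R := 2 / pi ^+ 2.
have pp : 0 < pi :> R := pi_gt0 R.
have c0 : 0 < c by rewrite divr_gt0// exprn_gt0.
apply: (@lt_le_trans _ _ (\int[mu1]_x (c%:E * (\1_(`[4^-1, 2^-1]%classic : set R) x)%:E))%E).
  rewrite ge0_integralZl//; last 2 first.
  - by apply/measurable_EFinP; apply: measurable_indic.
  - by rewrite lee_fin ltW.
  rewrite integral_indic// setIT [X in (_ * X)%E](lebesgue_measure_itv `[4^-1, 2^-1])/= lte_fin ifT; last lra.
  by rewrite -EFinD -EFinM lte_fin mulr_gt0//; lra.
apply: ge0_le_integralT => x; first by rewrite -EFinM lee_fin mulr_ge0// ltW.
rewrite -EFinM lee_fin indicE; case: (boolP (x \in _)); last by rewrite mulr0 fejer_ge0.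
rewrite inE/= in_itv/= mulr1 => /andP[x1 x2].
have x0 : 0 < x by rewrite (lt_le_trans _ x1).
rewrite fejerE ?gt_eqF// ler_pM//; [by rewrite invr_ge0 exprn_ge0// ltW| |].
  suff : cos (2 * pi * x) <= 0 by lra.
  have -> : 2 * pi * x = (2 * pi * x - pi / 2) + pi / 2 by ring.
  rewrite cosDpihalf oppr_le0 sin_ge0_pi//; apply/andP; split; nra.
rewrite lef_pV2 ?posrE ?exprn_gt0 ?mulr_gt0// ler_pXn2r// ?nnegrE ?mulr_ge0 ?(ltW pp) ?(ltW x0)//.
by nra.
Qed.

End fejer.

Section fejer_rV.
Context {R : realType} {n : nat}.
Notation mu := (@leb R n).

Definition triangleV (x : 'rV[R]_n) : R := \prod_(i < n) triangle (x ord0 i).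
Definition fejerV (x : 'rV[R]_n) : R := \prod_(i < n) fejer (x ord0 i).
Definition cauchyV (x : 'rV[R]_n) : R := \prod_(i < n) cauchyw (x ord0 i).

Lemma realc_prod (f : 'I_n -> R) : (\prod_(i < n) f i)%:C = \prod_(i < n) (f i)%:C.
Proof. exact: (rmorph_prod (real_complex R)). Qed.

Lemma triangleV_ge0 x : 0 <= triangleV x.
Proof. by apply: prodr_ge0 => i _; exact: triangle_ge0. Qed.

Lemma triangleV_le1 x : triangleV x <= 1.
Proof. by apply: prodr_ile1 => i _; rewrite triangle_ge0 triangle_le1. Qed.

Lemma fejerV_ge0 x : 0 <= fejerV x.
Proof. by apply: prodr_ge0 => i _; exact: fejer_ge0. Qed.

Lemma cauchyV_gt0 x : 0 < cauchyV x.
Proof. by apply: prodr_gt0 => i _; exact: cauchyw_gt0. Qed.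

Lemma measurable_coord_prod (f : R -> R) : measurable_fun setT f ->
  measurable_fun setT (fun x : 'rV[R]_n => \prod_(i < n) f (x ord0 i)).
Proof.
move=> mf; apply: measurable_prod => i _.
by apply: (measurableT_comp mf); exact: measurable_coordrV.
Qed.

Lemma integral_coord_prod_lty (f : R -> R) : measurable_fun setT f ->
  (forall s, 0 <= f s) -> (\int[leb1]_s (f s)%:E < +oo)%E ->
  (\int[mu]_x (\prod_(i < n) f (x ord0 i))%:E < +oo)%E.
Proof.
move=> mf f0 fo; rewrite (ge0_integral_prod (f := fun=> f))//.
suff : ((\prod_(i < n) \int[leb1]_s (f s)%:E)%E \is a fin_num).
  by move=> /fin_numP[_]; rewrite ltey.
elim/big_ind : _ => // [x y|i _]; first exact: fin_numM.
rewrite ge0_fin_numE//.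
by apply: integral_ge0 => s _; rewrite lee_fin.
Qed.

Lemma integral_cauchyV_lty : (\int[mu]_x (cauchyV x)%:E < +oo)%E.
Proof.
apply: integral_coord_prod_lty; [exact: measurable_cauchyw| |exact: integral_cauchyw_lty].
by move=> s; exact/ltW/cauchyw_gt0.
Qed.

Lemma cintegrable_realc (f : 'rV[R]_n -> R) : measurable_fun setT f ->
  (forall x, 0 <= f x) -> (\int[mu]_x (f x)%:E < +oo)%E ->
  cintegrable mu (fun x => (f x)%:C).
Proof.
move=> mf f0 fo; split; first exact: cmeasurable_real.
by under eq_integral do rewrite normc_realc ger0_norm//.
Qed.

Lemma cintegrable_cauchyV : cintegrable mu (fun x => (cauchyV x)%:C).
Proof.
apply: cintegrable_realc; last exact: integral_cauchyV_lty.
- exact: (measurable_coord_prod measurable_cauchyw).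
- by move=> x; exact/ltW/cauchyV_gt0.
Qed.

Lemma cintegrable_triangleV : cintegrable mu (fun x => (triangleV x)%:C).
Proof.
apply: cintegrable_realc.
- exact: (measurable_coord_prod measurable_triangle).
- exact: triangleV_ge0.
- by apply: integral_coord_prod_lty; [exact: measurable_triangle|exact: triangle_ge0|exact: integral_triangle_lty].
Qed.

Lemma measurable_fejerV : measurable_fun setT fejerV.
Proof. exact: (measurable_coord_prod measurable_fejer). Qed.

Lemma cintegrable_fejerV : cintegrable mu (fun x => (fejerV x)%:C).
Proof.
apply: cintegrable_realc.
- exact: measurable_fejerV.
- exact: fejerV_ge0.
- by apply: integral_coord_prod_lty; [exact: measurable_fejer|exact: fejer_ge0|exact: integral_fejer_lty].
Qed.

Lemma fourier_triangleV xi :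
  fourier (fun x => (triangleV x)%:C) xi = (fejerV xi)%:C.
Proof.
rewrite /fejerV realc_prod.
transitivity (\prod_(i < n) fourier1 (@ctriangle R) (xi ord0 i)); last first.
  by apply: eq_bigr => i _; rewrite fourier1_triangle.
rewrite -(@fourier_prod R n (fun=> @ctriangle R)).
  by congr fourier; apply/funext => x; rewrite /triangleV realc_prod.
by move=> i; exact: cintegrable_ctriangle.
Qed.

(** Equal to 1 by Fourier inversion at the origin, but carried as a positive constant; it is the
    constant of both [plancherel_le] and [fourier_inversion]. *)
Definition fejer_mass : R := \int[mu]_x fejerV x.

Lemma fejer_massE : (fejer_mass%:E = \int[mu]_x (fejerV x)%:E)%E.
Proof.
rewrite /fejer_mass /Rintegral fineK//.
exact: (integrable_fin_num measurableT (cintegrable_Re cintegrable_fejerV)).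
Qed.

Lemma fejer_mass_gt0 : 0 < fejer_mass.
Proof.
rewrite -lte_fin fejer_massE (ge0_integral_prod (f := fun=> @fejer R))//; last 2 first.
- by move=> i; exact: measurable_fejer.
- by move=> i s; exact: fejer_ge0.
elim/big_ind : _ => // [x y|i _]; [exact: mule_gt0|exact: integral_fejer_gt0].
Qed.

Lemma measurable_triangleV : measurable_fun setT triangleV.
Proof. exact: (measurable_coord_prod measurable_triangle). Qed.

Lemma cvg_triangleV (x : 'rV[R]_n) : triangleV (k.+1%:R^-1 *: x) @[k --> \oo] --> (1 : R).
Proof.
have E : \prod_(i < n) triangle (0 * x ord0 i) = 1.
  by rewrite big1// => i _; rewrite mul0r triangle0.
rewrite -[X in _ --> X]E.
rewrite /triangleV; apply: cvg_big => //; first exact: mul_continuous.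
move=> i _; under eq_fun do rewrite mxE.
apply: (cvg_comp (fun k : nat => k.+1%:R^-1 * x ord0 i) (@triangle R) _ (@continuous_triangle R (0 * x ord0 i))).
by apply: cvgM; [exact: cvg_harmonic|exact: cvg_cst].
Qed.

Lemma fourier_triangleV_scaled (e : R) (a xi : 'rV[R]_n) : 0 < e ->
  fourier (fun x => (triangleV (e *: x))%:C * expi (2 * pi * dotrV x a)) xi =
  ((e ^- n) * fejerV (e^-1 *: (xi - a)))%:C.
Proof.
move=> e0; rewrite fourier_modulation.
have ti := cintegrable_triangleV.
have ei0 : 0 < e^-1 by rewrite invr_gt0.
have := fourier_dilation (xi - a) ei0 ti.
rewrite fourier_triangleV /dilation => E.
have -> : fourier (fun x => (triangleV (e *: x))%:C) (xi - a) =
    (e ^- n)%:C * fourier (fun x => (e^-1 ^- n)%:C * (triangleV (e^-1^-1 *: x))%:C) (xi - a).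
  rewrite !fourierE -cintegralZ; last first.
    apply: cintegrable_fourier_integrand.
    exact: (cintegrable_dilation ei0 ti).
  congr cintegral; apply/funext => x; rewrite invrK !mulrA -[_ * (_ ^- n)%:C]rmorphM.
  by rewrite exprVn mulfV ?rmorph1 ?mul1r// invr_eq0 expf_eq0 gt_eqF ?andbF.
by rewrite E rmorphM.
Qed.

Lemma cintegrable_triangleV_scaled (e : R) : 0 < e ->
  cintegrable mu (fun x => (triangleV (e *: x))%:C).
Proof.
move=> e0; have ne : e != 0 by rewrite gt_eqF.
have := cintegrable_affine 0 ne cintegrable_triangleV.
by congr cintegrable; apply/funext => x; rewrite addr0.
Qed.

End fejer_rV.

(** * A Plancherel inequality *)

(* Keeps unification from unfolding integrals when two of them differ. *)
Opaque integral.

Section fatou_bound.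
Context d (T : measurableType d) (R : realType).
Variable mu : {measure set T -> \bar R}.

Lemma fatou_le (f_ : nat -> T -> \bar R) (f : T -> \bar R) (M : \bar R) :
  (forall n, measurable_fun setT (f_ n)) -> (forall n x, 0 <= f_ n x)%E ->
  (forall x, f_ ^~ x @ \oo --> f x) -> (forall n, \int[mu]_x f_ n x <= M)%E ->
  (\int[mu]_x f x <= M)%E.
Proof.
move=> mf f0 cf fM.
have -> : (\int[mu]_x f x = \int[mu]_x limn_einf (f_^~ x))%E.
  by apply: eq_integral => x _; rewrite (cvg_limn_einf_sup (cf x)).1.
apply: (le_trans (fatou mu measurableT mf (fun n x _ => f0 n x))).
rewrite limn_einf_lim; apply: lime_le; first exact: is_cvg_einfs.
apply: nearW => n; apply: le_trans (fM n).
by apply: ereal_inf_lbound; exists n => //=.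
Qed.

End fatou_bound.

Section real_integrands.
Context d (T : measurableType d) (R : realType).
Variable mu : {measure set T -> \bar R}.

Lemma ge0_integralZ_EFin (c : R) (f : T -> R) : 0 <= c ->
  measurable_fun setT f -> (forall x, 0 <= f x) ->
  (\int[mu]_x (c * f x)%:E = c%:E * \int[mu]_x (f x)%:E)%E.
Proof.
move=> c0 mf f0; rewrite -ge0_integralZl//.
- exact/measurable_EFinP.
- by move=> x _; rewrite lee_fin.
Qed.

Lemma integral_realcE (f : T -> R) : measurable_fun setT f ->
  (forall x, 0 <= f x) -> cintegrable mu (fun x => (f x)%:C) ->
  (\int[mu]_x (f x)%:E = (normc (cintegral mu setT (fun x => (f x)%:C)))%:E)%E.
Proof.
move=> mf f0 fi; rewrite cintegralE/=.
have -> : \int[mu]_x 0 = 0 :> R.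
  by rewrite /Rintegral (eq_integral (cst 0%E))// integral0.
rewrite expr0n/= addr0 sqrtr_sqr ger0_norm; last by apply: Rintegral_ge0 => x _.
by rewrite /Rintegral fineK//; exact: (integrable_fin_num measurableT (cintegrable_Re fi)).
Qed.

End real_integrands.

Lemma ge0_integral2D d1 d2 (T1 : measurableType d1) (T2 : measurableType d2)
    (R : realType) (m1 : {sigma_finite_measure set T1 -> \bar R})
    (m2 : {sigma_finite_measure set T2 -> \bar R}) (g1 g2 : T1 * T2 -> \bar R) :
  measurable_fun setT g1 -> measurable_fun setT g2 ->
  (forall z, 0 <= g1 z)%E -> (forall z, 0 <= g2 z)%E ->
  (\int[m1]_x \int[m2]_y (g1 (x, y) + g2 (x, y)) =
   \int[m1]_x \int[m2]_y g1 (x, y) + \int[m1]_x \int[m2]_y g2 (x, y))%E.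
Proof.
move=> mg1 mg2 g10 g20.
rewrite -ge0_integralD//; last 4 first.
- by move=> x _; exact: integral_ge0.
- exact: (measurable_fun_fubini_tonelli_F (m2 := m2) g1).
- by move=> x _; exact: integral_ge0.
- exact: (measurable_fun_fubini_tonelli_F (m2 := m2) g2).
apply: eq_integral => x _; apply: ge0_integralD => //.
  exact: (measurableT_comp mg1 (pair1_measurable x)).
exact: (measurableT_comp mg2 (pair1_measurable x)).
Qed.

Section plancherel.
Context {R : realType} {n : nat}.
Notation mu := (@leb R n).
Implicit Types (u v w f : 'rV[R]_n -> R[i]).

Lemma conjcM (z w : R[i]) : conjc (z * w) = conjc z * conjc w.
Proof. by case: z w => a b [c e]; rewrite /GRing.mul/=; congr (_ +i* _); ring. Qed.

Lemma fourier_conj u xi : cintegrable mu u ->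
  conjc (fourier u xi) = fourier (fun x => conjc (u x)) (- xi).
Proof.
move=> ui; rewrite !fourierE -cintegral_conj; last exact: cintegrable_fourier_integrand.
congr cintegral; apply/funext => x.
by rewrite conjcM conj_expi dotrVNr mulrN !opprK.
Qed.

Lemma fourier_opp u xi : cintegrable mu u ->
  fourier u (- xi) = fourier (fun x => u (- x)) xi.
Proof.
move=> ui; rewrite !fourierE -[LHS]cintegralN; last exact: cintegrable_fourier_integrand.
by congr cintegral; apply/funext => x; rewrite dotrVNl dotrVNr opprK.
Qed.

(** The transform of the triangle dilated by [e]. Its mass is the same for all [e], and it
    concentrates at 0 as [e] tends to 0. *)
Definition fejer_scaled (e : R) (x : 'rV[R]_n) : R := e ^- n * fejerV (e^-1 *: x).

Lemma fejer_scaled_ge0 e x : 0 < e -> 0 <= fejer_scaled e x.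
Proof. by move=> e0; rewrite mulr_ge0 ?fejerV_ge0// invr_ge0 exprn_ge0// ltW. Qed.

Lemma measurable_fejer_scaled d (T : measurableType d) (e : R) (h : T -> 'rV[R]_n) :
  measurable_fun setT h -> measurable_fun setT (fun t => fejer_scaled e (h t)).
Proof.
move=> mh; apply: measurable_funM => //; apply: (measurableT_comp measurable_fejerV).
exact: measurable_fun_rVZ.
Qed.

Lemma integral_fejer_scaled e : 0 < e ->
  (\int[mu]_x (fejer_scaled e x)%:E = (@fejer_mass R n)%:E)%E.
Proof.
move=> e0; have ei : e^-1 != 0 by rewrite invr_eq0 gt_eqF.
rewrite fejer_massE -(@ge0_integral_leb_affine R n e^-1 0 (fun x => (fejerV x)%:E) ei); last 2 first.
- by apply/measurable_EFinP; exact: measurable_fejerV.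
- by move=> x; rewrite lee_fin fejerV_ge0.
rewrite -ge0_integralZ_EFin; last 3 first.
- exact: exprn_ge0.
- by apply: (measurableT_comp measurable_fejerV); exact: measurable_scalerD.
- by move=> x; exact: fejerV_ge0.
apply: eq_integral => x _; rewrite addr0 /fejer_scaled; congr (_ * _)%:E.
by rewrite ger0_norm ?invr_ge0 ?ltW// exprVn.
Qed.

(** Multiplication formula: cutting the transform off by a triangle before inverting it amounts to
    averaging [u] around [x] against the Fejer kernel. The L^2 bound and the inversion theorem both
    rest on this. *)
Lemma fourier_mul_triangle u (e : R) (x : 'rV[R]_n) : 0 < e -> cintegrable mu u ->
  cintegral mu setT (fun xi => fourier u xi *
    ((triangleV (e *: xi))%:C * expi (2 * pi * dotrV xi x))) =
  cintegral mu setT (fun y => u y * (fejer_scaled e (y - x))%:C).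
Proof.
move=> e0 ui; rewrite fourier_multiplication//; last first.
  apply: cintegrable_expi; first exact: cintegrable_triangleV_scaled.
  by under eq_fun do rewrite -[2 * _ * _]mul1r; exact: measurable_phase.
by congr cintegral; apply/funext => y; rewrite fourier_triangleV_scaled.
Qed.

Lemma measurable_sqr_normc d (T : measurableType d) (f : T -> R[i]) :
  cmeasurable f -> measurable_fun setT (fun x => (normc (f x) ^+ 2)%:E).
Proof.
by move=> mf; apply/measurable_EFinP; apply: measurable_funX; exact: cmeasurable_normc.
Qed.

(** Schur's test: the product of two values of |u| is at most half the sum of their squares, and the
    kernel has mass [fejer_mass] in either variable. *)
Lemma integral_fejer_quadratic u (e : R) : 0 < e -> cmeasurable u ->
  (\int[mu]_x \int[mu]_y (normc (u x) * (normc (u y) * fejer_scaled e (x - y)))%:E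
    <= (@fejer_mass R n)%:E * \int[mu]_x (normc (u x) ^+ 2)%:E)%E.
Proof.
move=> e0 mu'; have mn := cmeasurable_normc mu'.
pose K (z : 'rV[R]_n * 'rV[R]_n) := fejer_scaled e (z.1 - z.2).
have mK : measurable_fun setT K.
  apply: measurable_fejer_scaled; apply: measurable_fun_rVB;
  [exact: measurable_fst|exact: measurable_snd].
have K0 z : 0 <= K z by exact: fejer_scaled_ge0.
have mn1 : measurable_fun setT (fun z : 'rV[R]_n * 'rV[R]_n => normc (u z.1)).
  exact: (measurableT_comp mn measurable_fst).
have mn2 : measurable_fun setT (fun z : 'rV[R]_n * 'rV[R]_n => normc (u z.2)).
  exact: (measurableT_comp mn measurable_snd).
pose g1 (z : 'rV[R]_n * 'rV[R]_n) := (2^-1 * (normc (u z.1) ^+ 2 * K z))%:E.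
pose g2 (z : 'rV[R]_n * 'rV[R]_n) := (2^-1 * (normc (u z.2) ^+ 2 * K z))%:E.
have g10 z : (0 <= g1 z)%E by rewrite lee_fin mulr_ge0// mulr_ge0// sqr_ge0.
have g20 z : (0 <= g2 z)%E by rewrite lee_fin mulr_ge0// mulr_ge0// sqr_ge0.
have mg1 : measurable_fun setT g1.
  apply/measurable_EFinP; apply: measurable_funM => //.
  by apply: measurable_funM => //; exact: measurable_funX.
have mg2 : measurable_fun setT g2.
  apply/measurable_EFinP; apply: measurable_funM => //.
  by apply: measurable_funM => //; exact: measurable_funX.
have kk0 x y : 0 <= normc (u x) * (normc (u y) * fejer_scaled e (x - y)).
  by apply: mulr_ge0; [|apply: mulr_ge0]; rewrite ?normc_ge0 ?fejer_scaled_ge0.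
apply: (@le_trans _ _ (\int[mu]_x \int[mu]_y (g1 (x, y) + g2 (x, y)))%E).
  apply: ge0_le_integralT => x.
    by apply: integral_ge0 => y _; rewrite lee_fin.
  apply: ge0_le_integralT => y; first by rewrite lee_fin.
  rewrite /g1 /g2 -EFinD lee_fin /K/= mulrA -mulrDr -mulrDl mulrA ler_wpM2r ?fejer_scaled_ge0//.
  have := sqr_ge0 (normc (u x) - normc (u y)); nra.
rewrite (ge0_integral2D mu mu mg1 mg2 g10 g20).
have mass x : (\int[mu]_y (K (x, y))%:E = (@fejer_mass R n)%:E)%E.
  rewrite -(integral_fejer_scaled e0).
  rewrite -(ge0_integral_reflect x (f := fun y => (fejer_scaled e y)%:E))//.
    by apply/measurable_EFinP; exact: measurable_fejer_scaled.
  by move=> y; rewrite lee_fin fejer_scaled_ge0.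
have mass' y : (\int[mu]_x (K (x, y))%:E = (@fejer_mass R n)%:E)%E.
  rewrite -(integral_fejer_scaled e0).
  rewrite -(ge0_integral_shift (- y) (f := fun y => (fejer_scaled e y)%:E))//.
    by apply/measurable_EFinP; exact: measurable_fejer_scaled.
  by move=> z; rewrite lee_fin fejer_scaled_ge0.
have half0 (z : 'rV[R]_n) : 0 <= 2^-1 * normc (u z) ^+ 2 by rewrite mulr_ge0// sqr_ge0.
have E1 : (\int[mu]_x \int[mu]_y g1 (x, y) = \int[mu]_x ((2^-1 * @fejer_mass R n)%:E * (normc (u x) ^+ 2)%:E))%E.
  apply: eq_integral => x _ /=.
  transitivity (\int[mu]_y ((2^-1 * normc (u x) ^+ 2) * K (x, y))%:E)%E.
    by apply: eq_integral => y _; rewrite /g1/= mulrA.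
  rewrite ge0_integralZ_EFin//; last exact: (measurableT_comp mK (pair1_measurable x)).
  by rewrite mass -!EFinM; congr EFin; ring.
have E2 : (\int[mu]_x \int[mu]_y g2 (x, y) = \int[mu]_x ((2^-1 * @fejer_mass R n)%:E * (normc (u x) ^+ 2)%:E))%E.
  rewrite (fubini_tonelli (m1 := mu) (m2 := mu) g2 mg2 g20).
  apply: eq_integral => y _.
  transitivity (\int[mu]_x ((2^-1 * normc (u y) ^+ 2) * K (x, y))%:E)%E.
    by apply: eq_integral => x _; rewrite /g2/= mulrA.
  rewrite ge0_integralZ_EFin//; last exact: (measurableT_comp mK (pair2_measurable y)).
  by rewrite mass' -!EFinM; congr EFin; ring.
have fm0 : 0 <= @fejer_mass R n by rewrite ltW// fejer_mass_gt0.
rewrite [X in (X + _)%E]E1 [X in (_ + X)%E]E2 ge0_integralZl//; last 3 first.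
- exact: measurable_sqr_normc.
- by move=> x _; rewrite lee_fin sqr_ge0.
- by rewrite lee_fin mulr_ge0.
rewrite -ge0_muleDl ?lee_fin ?mulr_ge0// -EFinD -mulrDl.
have -> : 2^-1 + 2^-1 = 1 :> R by lra.
by rewrite mul1r.
Qed.

(** With a triangle as convergence factor the left side becomes, by the multiplication formula, a
    quadratic form in [u] with the Fejer kernel, bounded independently of the factor. Fatou's lemma
    then removes the factor. *)
Theorem plancherel_le u : cintegrable mu u ->
  (\int[mu]_xi (normc (fourier u xi) ^+ 2)%:E <=
    (@fejer_mass R n)%:E * \int[mu]_x (normc (u x) ^+ 2)%:E)%E.
Proof.
move=> ui; have mu' : cmeasurable u by case: ui.
have mfu := cmeasurable_fourier mu'.
pose e (k : nat) : R := k.+1%:R^-1.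
have e0 k : 0 < e k by rewrite invr_gt0.
apply: (@fatou_le _ _ _ mu (fun k xi => (normc (fourier u xi) ^+ 2 * triangleV (e k *: xi))%:E)).
- move=> k; apply/measurable_EFinP; apply: measurable_funM.
    by apply: measurable_funX; exact: cmeasurable_normc.
  apply: (measurableT_comp measurable_triangleV).
  by apply: measurable_fun_rVZ.
- by move=> k xi; rewrite lee_fin mulr_ge0 ?sqr_ge0 ?triangleV_ge0.
- move=> xi; apply/cvg_EFin; first exact: nearW.
  rewrite -[X in _ --> X]mulr1; apply: cvgM; first exact: cvg_cst.
  exact: cvg_triangleV.
move=> k; set I := (X in (X <= _)%E).
have ti := cintegrable_triangleV_scaled (n := n) (e0 k).
(* The product [fourier u * v] is the truncated |u^|^2, and [v] is integrable because u^ is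
   bounded. *)
pose v xi := conjc (fourier u xi) * (triangleV (e k *: xi))%:C.
have vi : cintegrable mu v.
  apply: (cintegrable_bounded_mul (M := norm1 u)) => //; first exact: cmeasurable_conj.
  by move=> xi; rewrite normc_conjc normc_fourier_le.
have fvi : cintegrable mu (fun xi => fourier u xi * v xi).
  by apply: (cintegrable_bounded_mul (M := norm1 u)) => // xi; exact: normc_fourier_le.
have fv : (fun xi => fourier u xi * v xi) =
    (fun xi => (normc (fourier u xi) ^+ 2 * triangleV (e k *: xi))%:C).
  by apply/funext => xi; rewrite mulrA mulc_conj -rmorphM.
have -> : I = (normc (cintegral mu setT (fun xi => fourier u xi * v xi)))%:E.
  rewrite fv /I integral_realcE//.
  - apply: measurable_funM; first by apply: measurable_funX; exact: cmeasurable_normc.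
    by apply: (measurableT_comp measurable_triangleV); exact: measurable_fun_rVZ.
  - by move=> x; rewrite mulr_ge0 ?sqr_ge0 ?triangleV_ge0.
  - by rewrite -fv.
rewrite fourier_multiplication//.
have mfv := cmeasurable_fourier (proj1 vi).
apply: le_trans (integral_fejer_quadratic (e0 k) mu').
apply: le_trans (normc_cintegral_le _) _.
  have := cintegrable_bounded_mul mfv ui (fun xi => normc_fourier_le xi vi).
  by congr cintegrable; apply/funext => x; rewrite mulrC.
apply: ge0_le_integralT => x; first by rewrite lee_fin normc_ge0.
rewrite Normc.normcM.
(* The conjugate of [fourier u] is the transform of [w], so [fourier v] is a Fejer mean of [w]. *)
pose w y := conjc (u (- y)).
have wi : cintegrable mu w by apply: cintegrable_conj; exact: cintegrable_opp.
have -> : fourier v x = cintegral mu setT (fun y => w y * (fejer_scaled (e k) (y + x))%:C).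
  rewrite -[x in RHS]opprK -fourier_mul_triangle// fourierE; congr cintegral.
  apply/funext => xi; rewrite /v fourier_conj// fourier_opp; last exact: cintegrable_conj.
  by rewrite dotrVNr mulrN mulrA.
have mK : measurable_fun setT (fun y : 'rV[R]_n => fejer_scaled (e k) (y + x)).
  apply: measurable_fejer_scaled.
  by apply: measurable_fun_rVD.
have mK2 : measurable_fun setT (fun y : 'rV[R]_n => fejer_scaled (e k) (x - y)).
  apply: measurable_fejer_scaled.
  by apply: measurable_fun_rVB.
have mnu := cmeasurable_normc mu'.
rewrite EFinM.
under [leRHS]eq_integral do rewrite EFinM.
rewrite ge0_integralZl//; last 3 first.
- by apply/measurable_EFinP; exact: measurable_funM.
- by move=> y _; rewrite lee_fin mulr_ge0 ?normc_ge0 ?fejer_scaled_ge0.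
- by rewrite lee_fin normc_ge0.
apply: lee_wpmul2l; first by rewrite lee_fin normc_ge0.
have -> : (\int[mu]_y (normc (u y) * fejer_scaled (e k) (x - y))%:E =
    \int[mu]_y (normc (w y) * fejer_scaled (e k) (y + x))%:E)%E.
  rewrite -(ge0_integral_reflect 0 (f := fun y => (normc (u y) * fejer_scaled (e k) (x - y))%:E)).
  - by apply: eq_integral => y _; rewrite /w normc_conjc sub0r opprK addrC.
  - by apply/measurable_EFinP; exact: measurable_funM.
  - by move=> y; rewrite lee_fin mulr_ge0 ?normc_ge0 ?fejer_scaled_ge0.
have Kb y : fejer_scaled (e k) (y + x) <= e k ^- n * 2 ^+ n.
  rewrite ler_wpM2l//; first by rewrite invr_ge0 exprn_ge0// ltW.
  rewrite -[n in leRHS]card_ord -prodr_const; apply: ler_prod => i _.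
  by rewrite fejer_ge0 fejer_le2.
apply: le_trans (normc_cintegral_le _) _.
  have := cintegrable_bounded_mul (cmeasurable_real mK) wi (M := e k ^- n * 2 ^+ n).
  under eq_fun do rewrite mulrC.
  by apply => y; rewrite normc_realc ger0_norm ?fejer_scaled_ge0.
apply: ge0_le_integralT => y; first by rewrite lee_fin normc_ge0.
by rewrite Normc.normcM normc_realc ger0_norm ?fejer_scaled_ge0.
Qed.

End plancherel.

(** * Inversion and decay of Fourier transforms *)

Section complex_dominated.
Context d (T : measurableType d) (R : realType).
Variable mu : {measure set T -> \bar R}.

Lemma cintegral_dominated_cvg (f_ : nat -> T -> R[i]) (f : T -> R[i]) (g : T -> R) :
  (forall k, cmeasurable (f_ k)) -> cmeasurable f ->
  (forall x, Re (f_ k x) @[k --> \oo] --> Re (f x)) ->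
  (forall x, Im (f_ k x) @[k --> \oo] --> Im (f x)) ->
  mu.-integrable setT (EFin \o g) -> (forall k x, normc (f_ k x) <= g x) ->
  (Re (cintegral mu setT (f_ k)) @[k --> \oo] --> Re (cintegral mu setT f)) /\
  (Im (cintegral mu setT (f_ k)) @[k --> \oo] --> Im (cintegral mu setT f)).
Proof.
move=> mf_ mf cr ci gi fg; split.
  apply: (Rintegral_dominated_cvg (g := g) (f_ := fun k x => Re (f_ k x))) => //.
  - by move=> k; case: (mf_ k).
  - by case: mf.
  - by move=> k x; exact: le_trans (abs_Re_le _) (fg k x).
apply: (Rintegral_dominated_cvg (g := g) (f_ := fun k x => Im (f_ k x))) => //.
- by move=> k; case: (mf_ k).
- by case: mf.
- by move=> k x; exact: le_trans (abs_Im_le _) (fg k x).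
Qed.

End complex_dominated.

Section inversion.
Context {R : realType} {n : nat}.
Notation mu := (@leb R n).
Implicit Types (u : 'rV[R]_n -> R[i]).

Lemma Re_mulcr (z : R[i]) (t : R) : Re (z * t%:C) = Re z * t.
Proof. by rewrite Re_mulc/= mulr0 subr0. Qed.

Lemma Im_mulcr (z : R[i]) (t : R) : Im (z * t%:C) = Im z * t.
Proof. by rewrite Im_mulc/= mulr0 add0r. Qed.

(** The substitution y = e z + x moves [e] from the kernel into the argument of [u], so that one
    integrable majorant serves for all [e]. *)
Lemma cintegral_fejer_shift u (e : R) (x : 'rV[R]_n) (M : R) : 0 < e ->
  cintegrable mu u -> (forall y, normc (u y) <= M) ->
  cintegral mu setT (fun y => u y * (fejer_scaled e (y - x))%:C) =
  cintegral mu setT (fun z => u (e *: z + x) * (fejerV z)%:C).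
Proof.
move=> e0 ui uM; have ne : e != 0 by rewrite gt_eqF.
have en : e ^+ n != 0 by rewrite expf_eq0 (negbTE ne) andbF.
have E z : u (e *: z + x) * (fejer_scaled e (e *: z + x - x))%:C =
    (e ^- n)%:C * (u (e *: z + x) * (fejerV z)%:C).
  rewrite addrK /fejer_scaled scalerA mulVf// scale1r rmorphM/=; ring.
have mK : measurable_fun setT (fun y : 'rV[R]_n => fejer_scaled e (y - x)).
  by apply: measurable_fejer_scaled; exact: measurable_fun_rVB.
have fi : cintegrable mu (fun z => u (e *: z + x) * (fejerV z)%:C).
  apply: (cintegrable_bounded_mul (M := M)) => //; last exact: cintegrable_fejerV.
  by case: (cintegrable_affine x ne ui).
have fKi : cintegrable mu (fun y => u y * (fejer_scaled e (y - x))%:C).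
  under eq_fun do rewrite mulrC.
  apply: (cintegrable_bounded_mul (M := e ^- n * 2 ^+ n)) => //.
  move=> y; rewrite normc_realc ger0_norm ?fejer_scaled_ge0//.
  rewrite ler_wpM2l ?invr_ge0 ?exprn_ge0 ?(ltW e0)//.
  rewrite -[n in leRHS]card_ord -prodr_const; apply: ler_prod => i _.
  by rewrite fejer_ge0 fejer_le2.
rewrite -(cintegral_affine x ne fKi).
under eq_fun do rewrite E.
rewrite (cintegralZ _ fi) mulrA -rmorphM ger0_norm ?(ltW e0)//= mulfV//.
by rewrite rmorph1 mul1r.
Qed.

(** The Fejer means [A k = B k] have two limits. On the frequency side the triangle tends to 1; on
    the space side [u] is sampled ever closer to [x], and continuity at [x] gives the value times
    the mass of the kernel. *)
Theorem fourier_inversion u (M : R) (x : 'rV[R]_n) :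
  cintegrable mu u -> cintegrable mu (fourier u) ->
  (forall y, normc (u y) <= M) ->
  {for x, continuous (fun y => Re (u y))} -> {for x, continuous (fun y => Im (u y))} ->
  inv_fourier (fourier u) x = (@fejer_mass R n)%:C * u x.
Proof.
move=> ui fui uM cr ci.
pose e (k : nat) : R := k.+1%:R^-1.
have e0 k : 0 < e k by rewrite invr_gt0.
have ce z : e k *: z + x @[k --> \oo] --> x.
  rewrite -[X in _ --> X]add0r -(scale0r z).
  by apply: cvgD; [apply: cvgZr_tmp; exact: cvg_harmonic|exact: cvg_cst].
pose A k := cintegral mu setT (fun xi => fourier u xi * expi (2 * pi * dotrV xi x) * (triangleV (e k *: xi))%:C).
pose B k := cintegral mu setT (fun z => u (e k *: z + x) * (fejerV z)%:C).
have AB k : A k = B k.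
  rewrite /B -(cintegral_fejer_shift x (e0 k) ui uM) -fourier_mul_triangle//.
  by congr cintegral; apply/funext => xi; rewrite -mulrA [expi _ * _]mulrC.
have mfu := proj1 fui.
have [mu' _] := ui.
have mexp : cmeasurable (fun xi => expi (2 * pi * dotrV xi x) : R[i]).
  by apply: cmeasurable_inv_fourier_kernel.
have [Ar Ai] : (Re (A k) @[k --> \oo] --> Re (inv_fourier (fourier u) x)) /\
    (Im (A k) @[k --> \oo] --> Im (inv_fourier (fourier u) x)).
  have -> : inv_fourier (fourier u) x =
      cintegral mu setT (fun xi => fourier u xi * expi (2 * pi * dotrV xi x)).
    by rewrite /inv_fourier; congr cintegral; apply/funext => xi; rewrite dotrVC.
  apply: (cintegral_dominated_cvg (g := fun xi => normc (fourier u xi))).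
  - move=> k; apply: cmeasurableM; first exact: cmeasurableM.
    apply: cmeasurable_real; apply: (measurableT_comp measurable_triangleV).
    exact: measurable_fun_rVZ.
  - exact: cmeasurableM.
  - move=> xi; under eq_fun do rewrite Re_mulcr.
    set w := Re _; rewrite -[X in nbhs X]mulr1.
    by apply: cvgM; [exact: cvg_cst|exact: cvg_triangleV].
  - move=> xi; under eq_fun do rewrite Im_mulcr.
    set w := Im _; rewrite -[X in nbhs X]mulr1.
    by apply: cvgM; [exact: cvg_cst|exact: cvg_triangleV].
  - exact: cintegrable_normc.
  - move=> k xi; rewrite !Normc.normcM normc_expi mulr1 normc_realc ger0_norm ?triangleV_ge0//.
    by rewrite ler_piMr ?normc_ge0// triangleV_le1.
have [Br Bi] : (Re (B k) @[k --> \oo] --> Re ((@fejer_mass R n)%:C * u x)) /\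
    (Im (B k) @[k --> \oo] --> Im ((@fejer_mass R n)%:C * u x)).
  have -> : (@fejer_mass R n)%:C * u x = cintegral mu setT (fun z => u x * (fejerV z)%:C).
    rewrite cintegralZ; last exact: cintegrable_fejerV.
    rewrite mulrC; congr (_ * _); rewrite cintegralE/=; congr (_ +i* _).
    by rewrite /Rintegral (eq_integral (cst 0%E))// integral0.
  apply: (cintegral_dominated_cvg (g := fun z => M * fejerV z)).
  - move=> k; apply: cmeasurableM; last exact: (cmeasurable_real measurable_fejerV).
    by apply: (cmeasurable_comp _ mu'); exact: measurable_scalerD.
  - apply: cmeasurableM; first exact: cmeasurable_cst.
    exact: (cmeasurable_real measurable_fejerV).
  - move=> z; under eq_fun do rewrite Re_mulcr.
    rewrite Re_mulcr; apply: cvgM; last exact: cvg_cst.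
    exact: (cvg_comp _ _ (ce z) cr).
  - move=> z; under eq_fun do rewrite Im_mulcr.
    rewrite Im_mulcr; apply: cvgM; last exact: cvg_cst.
    exact: (cvg_comp _ _ (ce z) ci).
  - exact: (integrableZl measurableT M (cintegrable_Re (@cintegrable_fejerV R n))).
  - move=> k z; rewrite Normc.normcM normc_realc ger0_norm ?fejerV_ge0//.
    by rewrite ler_wpM2r ?fejerV_ge0.
apply/eqP; rewrite eq_complex; apply/andP; split; apply/eqP.
  move: Ar; under eq_fun do rewrite AB.
  by move=> Ar; exact: (cvg_unique _ Ar Br).
move: Ai; under eq_fun do rewrite AB.
by move=> Ai; exact: (cvg_unique _ Ai Bi).
Qed.

End inversion.

(** * Rapid decay *)

Section rapid_decay.
Context {R : realType} {n : nat}.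
Notation mu := (@leb R n).
Implicit Types (u v : 'rV[R]_n -> R[i]).

(** The decay part of the Schwartz condition alone: it survives multiplication by a symbol of
    polynomial growth that is not smooth. *)
Definition rapid u : Prop :=
  forall k : nat, exists M : R, forall x, (1 + enorm x) ^+ k * normc (u x) <= M.

Lemma oneDenorm_gt0 (x : 'rV[R]_n) : 0 < 1 + enorm x.
Proof. by rewrite ltr_pwDl// enorm_ge0. Qed.

Lemma oneDenorm_ge1 (x : 'rV[R]_n) : 1 <= 1 + enorm x.
Proof. by rewrite lerDl enorm_ge0. Qed.

(** Each coordinate satisfies 1 + x_i^2 <= (1 + |x|)^2, and there are [n] of them. Decay of order
    [2 * n] therefore implies integrability. *)
Lemma cauchyV_ge (x : 'rV[R]_n) : (1 + enorm x) ^- (2 * n) <= cauchyV x.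
Proof.
have -> : (1 + enorm x) ^- (2 * n) = \prod_(i < n) (1 + enorm x) ^- 2.
  by rewrite prodr_const card_ord exprM exprVn.
apply: ler_prod => i _; rewrite invr_ge0 exprn_ge0 ?(ltW (oneDenorm_gt0 _))//= lef_pV2 ?posrE ?exprn_gt0 ?oneDenorm_gt0 ?oneDsqr_gt0//.
have h := abs_coord_le x i; have h0 := enorm_ge0 x.
rewrite sqrrD expr1n mul1r -(@real_normK _ (x ord0 i)) ?num_real//.
have h1 : `|x ord0 i| ^+ 2 <= enorm x ^+ 2 by rewrite ler_pXn2r// nnegrE.
by lra.
Qed.

Lemma rapid_le u k : rapid u -> exists M : R, 0 <= M /\
  forall x, normc (u x) <= M * (1 + enorm x) ^- k.
Proof.
move=> /(_ k)[M uM]; exists `|M|; split => // x.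
rewrite ler_pdivlMr ?exprn_gt0 ?oneDenorm_gt0// mulrC (le_trans (uM x))//.
exact: ler_norm.
Qed.

Lemma rapid_bounded u : rapid u -> exists M : R, forall x, normc (u x) <= M.
Proof.
move=> /(rapid_le 0)[M [_ uM]]; exists M => x.
by move: (uM x); rewrite expr0 invr1 mulr1.
Qed.

Lemma rapid_integrable u : cmeasurable u -> rapid u -> cintegrable mu u.
Proof.
move=> mu' /(rapid_le (2 * n))[M [M0 uM]].
apply: (cintegrable_le mu' (cintegrableZ M%:C cintegrable_cauchyV)) => x.
rewrite Normc.normcM !normc_realc !ger0_norm ?(ltW (cauchyV_gt0 _))//.
by rewrite (le_trans (uM x))// ler_wpM2l// cauchyV_ge.
Qed.

Lemma rapid_mul_growth u (A : R) (k : nat) (m : 'rV[R]_n -> R[i]) :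
  (forall x, normc (m x) <= A * (1 + enorm x) ^+ k) -> rapid u ->
  rapid (fun x => m x * u x).
Proof.
move=> mA ru j; have [M uM] := ru (j + k)%N.
exists (`|A| * M) => x; rewrite Normc.normcM.
have p0 i : 0 <= (1 + enorm x) ^+ i by rewrite exprn_ge0// ltW// oneDenorm_gt0.
rewrite (@le_trans _ _ ((1 + enorm x) ^+ j * ((`|A| * (1 + enorm x) ^+ k) * normc (u x))))//.
  rewrite ler_wpM2l// ler_wpM2r ?normc_ge0// (le_trans (mA x))//.
  by rewrite ler_wpM2r// ler_norm.
rewrite [leLHS](_ : _ = `|A| * ((1 + enorm x) ^+ (j + k) * normc (u x))); last by rewrite exprD; ring.
by rewrite ler_wpM2l.
Qed.

Lemma rapid_mul_bounded u (A : R) (m : 'rV[R]_n -> R[i]) :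
  (forall x, normc (m x) <= A) -> rapid u -> rapid (fun x => m x * u x).
Proof. by move=> mA; apply: (rapid_mul_growth (A := A) (k := 0)) => x; rewrite expr0 mulr1. Qed.

End rapid_decay.

(** * Derivatives along lines and difference quotients *)

Section line_derivative.
Context {R : realType} {n : nat}.
Implicit Types (f : 'rV[R]_n -> R) (x v : 'rV[R]_n) (s : R).

Lemma diffquot_line f x v s :
  (fun h => h^-1 *: ((f \o shift (s *: v + x)) (h *: v) - f (s *: v + x))) =
  (fun h => h^-1 *: (((fun s => f (s *: v + x)) \o shift s) (h *: (1 : R)) - f (s *: v + x))).
Proof.
apply/funext => h /=; congr (_ *: (f _ - _)).
by rewrite /GRing.scale/= mulr1 addrA -scalerDl.
Qed.

Lemma derivable_line f x v s :
  derivable f (s *: v + x) v = derivable (fun s => f (s *: v + x)) s 1.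
Proof. by rewrite /derivable diffquot_line. Qed.

Lemma derive_line f x v s :
  'D_v f (s *: v + x) = 'D_1 (fun s => f (s *: v + x)) s.
Proof. by rewrite /derive diffquot_line. Qed.

Lemma mean_value_line f x v (h : R) : 0 <= h ->
  (forall y, differentiable f y) ->
  exists2 c : R, 0 <= c <= h & f (h *: v + x) - f x = h * 'D_v f (c *: v + x).
Proof.
move=> h0 df.
have dg s : is_derive (s : R) 1 (fun s => f (s *: v + x)) ('D_v f (s *: v + x)).
  rewrite derive_line; apply: derivableP; rewrite -derivable_line.
  exact: diff_derivable.
have [] := @MVT_segment R (fun s => f (s *: v + x)) _ 0 h h0 (fun s _ => dg s).
  by apply: derivable_within_continuous => s _; exact: (@ex_derive _ _ _ _ _ _ _ (dg s)).
move=> c ch E.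
exists c; first by move: ch; rewrite in_itv.
by move: E; rewrite scale0r add0r subr0 mulrC.
Qed.

Lemma cvg_diffquot f x v : derivable f x v ->
  k.+1%:R * (f (k.+1%:R^-1 *: v + x) - f x) @[k --> \oo] --> 'D_v f x.
Proof.
move=> df.
have c0 : (k.+1%:R^-1 : R) @[k --> \oo] --> 0^'.
  move=> A A0; have := @cvg_harmonic R _ A0; rewrite /= /nbhs/= => AA.
  by apply: filterS AA => k; apply; rewrite invr_neq0.
have := cvg_comp _ _ c0 df; apply: cvg_trans; apply: near_eq_cvg.
by apply: nearW => k /=; rewrite invrK.
Qed.

End line_derivative.

Section fourier_derivative.
Context {R : realType} {n : nat}.
Notation mu := (@leb R n).
Implicit Types (u v : 'rV[R]_n -> R[i]).

Definition cdifferentiable u := forall x,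
  differentiable (fun y => Re (u y)) x /\ differentiable (fun y => Im (u y)) x.

Lemma cdifferentiable_measurable u : cdifferentiable u -> cmeasurable u.
Proof.
move=> du; split; apply: continuous_measurable_rV => x;
  by apply: differentiable_continuous; case: (du x).
Qed.

Lemma enorm_delta (i : 'I_n) : enorm (delta_mx ord0 i : 'rV[R]_n) = 1.
Proof.
rewrite /enorm /dotrV (bigD1 i)//= big1 ?addr0 ?mxE ?eqxx ?mulr1 ?sqrtr1// => j ji.
by rewrite !mxE eqxx (negbTE ji) mulr0.
Qed.

Lemma dotrV_delta (i : 'I_n) (x : 'rV[R]_n) : dotrV (delta_mx ord0 i) x = x ord0 i.
Proof.
rewrite /dotrV (bigD1 i)//= big1 ?addr0 ?mxE ?eqxx ?mul1r// => j ji.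
by rewrite !mxE eqxx (negbTE ji) mul0r.
Qed.

(** The mean value theorem is applied to real and imaginary parts separately, hence the factor 2. A
    shift by at most 1 changes [1 + enorm x] by a factor at most 2, hence [2 ^+ K]. The bound is
    uniform in [k], as dominated convergence requires. *)
Lemma diffquot_le u (i : 'I_n) (M : R) (K k : nat) (x : 'rV[R]_n) :
  cdifferentiable u -> (forall y, normc (partial i u y) <= M * (1 + enorm y) ^- K) ->
  normc (k.+1%:R%:C * (u (k.+1%:R^-1 *: delta_mx ord0 i + x) - u x)) <=
  2 * M * 2 ^+ K * (1 + enorm x) ^- K.
Proof.
move=> du uM.
set e := delta_mx ord0 i; set h : R := k.+1%:R^-1.
have h0 : 0 < h by rewrite invr_gt0.
have h1 : h <= 1 by rewrite invf_le1// ler1n.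
have M0 : 0 <= M.
  have := le_trans (normc_ge0 _) (uM 0).
  by rewrite pmulr_lge0// invr_gt0 exprn_gt0// oneDenorm_gt0.
have B (c : R) : 0 <= c <= h -> normc (partial i u (c *: e + x)) <= M * 2 ^+ K * (1 + enorm x) ^- K.
  move=> /andP[c0 ch]; apply: (le_trans (uM _)); rewrite -mulrA ler_wpM2l//.
  rewrite ler_pdivlMr ?exprn_gt0 ?oneDenorm_gt0// mulrC ler_pdivrMr ?exprn_gt0 ?oneDenorm_gt0//.
  rewrite -exprMn.
  apply: lerXn2r; rewrite ?nnegrE ?mulr_ge0 ?(ltW (oneDenorm_gt0 _))//.
  have E : x = (c *: e + x) + (- c) *: e by rewrite scaleNr addrAC subrr add0r.
  have := ler_enormD (c *: e + x) ((- c) *: e); rewrite -E enormZ enorm_delta mulr1 normrN ger0_norm//.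
  have := enorm_ge0 (c *: e + x).
  by lra.
apply: (le_trans (normc_le_ReIm _)).
have kh (r s : R) : k.+1%:R%:C * (r +i* s) = (k.+1%:R * r) +i* (k.+1%:R * s).
  by apply/eqP; rewrite eq_complex /= !mul0r subr0 addr0 !eqxx.
have -> : u (h *: e + x) - u x = (Re (u (h *: e + x)) - Re (u x)) +i* (Im (u (h *: e + x)) - Im (u x)).
  by apply/eqP; rewrite eq_complex Re_addc Im_addc Re_oppc Im_oppc /= !eqxx.
rewrite kh /=.
have [c1 c1h E1] := mean_value_line x e (ltW h0) (fun y => proj1 (du y)).
have [c2 c2h E2] := mean_value_line x e (ltW h0) (fun y => proj2 (du y)).
rewrite E1 E2 !mulrA mulfV// !mul1r.
have b1 := le_trans (abs_Re_le (partial i u (c1 *: e + x))) (B _ c1h).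
have b2 := le_trans (abs_Im_le (partial i u (c2 *: e + x))) (B _ c2h).
by move: b1 b2; rewrite /partial/= => b1 b2; lra.
Qed.

Lemma fourier_diffquot u (i : 'I_n) (h : R) (xi : 'rV[R]_n) : cintegrable mu u ->
  fourier (fun x => u (h *: delta_mx ord0 i + x) - u x) xi =
  (expi (2 * pi * (h * xi ord0 i)) - 1) * fourier u xi.
Proof.
move=> ui; set e := delta_mx ord0 i.
have si := cintegrable_shift (h *: e) ui.
have E : (fun x => u (h *: e + x) - u x) = (fun x => u (x + h *: e) + (-1) * u x).
  by apply/funext => x; rewrite addrC mulN1r [_ + x]addrC addrC.
have -> : expi (2 * pi * (h * xi ord0 i)) = expi (2 * pi * dotrV (h *: e) xi) :> R[i].
  by rewrite dotrVZl dotrV_delta.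
rewrite E mulrBl mul1r -(fourier_shift _ _ ui) !fourierE.
rewrite -[- cintegral _ _ _]mulN1r -(cintegralZ (-1) (cintegrable_fourier_integrand xi ui)).
rewrite -cintegralD; last 2 first.
- exact: (cintegrable_fourier_integrand xi si).
- exact: (cintegrableZ (-1) (cintegrable_fourier_integrand xi ui)).
by congr cintegral; apply/funext => x; rewrite mulrDl mulrA.
Qed.

Lemma cvg_expi_diffquot (a : R) :
  (Re (k.+1%:R%:C * (expi (a * k.+1%:R^-1) - 1)) @[k --> \oo] --> (0 : R)) /\
  (Im (k.+1%:R%:C * (expi (a * k.+1%:R^-1) - 1)) @[k --> \oo] --> a).
Proof.
have c0 : (k.+1%:R^-1 : R) @[k --> \oo] --> 0^'.
  move=> A A0; have := @cvg_harmonic R _ A0; rewrite /= /nbhs/= => AA.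
  by apply: filterS AA => k; apply; rewrite invr_neq0.
have dc : is_derive (0 : R) 1 (fun s : R => cos (a * s)) 0.
  by apply: is_derive_eq; rewrite /GRing.scale/= mulr0 sin0; ring.
have ds : is_derive (0 : R) 1 (fun s : R => sin (a * s)) a.
  by apply: is_derive_eq; rewrite /GRing.scale/= mulr0 cos0; ring.
have Q (g : R -> R) l : is_derive (0 : R) 1 g l ->
    k.+1%:R * (g k.+1%:R^-1 - g 0) @[k --> \oo] --> l.
  move=> [dg <-]; have := cvg_comp _ _ c0 dg; apply: cvg_trans; apply: near_eq_cvg.
  by apply: nearW => k /=; rewrite invrK /GRing.scale/= mulr1 addr0.
split.
  have := Q _ _ dc; apply: cvg_trans; apply: near_eq_cvg; apply: nearW => k /=.
  by rewrite mulr0 cos0; ring.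
have := Q _ _ ds; apply: cvg_trans; apply: near_eq_cvg; apply: nearW => k /=.
by rewrite mulr0 sin0; ring.
Qed.

(** Difference quotients replace integration by parts: their transform is exactly a quotient of
    exponentials times [fourier u], and both sides pass to the limit, the integral by dominated
    convergence. *)
Lemma fourier_partial u (i : 'I_n) (xi : 'rV[R]_n) :
  cdifferentiable u -> cmeasurable (partial i u) -> rapid u -> rapid (partial i u) ->
  fourier (partial i u) xi = (0 +i* (2 * pi * xi ord0 i)) * fourier u xi.
Proof.
move=> du mdu ru rdu.
have mu' := cdifferentiable_measurable du.
have ui := rapid_integrable mu' ru.
have [M [M0 uM]] := rapid_le (2 * n) rdu.
pose D (k : nat) (x : 'rV[R]_n) := (k.+1%:R : R)%:C * (u (k.+1%:R^-1 *: delta_mx ord0 i + x) - u x).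
have Di k : fourier (D k) xi =
    k.+1%:R%:C * (expi (2 * pi * xi ord0 i * k.+1%:R^-1) - 1) * fourier u xi.
  have -> : D k = (fun x => k.+1%:R%:C * (u (k.+1%:R^-1 *: delta_mx ord0 i + x) - u x)) by [].
  have si := cintegrable_shift (k.+1%:R^-1 *: delta_mx ord0 i) ui.
  have di : cintegrable mu (fun x => u (k.+1%:R^-1 *: delta_mx ord0 i + x) - u x).
    by under eq_fun do rewrite [X in u X]addrC; apply: cintegrableD => //; exact: cintegrableN.
  rewrite fourierE; under eq_fun do rewrite -mulrA.
  rewrite (cintegralZ _ (cintegrable_fourier_integrand xi di)) -fourierE (fourier_diffquot i _ xi ui).
  by rewrite -!mulrA [_ * xi _ _]mulrC.
have mD k : cmeasurable (fun x => D k x * expi (- (2 * pi * dotrV x xi))).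
  apply: cmeasurableM; last exact: cmeasurable_fourier_kernel.
  apply: cmeasurableM; first exact: cmeasurable_cst.
  apply: cmeasurableD; last exact: cmeasurableN.
  by apply: (cmeasurable_comp _ mu'); exact: measurable_fun_rVD.
have cvgD' x : (Re (D k x) @[k --> \oo] --> Re (partial i u x)) /\
    (Im (D k x) @[k --> \oo] --> Im (partial i u x)).
  split.
    have du' : derivable (fun y => Re (u y)) x (delta_mx ord0 i) by apply: diff_derivable; exact: (proj1 (du x)).
    have := cvg_diffquot du'.
    apply: cvg_trans; apply: near_eq_cvg; apply: nearW => k.
    by rewrite /D Re_mulc Re_addc Re_oppc/= mul0r subr0.
  have du' : derivable (fun y => Im (u y)) x (delta_mx ord0 i) by apply: diff_derivable; exact: (proj2 (du x)).
    have := cvg_diffquot du'.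
  apply: cvg_trans; apply: near_eq_cvg; apply: nearW => k.
  by rewrite /D Im_mulc Im_addc Im_oppc/= mul0r addr0.
have [Ar Ai] : (Re (fourier (D k) xi) @[k --> \oo] --> Re (fourier (partial i u) xi)) /\
    (Im (fourier (D k) xi) @[k --> \oo] --> Im (fourier (partial i u) xi)).
  apply: (@cintegral_dominated_cvg _ _ _ mu
    (fun k x => D k x * expi (- (2 * pi * dotrV x xi)))
    (fun x => partial i u x * expi (- (2 * pi * dotrV x xi))) (fun x => 2 * M * 2 ^+ (2 * n) * cauchyV x)).
  - exact: mD.
  - apply: cmeasurableM => //; exact: cmeasurable_fourier_kernel.
  - move=> x; under eq_fun do rewrite Re_mulc.
    by rewrite Re_mulc; apply: cvgB; apply: cvgM; [exact: (proj1 (cvgD' x))|exact: cvg_cst|exact: (proj2 (cvgD' x))|exact: cvg_cst].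
  - move=> x; under eq_fun do rewrite Im_mulc.
    by rewrite Im_mulc; apply: cvgD; apply: cvgM; [exact: (proj1 (cvgD' x))|exact: cvg_cst|exact: (proj2 (cvgD' x))|exact: cvg_cst].
  - exact: (integrableZl measurableT _ (cintegrable_Re (@cintegrable_cauchyV R n))).
  - move=> k x; rewrite Normc.normcM normc_expi mulr1.
    apply: (le_trans (diffquot_le k x du uM)).
    by rewrite ler_wpM2l ?cauchyV_ge// !mulr_ge0.
have [Br Bi] := cvg_expi_diffquot (2 * pi * xi ord0 i).
apply/eqP; rewrite eq_complex; apply/andP; split; apply/eqP.
  move: Ar; under eq_fun do rewrite Di Re_mulc.
  move=> Ar; apply: (cvg_unique _ Ar _) => //; rewrite Re_mulc/=.
  by apply: cvgB; apply: cvgM => //; exact: cvg_cst.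
move: Ai; under eq_fun do rewrite Di Im_mulc.
move=> Ai; apply: (cvg_unique _ Ai _) => //; rewrite Im_mulc/=.
by apply: cvgD; apply: cvgM => //; exact: cvg_cst.
Qed.

(** Repeated derivatives in a single direction suffice: they control each power of a coordinate of
    [xi], and 1 + |xi| is at most [n.+1] times the largest of 1 and the coordinates in absolute
    value. *)
Lemma fourier_rapid u :
  (forall i k, cdifferentiable (iter k (partial i) u)) ->
  (forall i k, rapid (iter k (partial i) u)) -> cmeasurable u -> rapid u ->
  rapid (fourier u).
Proof.
move=> du ru mu' ru0 k.
have iu := rapid_integrable mu' ru0.
have E (i : 'I_n) j xi : fourier (iter j (partial i) u) xi = (0 +i* (2 * pi * xi ord0 i)) ^+ j * fourier u xi.
  elim: j => [|j IH]; first by rewrite mul1r.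
  rewrite iterS fourier_partial//; last 2 first.
  - exact: (cdifferentiable_measurable (du i j.+1)).
  - exact: (ru i j.+1).
  by rewrite IH mulrA -exprS.
have B (i : 'I_n) : exists M : R, 0 <= M /\ forall xi : 'rV[R]_n, `|xi ord0 i| ^+ k * normc (fourier u xi) <= M.
  exists (norm1 (iter k (partial i) u)); split; first exact: norm1_ge0.
  move=> xi; have := normc_fourier_le xi (rapid_integrable (cdifferentiable_measurable (du i k)) (ru i k)).
  rewrite E Normc.normcM normcX; apply: le_trans; rewrite ler_wpM2r ?normc_ge0//.
  apply: lerXn2r; rewrite ?nnegrE ?normc_ge0//.
  have -> : (0 +i* (2 * pi * xi ord0 i))%C = 'i * (2 * pi * xi ord0 i)%:C.
    by apply/eqP; rewrite eq_complex/= !mul0r !mulr0 mul1r subr0 add0r !eqxx.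
  rewrite Normc.normcM normc_realc /= expr0n expr1n add0r sqrtr1 mul1r normrM ler_peMl//.
  rewrite ger0_norm ?mulr_ge0 ?pi_ge0//; have := pi_ge2 R; by lra.
have [M MB] := choice B.
exists (n.+1%:R ^+ k * (norm1 u + \sum_(i < n) M i)) => xi.
pose t : R := \big[Num.max/1]_(i < n) `|xi ord0 i|.
have t1 : 1 + enorm xi <= n.+1%:R * t.
  have h i : `|xi ord0 i| <= t by exact: (le_bigmax _ (fun i => `|xi ord0 i|)).
  have t1 : 1 <= t by exact: bigmax_ge_id.
  by rewrite -[n.+1]add1n natrD mulrDl mul1r lerD// enorm_le_coord.
have tk : t ^+ k * normc (fourier u xi) <= norm1 u + \sum_(i < n) M i.
  have S0 : 0 <= \sum_(i < n) M i by apply: sumr_ge0 => i _; case: (MB i).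
  rewrite /t; elim/big_ind : _ => [|x y|i _].
  - by rewrite expr1n mul1r (le_trans (normc_fourier_le xi iu))// lerDl.
  - by rewrite maxEle; case: ifP.
  - rewrite (le_trans ((MB i).2 xi))// (bigD1 i)//= addrCA lerDl addr_ge0 ?norm1_ge0//.
    by apply: sumr_ge0 => j _; case: (MB j).
apply: (@le_trans _ _ ((n.+1%:R * t) ^+ k * normc (fourier u xi))).
  rewrite ler_wpM2r ?normc_ge0//; apply: lerXn2r; rewrite ?nnegrE ?(ltW (oneDenorm_gt0 _))//.
  exact: le_trans (ltW (oneDenorm_gt0 _)) t1.
by rewrite exprMn -mulrA ler_wpM2l// exprn_ge0.
Qed.

End fourier_derivative.

(** * Smooth bumps *)

Section schwartz_decay.
Context {R : realType} {n : nat}.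
Implicit Types (f : 'rV[R]_n -> R[i]).

(** Extracts from the multi-index bounds of [schwartz] the iterated derivatives in one direction
    that [fourier_rapid] consumes. *)
Lemma mderiv_pure f (i : 'I_n) (k : nat) :
  mderiv [ffun j => if j == i then k else 0%N] f = iter k (partial i) f.
Proof.
have H s : uniq s -> foldr (fun j g => iter ([ffun j => if j == i then k else 0%N] j) (partial j) g) f s =
    if i \in s then iter k (partial i) f else f.
  elim: s => [//|j s IH] /= /andP[js us]; rewrite IH// ffunE inE eq_sym.
  case: eqVneq => [->|ij] /=; first by rewrite (negbTE js).
  by [].
by rewrite /mderiv H ?enum_uniq// mem_enum.
Qed.

Lemma schwartz_iter f (i : 'I_n) (k : nat) : schwartz f ->
  cdifferentiable (iter k (partial i) f) /\ rapid (iter k (partial i) f).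
Proof.
move=> [sf df]; split.
  have E : foldr partial f (nseq k i) = iter k (partial i) f.
    by elim: k => [//|k IH] /=; rewrite IH.
  by move=> x; rewrite -E; exact: sf.
by move=> K; have [M fM] := df K [ffun j => if j == i then k else 0%N]; exists M => x; rewrite -mderiv_pure.
Qed.

Lemma mderiv0 f : mderiv [ffun => 0%N] f = f.
Proof.
rewrite /mderiv; elim: (enum _) => [//|j s IH] /=; by rewrite IH ffunE.
Qed.

Lemma schwartz_rapid f : schwartz f -> rapid f.
Proof.
move=> [_ df] k; have [M fM] := df k [ffun => 0%N].
by exists M => x; rewrite -[f]mderiv0.
Qed.

Lemma smooth_cdifferentiable f : smooth f -> cdifferentiable f.
Proof. by move=> sf x; exact: (sf [::] x). Qed.

Lemma schwartz_cdifferentiable f : schwartz f -> cdifferentiable f.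
Proof. by move=> [sf _]; exact: smooth_cdifferentiable. Qed.

Lemma schwartz_measurable f : schwartz f -> cmeasurable f.
Proof. by move=> /schwartz_cdifferentiable; exact: cdifferentiable_measurable. Qed.

Lemma schwartz_integrable f : schwartz f -> cintegrable (@leb R n) f.
Proof. by move=> sf; apply: rapid_integrable; [exact: schwartz_measurable|exact: schwartz_rapid]. Qed.

Lemma schwartz_fourier_rapid f : schwartz f -> rapid (fourier f).
Proof.
move=> sf; apply: fourier_rapid.
- by move=> i k; case: (schwartz_iter i k sf).
- by move=> i k; case: (schwartz_iter i k sf).
- exact: schwartz_measurable.
- exact: schwartz_rapid.
Qed.

End schwartz_decay.

Section bump1.
Context {R : realType}.
Implicit Types (f g : R -> R).

(** Off by one: [cn n f] asks that [f] and its first [n] derivatives be derivable, so [n + 1]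
    derivatives exist. *)
Fixpoint cn (n : nat) f : Prop :=
  (forall s : R, derivable f s 1) /\ (if n is n'.+1 then cn n' (derive1 f) else True).

Lemma cn0 f : (forall s : R, derivable f s 1) -> cn 0 f.
Proof. by move=> df; apply: conj. Qed.

Lemma cn_derivable n f (s : R) : cn n f -> derivable f s 1.
Proof. by case: n => [|n] [df _]; exact: df. Qed.

Lemma cn_is_derive n f (s : R) : cn n f -> is_derive s 1 f (derive1 f s).
Proof. by move=> cf; rewrite derive1E; apply: derivableP; exact: cn_derivable cf. Qed.

Lemma cn_succ n f (g : R -> R) :
  (forall s : R, is_derive s 1 f (g s)) -> cn n g -> cn n.+1 f.
Proof.
move=> fg cg; apply: conj; first by move=> s; exact: (@ex_derive _ _ _ _ _ _ _ (fg s)).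
suff -> : derive1 f = g by exact: cg.
by apply/funext => s; rewrite derive1E; exact: (@derive_val _ _ _ _ _ _ _ (fg s)).
Qed.

Lemma cn_pred n f : cn n.+1 f -> cn n (derive1 f).
Proof. by case. Qed.

(* Otherwise unification unfolds [cn] down to limits of difference quotients. *)
Opaque cn.

Lemma cnS n f : cn n.+1 f -> cn n f.
Proof.
elim: n f => [|n IH] f cf; first by apply: cn0 => s; exact: cn_derivable cf.
by apply: (cn_succ (fun s => cn_is_derive s cf)); apply: IH; exact: cn_pred.
Qed.

Lemma cnD n f g : cn n f -> cn n g -> cn n (f \+ g).
Proof.
elim: n f g => [|n IH] f g cf cg.
  by apply: cn0 => s; apply: derivableD; [exact: cn_derivable cf|exact: cn_derivable cg].
apply: (@cn_succ _ _ (derive1 f \+ derive1 g)) => [s|].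
  exact: (is_deriveD (cn_is_derive s cf) (cn_is_derive s cg)).
by apply: IH; exact: cn_pred.
Qed.

Lemma cnM n f g : cn n f -> cn n g -> cn n (f \* g).
Proof.
elim: n f g => [|n IH] f g cf cg.
  by apply: cn0 => s; apply: derivableM; [exact: cn_derivable cf|exact: cn_derivable cg].
apply: (@cn_succ _ _ ((f \* derive1 g) \+ (g \* derive1 f))) => [s|].
  exact: (is_deriveM (cn_is_derive s cf) (cn_is_derive s cg)).
by apply: cnD; apply: IH; first [exact: cn_pred|exact: cnS].
Qed.

Lemma cn_cst n (a : R) : cn n (fun=> a).
Proof.
elim: n a => [|n IH] a; first by apply: cn0 => s; exact: derivable_cst.
apply: (@cn_succ n (fun=> a) (fun=> 0) _ (IH 0)) => s; exact: is_derive_cst.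
Qed.

Lemma cn_affine n (a c : R) f : cn n f -> cn n (fun s => f (c + a * s)).
Proof.
have D m g (s : R) : cn m g -> is_derive s 1 (fun s => g (c + a * s)) (a * derive1 g (c + a * s)).
  move=> dg; have h : is_derive s 1 (fun s => c + a * s) a.
    by apply: is_derive_eq; rewrite /GRing.scale/=; ring.
  have := @is_derive1_comp R g (fun s => c + a * s) s _ _ (cn_is_derive _ dg) h.
  by rewrite mulrC.
elim: n f => [|n IH] f cf.
  by apply: cn0 => s; exact: (@ex_derive _ _ _ _ _ _ _ (D _ _ s cf)).
have h : cn n ((fun=> a) \* (fun s => derive1 f (c + a * s))).
  by apply: cnM; [exact: cn_cst|apply: IH; exact: cn_pred].
by apply: (cn_succ _ h) => s; exact: (D _ _ s cf).
Qed.

(** [flat 0] is the classical exp(-1/x) extended by 0. The powers of 1/x close the family under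
    differentiation, up to linear combinations, so induction reaches every order. *)
Definition flat (k : nat) (x : R) : R := if 0 < x then x^-1 ^+ k * expR (- x^-1) else 0.

Lemma flat_ge0 k x : 0 <= flat k x.
Proof.
rewrite /flat; case: ifP => // x0.
by rewrite mulr_ge0 ?expR_ge0// exprn_ge0// invr_ge0 ltW.
Qed.

(** The power m+1 of the inequality s <= exp(s) at s = y/(m+1). *)
Lemma exp_ge_pow (m : nat) (y : R) : 0 < y -> (y / m.+1%:R) ^+ m.+1 <= expR y.
Proof.
move=> y0; have -> : expR y = expR (y / m.+1%:R) ^+ m.+1.
  by rewrite -expRM_natl; congr expR; field.
apply: lerXn2r; rewrite ?nnegrE ?expR_ge0 ?divr_ge0 ?(ltW y0)//.
by apply: le_trans (expR_ge1Dx _); rewrite lerDr.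
Qed.

(** [exp_ge_pow] at 1/x with exponent k+2. The order x^2 leaves a factor |h| in the difference
    quotient at 0, which gives derivative 0 there. *)
Lemma flat_le k (x : R) : `|flat k x| <= k.+2%:R ^+ k.+2 * `|x| ^+ 2.
Proof.
rewrite ger0_norm ?flat_ge0// /flat; case: ifP => [x0|_]; last by rewrite mulr_ge0 ?exprn_ge0.
rewrite gtr0_norm// expRN.
have y0 : 0 < x^-1 by rewrite invr_gt0.
have := exp_ge_pow k.+1 y0; rewrite expr_div_n ler_pdivrMr ?exprn_gt0// => h.
rewrite ler_pdivrMr ?expR_gt0//.
have -> : x^-1 ^+ k = x ^+ 2 * x^-1 ^+ k.+2.
  by rewrite -[k.+2]addn2 exprD; field; rewrite ?gt_eqF.
by rewrite [_ ^+ k.+2 * x ^+ 2]mulrC -[X in _ <= X]mulrA ler_wpM2l ?exprn_ge0 ?(ltW x0)// mulrC.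
Qed.

Lemma is_derive_flat k (x : R) :
  is_derive x 1 (flat k) (flat k.+2 x - k%:R * flat k.+1 x).
Proof.
case: (ltgtP 0 x) => [x0|x0|<-].
- suff : is_derive x 1 (fun x => x^-1 ^+ k * expR (- x^-1)) (flat k.+2 x - k%:R * flat k.+1 x).
    apply: near_eq_is_derive.
    near=> y; rewrite /flat ifT//; near: y; exact: lt_nbhsr.
  have xn : x != 0 by rewrite gt_eqF.
  have dv := @is_deriveV R id x 1 1 xn (is_derive_id _ _).
  have de : is_derive x 1 (fun x => expR (- x^-1)) (expR (- x^-1) * x ^- 2).
    have := @is_derive1_comp R expR (fun x => - x^-1) x _ _ (is_derive_expR _) (is_deriveN dv).
    by move=> h; apply: (is_derive_eq h); rewrite /GRing.scale/= mulr1 opprK.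
  have dp : is_derive x 1 (fun x => x^-1 ^+ k) (- (k%:R * x^-1 ^+ k.+1)).
    clear de; case: k => [|k].
      by rewrite mul0r oppr0; exact: is_derive_cst.
    have := is_deriveX k.+1 dv; rewrite exprfctE => h; apply: (is_derive_eq h).
    by rewrite /GRing.scale/= !exprS; field.
  have h := is_deriveM dp de; apply: (is_derive_eq h).
  by rewrite /flat x0 /GRing.scale/= !exprS; field.
- suff : is_derive x 1 (fun=> 0) (flat k.+2 x - k%:R * flat k.+1 x).
    apply: near_eq_is_derive.
    near=> y; rewrite /flat ltNge (_ : y <= 0)//; apply: ltW; near: y; exact: lt_nbhsl.
  by apply: is_derive_eq; rewrite /flat ltNge (ltW x0)/= mulr0 subr0.
- have E : flat k.+2 0 - k%:R * flat k.+1 0 = 0 by rewrite /flat ltxx mulr0 subr0.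
  rewrite E.
  have C : h^-1 *: ((flat k \o shift 0) (h *: (1 : R)) - flat k 0) @[h --> 0^'] --> (0 : R).
    apply/cvgr0Pnorm_le => e e0.
    near=> h.
    have hn : h != 0 by near: h; exact: nbhs_dnbhs_neq.
    rewrite /= addr0 {2}/flat ltxx subr0 /GRing.scale/= mulr1 normrM normfV.
    rewrite ler_pdivrMl ?normr_gt0// (le_trans (flat_le _ _))// expr2 mulrA mulrC ler_wpM2l//.
    rewrite mulrC -ler_pdivlMr ?exprn_gt0//.
    by near: h; apply: dnbhs0_le; rewrite divr_gt0// exprn_gt0.
  apply: DeriveDef; first by apply/cvg_ex; exists 0.
  exact: (cvg_lim _ C).
Unshelve. all: by end_near. Qed.

Lemma cn_flat n k : cn n (flat k).
Proof.
elim: n k => [|n IH] k.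
  by apply: cn0 => s; exact: (@ex_derive _ _ _ _ _ _ _ (is_derive_flat k s)).
apply: (@cn_succ _ _ (flat k.+2 \+ ((fun=> - k%:R) \* flat k.+1))) => [s|].
  by rewrite /= mulNr; exact: is_derive_flat.
by apply: cnD; [exact: IH|apply: cnM; [exact: cn_cst|exact: IH]].
Qed.

Variable eps : R.

(** A product of two one-sided flat functions, hence smooth, even and zero outside [[- eps, eps]];
    [k] counts derivatives. Evenness lets a window be read in [eta - xi] or in [xi - eta]. *)
Definition sbump (k : nat) : R -> R :=
  iter k (fun f : R -> R => (derive1 f)) (fun s => flat 0 (eps + s) * flat 0 (eps - s)).

Lemma cn_bump n k : cn n (sbump k).
Proof.
have H m : cn m (sbump 0).
  have := cnM (cn_affine 1 eps (cn_flat m 0)) (cn_affine (-1) eps (cn_flat m 0)).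
  congr cn; apply/funext => s; by rewrite /= mul1r mulN1r.
have H' j m f : cn (j + m) f -> cn m (iter j (fun f : R -> R => (derive1 f)) f).
  elim: j m f => [//|j IH] m f; rewrite addSnnS => h; have [_] := IH _ _ h; exact.
exact: (H' k n _ (H _)).
Qed.

Lemma is_derive_bump k (s : R) : is_derive s 1 (sbump k) (sbump k.+1 s).
Proof. exact: (cn_is_derive s (cn_bump 0 k)). Qed.

Lemma bump0_ge0 s : 0 <= sbump 0 s.
Proof. by rewrite /= mulr_ge0 ?flat_ge0. Qed.

Lemma bump0_even s : sbump 0 (- s) = sbump 0 s.
Proof. by rewrite /= opprK mulrC. Qed.

Lemma bump0_gt0 : 0 < eps -> 0 < sbump 0 0.
Proof. by move=> e0; rewrite /= addr0 subr0 /flat e0 mul1r mulr_gt0 ?expR_gt0. Qed.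

Lemma bump_out k s : eps < `|s| -> sbump k s = 0.
Proof.
elim: k s => [|k IH] s es.
  rewrite /= /flat; move: es; rewrite ltr_normr => /orP[h|h].
    by rewrite [0 < eps - s]ltNge (_ : eps - s <= 0) ?mulr0//; lra.
  by rewrite [0 < eps + s]ltNge (_ : eps + s <= 0) ?mul0r//; lra.
rewrite [sbump k.+1]/= derive1E -(@near_eq_derive _ _ _ (cst 0)) ?derive_cst//.
have : \forall t \near s, eps < `|t|.
  have := @norm_continuous R R s; move=> /(_ [set t | eps < t]); apply.
  exact: lt_nbhsr.
by apply: filterS => t et; rewrite IH.
Unshelve. all: by end_near. Qed.

Lemma bump_bounded k : exists2 M : R, 0 < M & forall s, `|sbump k s| <= M.
Proof.
have [e0|e0] := leP 0 eps; last first.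
  exists 1 => // s; rewrite bump_out ?normr0//; exact: lt_le_trans e0 _.
have c : {within `[- eps, eps], continuous (fun s => `|sbump k s|)}.
  apply: continuous_subspaceT => s; apply: continuous_comp; last exact: norm_continuous.
  apply: differentiable_continuous; apply/derivable1_diffP.
  exact: (@ex_derive _ _ _ _ _ _ _ (is_derive_bump k s)).
have [|m mI mM] := EVT_max _ c; first by rewrite ge0_cp.
exists (1 + `|sbump k m|); first by rewrite ltr_pwDl.
move=> s; have [es|es] := ltP eps `|s|; first by rewrite bump_out// normr0 addr_ge0.
rewrite (le_trans (mM s _)) ?lerDr//; by rewrite in_itv/= -ler_norml.
Qed.

End bump1.

(** * Smooth products of functions of one coordinate *)

Section tensor.
Context {R : realType} {n : nat}.
Variable F : 'I_n -> nat -> R -> R.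
Hypothesis dF : forall i k (s : R), is_derive s 1 (F i k) (F i k.+1 s).
Variable c : R.

(** In [F i k] the index [k] counts derivatives, so [partial] only increments an entry of [nu], and
    smoothness reduces to differentiability of the members of the family. *)
Definition tensor (nu : 'I_n -> nat) (x : 'rV[R]_n) : R[i] :=
  (c * \prod_(i < n) F i (nu i) (x ord0 i))%:C.

Lemma differentiable_tensor nu : cdifferentiable (tensor nu).
Proof.
move=> x; split; last exact: differentiable_cst.
apply: (@differentiableM _ _ (fun=> c)); first exact: differentiable_cst.
elim: (index_enum _) => [|i r IH].
  under eq_fun do rewrite big_nil; exact: differentiable_cst.
under eq_fun do rewrite big_cons.
apply: (@differentiableM _ _ (fun y : 'rV[R]_n => F i (nu i) (y ord0 i))) => //.
apply: (@differentiable_comp _ _ _ _ (fun y : 'rV[R]_n => y ord0 i) (F i (nu i))).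
  exact: differentiable_coord.
apply/derivable1_diffP; exact: (@ex_derive _ _ _ _ _ _ _ (dF i (nu i) _)).
Qed.

Lemma partial_tensor nu (j : 'I_n) :
  partial j (tensor nu) = tensor (fun i => ((i == j) + nu i)%N).
Proof.
apply/funext => x; rewrite /partial.
have -> : 'D_(delta_mx ord0 j) (fun y => Im (tensor nu y)) x = 0 by exact: derive_cst.
rewrite /tensor; congr (_ +i* _).
rewrite -{1}[x](add0r x) -{1}(scale0r (delta_mx ord0 j)) derive_line /=.
pose P := \prod_(i < n | i != j) F i (nu i) (x ord0 i).
have -> : (fun s : R => c * \prod_(i < n) F i (nu i) ((s *: delta_mx ord0 j + x) ord0 i)) =
    (fun s => c * P * F j (nu j) (s + x ord0 j)).
  apply/funext => s; rewrite (bigD1 j)//= !mxE !eqxx mulr1 -mulrA; congr (_ * _).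
  rewrite mulrC; congr (_ * _); apply: eq_bigr => i ij.
  by rewrite !mxE eqxx (negbTE ij) mulr0 add0r.
have h : is_derive (0 : R) 1 (fun s : R => F j (nu j) (s + x ord0 j)) (F j (nu j).+1 (x ord0 j)).
  have hs : is_derive (0 : R) 1 (fun s : R => s + x ord0 j) 1.
    by apply: is_derive_eq; rewrite addr0.
  have := @is_derive1_comp R (F j (nu j)) (fun s => s + x ord0 j) 0 _ _ (dF j (nu j) _) hs.
  by rewrite add0r mulr1.
have h2 := is_deriveM (is_derive_cst (c * P) (0 : R) 1) h.
rewrite [LHS](@derive_val _ _ _ _ _ _ _ h2) /GRing.scale/= mulr0 addr0.
rewrite [in RHS](bigD1 j)//= eqxx add1n -mulrA; congr (_ * _); rewrite mulrC; congr (_ * _).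
by apply: eq_bigr => i ij; rewrite (negbTE ij).
Qed.

Lemma foldr_partial_tensor nu (s : seq 'I_n) :
  foldr partial (tensor nu) s = tensor (fun i => (count_mem i s + nu i)%N).
Proof.
elim: s => [//|j s IH] /=; rewrite IH partial_tensor; congr tensor.
by apply/funext => i; rewrite addnA eq_sym.
Qed.

Lemma smooth_tensor nu : smooth (tensor nu).
Proof. by move=> s x; rewrite foldr_partial_tensor; exact: differentiable_tensor. Qed.

Lemma iter_partial_tensor nu (j : 'I_n) (k : nat) :
  iter k (partial j) (tensor nu) = tensor (fun i => ((i == j) * k + nu i)%N).
Proof.
elim: k => [|k IH] /=.
  by congr tensor; apply/funext => i; rewrite muln0.
by rewrite IH partial_tensor; congr tensor; apply/funext => i; rewrite mulnS addnA.
Qed.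

Lemma mderiv_tensor (nu : {ffun 'I_n -> nat}) : mderiv nu (tensor (fun=> 0%N)) = tensor nu.
Proof.
have H s : uniq s -> foldr (fun i g => iter (nu i) (partial i) g) (tensor (fun=> 0%N)) s =
    tensor (fun i => ((i \in s) * nu i)%N).
  elim: s => [_|j s IH] /=; first by congr tensor.
  move=> /andP[js us]; rewrite IH// iter_partial_tensor; congr tensor.
  apply/funext => i; rewrite inE; case: eqVneq => [->|ij] /=; last by [].
  by rewrite (negbTE js) mul1n addn0.
by rewrite /mderiv H ?enum_uniq//; congr tensor; apply/funext => i; rewrite mem_enum mul1n.
Qed.

End tensor.

Section bumpV.
Context {R : realType} {n : nat}.
Variable eps : R.
Hypothesis eps0 : 0 < eps.

(* A bump at scale [1/a] centred at [xi], or its [nu]-th partial derivative. *)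
Definition bumpV (c a : R) (xi : 'rV[R]_n) (nu : 'I_n -> nat) : 'rV[R]_n -> R[i] :=
  tensor (fun i k s => a ^+ k * sbump eps k (a * (s - xi ord0 i))) c nu.

Lemma is_derive_bumpV a (xi : 'rV[R]_n) (i : 'I_n) k (s : R) :
  is_derive s 1 (fun s => a ^+ k * sbump eps k (a * (s - xi ord0 i)))
    (a ^+ k.+1 * sbump eps k.+1 (a * (s - xi ord0 i))).
Proof.
have hs : is_derive s 1 (fun s : R => a * (s - xi ord0 i)) a.
  by apply: is_derive_eq; rewrite /GRing.scale/= subr0 mulr1.
have h := @is_derive1_comp R (sbump eps k) (fun s => a * (s - xi ord0 i)) s _ _ (is_derive_bump eps k _) hs.
have h2 := is_deriveM (is_derive_cst (a ^+ k) s 1) h.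
by apply: (is_derive_eq h2); rewrite /GRing.scale/= mulr0 addr0 exprS; ring.
Qed.

Lemma bumpV_out c a (xi : 'rV[R]_n) nu (x : 'rV[R]_n) (i : 'I_n) :
  eps < `|a * (x ord0 i - xi ord0 i)| -> bumpV c a xi nu x = 0.
Proof.
move=> h; rewrite /bumpV /tensor (bigD1 i)//= bump_out// mulr0 mul0r mulr0.
by rewrite rmorph0.
Qed.

(** [M] depends neither on the scale nor on the centre, and each derivative costs a factor [a]: the
    shape [adapted_bump] demands for a radius comparable to 1/a. *)
Lemma bumpV_le (nu : 'I_n -> nat) : exists2 M : R, 0 < M &
  forall c a xi x, normc (bumpV c a xi nu x) <= `|c| * `|a| ^+ (\sum_i nu i) * M.
Proof.
have B k : exists M : R, 0 < M /\ forall s, `|sbump eps k s| <= M.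
  by have [M M0 MM] := bump_bounded eps k; exists M.
have [M MB] := choice B.
exists (\prod_(i < n) M (nu i)); first by apply: prodr_gt0 => i _; case: (MB (nu i)).
move=> c a xi x; rewrite normc_realc normrM -mulrA ler_wpM2l// normr_prod.
rewrite -prodrXr -big_split/=; apply: ler_prod => i _.
by rewrite normr_ge0/= normrM normrX ler_wpM2l ?exprn_ge0//; case: (MB (nu i)).
Qed.

Lemma bumpV_ball c a xi nu (x : 'rV[R]_n) : 0 < a ->
  bumpV c a xi nu x != 0 -> forall i, `|x ord0 i - xi ord0 i| <= eps / a.
Proof.
move=> a0 h i; rewrite leNgt; apply/negP => hi; move: h.
by rewrite (@bumpV_out _ _ _ _ _ i) ?eqxx// normrM gtr0_norm// mulrC -ltr_pdivrMr.
Qed.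

Lemma rapid_bumpV c a xi nu : 0 < a -> rapid (bumpV c a xi nu).
Proof.
move=> a0 k; have [M M0 MB] := bumpV_le nu.
exists ((1 + (enorm xi + n%:R * (eps / a))) ^+ k * (`|c| * `|a| ^+ (\sum_i nu i) * M)) => x.
have r0 : 0 <= `|c| * `|a| ^+ (\sum_i nu i) * M by rewrite !mulr_ge0 ?exprn_ge0// ltW.
have s0 : 0 <= n%:R * (eps / a) by rewrite mulr_ge0// divr_ge0 ?ltW.
have e0 := enorm_ge0 xi.
have [->|h] := eqVneq (bumpV c a xi nu x) 0.
  by rewrite Normc.normc0 mulr0 mulr_ge0// exprn_ge0//; lra.
apply: ler_pM; rewrite ?normc_ge0 ?MB ?exprn_ge0 ?(ltW (oneDenorm_gt0 _))//.
apply: lerXn2r; rewrite ?nnegrE ?(ltW (oneDenorm_gt0 _)) ?addr_ge0//.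
rewrite lerD2l -{1}[x](subrK xi) addrC (le_trans (ler_enormD _ _))// lerD2l.
by apply: enorm_le_coord => i; rewrite !mxE; exact: (bumpV_ball a0 h).
Qed.

Lemma smooth_bumpV c a xi nu : smooth (bumpV c a xi nu).
Proof. by apply: smooth_tensor => i k s; exact: is_derive_bumpV. Qed.

Lemma cmeasurable_bumpV c a xi nu : cmeasurable (bumpV c a xi nu).
Proof. by apply: cdifferentiable_measurable; apply: smooth_cdifferentiable; exact: smooth_bumpV. Qed.

Lemma mderiv_bumpV c a xi (nu : {ffun 'I_n -> nat}) :
  mderiv nu (bumpV c a xi (fun=> 0%N)) = bumpV c a xi nu.
Proof. by apply: mderiv_tensor => i k s; exact: is_derive_bumpV. Qed.

Lemma fourier_bumpV_rapid c a xi : 0 < a -> rapid (fourier (bumpV c a xi (fun=> 0%N))).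
Proof.
move=> a0.
have E i k : iter k (partial i) (bumpV c a xi (fun=> 0%N)) = bumpV c a xi (fun j => (j == i) * k + 0)%N.
  by apply: iter_partial_tensor => j m s; exact: is_derive_bumpV.
apply: fourier_rapid.
- by move=> i k; rewrite E; apply: smooth_cdifferentiable; exact: smooth_bumpV.
- by move=> i k; rewrite E; exact: rapid_bumpV.
- exact: cmeasurable_bumpV.
- exact: rapid_bumpV.
Qed.

Lemma supp_bumpV c a xi nu (x : 'rV[R]_n) : 0 < a ->
  supp (bumpV c a xi nu) x -> forall i, `|x ord0 i - xi ord0 i| <= eps / a.
Proof.
move=> a0 sx i.
have cl : closed [set y : 'rV[R]_n | `|y ord0 i - xi ord0 i| <= eps / a].
  apply: (closed_comp (f := fun y : 'rV[R]_n => `|y ord0 i - xi ord0 i|) (D := [set r | r <= eps / a])) => //.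
    move=> y _; apply: (@continuous_comp _ _ _ (fun y : 'rV[R]_n => y ord0 i - xi ord0 i) (fun t : R => `|t|)); last exact: norm_continuous.
    apply: differentiable_continuous.
    apply: (@differentiableB _ _ _ (fun y : 'rV[R]_n => y ord0 i) (fun=> xi ord0 i)).
      exact: differentiable_coord.
    exact: differentiable_cst.
move: sx; rewrite /supp => sx.
suff : closure [set y : 'rV[R]_n | bumpV c a xi nu y != 0] `<=` [set y | `|y ord0 i - xi ord0 i| <= eps / a] by apply.
rewrite [X in _ `<=` X](closure_id _).1//; apply: closure_subset => y /= h.
exact: (bumpV_ball a0 h).
Qed.

End bumpV.

Lemma compact_supp_bumpV {R : realType} {n : nat} (eps : R) c a (xi : 'rV[R]_n) nu :
  (0 < n)%N -> 0 < eps -> 0 < a -> compact (supp (bumpV eps c a xi nu)).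
Proof.
case: n xi nu => [//|n] xi nu _ e0 a0; apply: bounded_closed_compact; last exact: closed_closure.
exists (`|xi| + eps / a); split; first exact: num_real.
move=> r hr x sx; apply: ltW; apply: le_lt_trans hr.
rewrite -{1}[x](subrK xi) addrC (le_trans (ler_normD _ _))// lerD2l.
rewrite /Num.norm/= mx_normrE; apply/bigmax_leP; split => /=; first by rewrite divr_ge0// ltW.
move=> [i j] _ /=; rewrite (ord1 i) !mxE.
exact: (supp_bumpV a0 sx).
Qed.

(** * The window and the kernel whose transform it is *)

Section cutoff.
Context {R : realType} {n : nat}.
Variable eps : R.
Hypothesis eps0 : 0 < eps.
Notation mu := (@leb R n).

(** The bump h of the overview. *)
Definition cutoff (z : 'rV[R]_n) : R := \prod_(i < n) sbump eps 0 (z ord0 i).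

Lemma cutoff_bumpV c a (xi z : 'rV[R]_n) :
  bumpV eps c a xi (fun=> 0%N) z = (c * cutoff (a *: (z - xi)))%:C.
Proof.
rewrite /bumpV /tensor; congr ((c * _)%:C); apply: eq_bigr => i _.
by rewrite expr0 mul1r !mxE.
Qed.

Lemma cutoffE : (fun z => (cutoff z)%:C) = bumpV eps 1 1 0 (fun=> 0%N).
Proof. by apply/funext => z; rewrite cutoff_bumpV mul1r scale1r subr0. Qed.

Lemma cutoffN z : cutoff (- z) = cutoff z.
Proof. by apply: eq_bigr => i _; rewrite !mxE bump0_even. Qed.

Lemma cutoff_ge0 z : 0 <= cutoff z.
Proof. by apply: prodr_ge0 => i _; exact: bump0_ge0. Qed.

Lemma cutoff_bounded : exists2 M : R, 0 < M & forall z, cutoff z <= M.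
Proof.
have [M M0 MB] := @bumpV_le R n eps (fun=> 0%N); exists M => // z.
have := MB 1 1 0 z; rewrite cutoff_bumpV normr1 expr1n !mul1r scale1r subr0 normc_realc.
by rewrite ger0_norm ?cutoff_ge0.
Qed.

Lemma cutoff_out (z : 'rV[R]_n) (i : 'I_n) : eps < `|z ord0 i| -> cutoff z = 0.
Proof. by move=> h; apply/eqP/prodf_eq0; exists i => //; rewrite bump_out. Qed.

Lemma cutoff_ball z : cutoff z != 0 -> forall i, `|z ord0 i| <= eps.
Proof. by move=> h i; rewrite leNgt; apply/negP => hi; rewrite (cutoff_out hi) eqxx in h. Qed.

Lemma cmeasurable_cutoff : cmeasurable (fun z : 'rV[R]_n => (cutoff z)%:C).
Proof. by rewrite cutoffE; exact: cmeasurable_bumpV. Qed.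

Lemma measurable_cutoff : measurable_fun setT cutoff.
Proof. by case: cmeasurable_cutoff. Qed.

Lemma rapid_cutoff : rapid (fun z : 'rV[R]_n => (cutoff z)%:C).
Proof. by rewrite cutoffE; exact: rapid_bumpV. Qed.

Lemma fourier_cutoff_rapid : rapid (fourier (fun z : 'rV[R]_n => (cutoff z)%:C)).
Proof. by rewrite cutoffE; exact: fourier_bumpV_rapid. Qed.

Lemma cintegrable_cutoff : cintegrable mu (fun z => (cutoff z)%:C).
Proof. exact: (rapid_integrable cmeasurable_cutoff rapid_cutoff). Qed.

(** The kernel H of the overview before scaling. Since [cutoff] is even the forward transform can
    stand for the inverse one, and the factor cancels the constant of [fourier_inversion]. *)
Definition cutoff_kernel : 'rV[R]_n -> R[i] :=
  fun x => (@fejer_mass R n)^-1%:C * fourier (fun z => (cutoff z)%:C) x.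

Lemma cmeasurable_cutoff_kernel : cmeasurable cutoff_kernel.
Proof.
apply: cmeasurableM; first exact: cmeasurable_cst.
by apply: cmeasurable_fourier; case: cintegrable_cutoff.
Qed.

Lemma rapid_cutoff_kernel : rapid cutoff_kernel.
Proof. exact: (rapid_mul_bounded (m := fun=> _) (fun=> lexx _) fourier_cutoff_rapid). Qed.

Lemma fourier_cutoff_kernel xi : fourier cutoff_kernel xi = (cutoff xi)%:C.
Proof.
have i1 := cintegrable_cutoff.
have i2 : cintegrable mu (fourier (fun z => (cutoff z)%:C)).
  by apply: rapid_integrable fourier_cutoff_rapid; apply: cmeasurable_fourier; case: i1.
have cd : cdifferentiable (fun z : 'rV[R]_n => (cutoff z)%:C).
  by rewrite cutoffE; apply: smooth_cdifferentiable; exact: smooth_bumpV.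
have [M M0 MB] := cutoff_bounded.
have h := @fourier_inversion R n (fun z => (cutoff z)%:C) M (- xi) i1 i2.
rewrite /cutoff_kernel fourierE; under eq_fun do rewrite -mulrA.
rewrite (cintegralZ _ (cintegrable_fourier_integrand xi i2)) -fourierE.
rewrite -[in fourier _ xi](opprK xi) -inv_fourierE h.
- by rewrite mulrA -rmorphM mulVf ?gt_eqF ?fejer_mass_gt0// rmorph1 mul1r cutoffN.
- by move=> y; rewrite normc_realc ger0_norm ?cutoff_ge0.
- exact: differentiable_continuous (proj1 (cd _)).
- exact: differentiable_continuous (proj2 (cd _)).
Qed.

End cutoff.

(** * The fixed-scale inequality *)

(** The choice s = u/k is optimal. *)
Lemma sqr_le_of_am {R : realType} (u k b : R) : 0 <= u -> 0 < k -> 0 <= b ->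
  (forall s : R, 0 < s -> 2 * u <= s * k + s^-1 * b) -> u ^+ 2 <= k * b.
Proof.
rewrite le_eqVlt => /predU1P[<- k0 b0 _|u0 k0 b0 /(_ (u / k))].
  by rewrite expr0n mulr_ge0// ltW.
rewrite divr_gt0// divfK ?gt_eqF// invf_div => /(_ isT) h.
have {h} : u <= k / u * b by lra.
by rewrite mulrAC ler_pdivlMr// -expr2.
Qed.

(** * Weighted L^2 estimates *)

Section weighted_cauchy_schwarz.
Context d (T : measurableType d) (R : realType).
Variable mu : {measure set T -> \bar R}.

Lemma measurable_inv_gt0 (w : T -> R) : measurable_fun setT w ->
  (forall x, 0 < w x) -> measurable_fun setT (fun x => (w x)^-1).
Proof.
move=> mw w0; have -> : (fun x => (w x)^-1) = (fun x => w x `^ (-1)).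
  by apply/funext => x; rewrite powR_inv1// ltW.
exact: (measurableT_comp (measurable_powR _) mw).
Qed.

(** For every s > 0 one has 2 |f g| <= s |f|^2 w + |g|^2 / (s w) pointwise; this is integrated and s
    optimised by [sqr_le_of_am]. If the last integral is infinite the claim is trivial because [K]
    is positive. *)
Lemma weighted_cauchy_schwarz (f g : T -> R[i]) (w : T -> R) (K : R) :
  cintegrable mu (fun x => f x * g x) -> cmeasurable f -> cmeasurable g ->
  measurable_fun setT w -> (forall x, 0 < w x) -> 0 < K ->
  (\int[mu]_x (normc (f x) ^+ 2 * w x)%:E <= K%:E)%E ->
  ((normc (cintegral mu setT (fun x => (f x * g x)%R)) ^+ 2)%:E <=
    K%:E * \int[mu]_x (normc (g x) ^+ 2 * (w x)^-1)%:E)%E.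
Proof.
move=> fgi mf mg mw w0 K0 fK.
have mnf := measurable_funX 2 (cmeasurable_normc mf).
have mng := measurable_funX 2 (cmeasurable_normc mg).
have mwV : measurable_fun setT (fun x => (w x)^-1).
  exact: measurable_inv_gt0.
set B := (X in (_ <= _ * X)%E).
have B0 : (0 <= B)%E.
  by apply: integral_ge0 => x _; rewrite lee_fin mulr_ge0 ?sqr_ge0// invr_ge0 ltW.
case E : B => [b| |]; last 2 first.
- by rewrite gt0_muley ?lte_fin// leey.
- by move: B0; rewrite E.
rewrite -EFinM lee_fin; apply: sqr_le_of_am => //; first exact: normc_ge0.
  by move: B0; rewrite E.
move=> s s0; rewrite -lee_fin.
apply: (@le_trans _ _ (\int[mu]_x (s * (normc (f x) ^+ 2 * w x) + s^-1 * (normc (g x) ^+ 2 * (w x)^-1))%:E)%E).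
  rewrite EFinM; apply: (@le_trans _ _ (2%:E * \int[mu]_x (normc (f x * g x))%:E)%E).
    by apply: lee_wpmul2l => //; exact: normc_cintegral_le.
  rewrite -ge0_integralZ_EFin; [|by []|by apply: cmeasurable_normc; exact: cmeasurableM|by move=> x; exact: normc_ge0].
  apply: ge0_le_integralT => x; first by rewrite lee_fin mulr_ge0 ?normc_ge0.
  rewrite lee_fin Normc.normcM.
  set p := normc (f x); set q := normc (g x); have wx := w0 x.
  have h := sqr_ge0 (s * w x * p - q).
  have sw : 0 < s * w x by rewrite mulr_gt0.
  rewrite -(@ler_pM2l _ (s * w x))// -subr_ge0.
  rewrite [leRHS](_ : _ = (s * w x * p - q) ^+ 2)//; field.
  by rewrite !gt_eqF.
under eq_integral do rewrite EFinD.
rewrite ge0_integralD; last 5 first.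
- exact: measurableT.
- by move=> x _; rewrite lee_fin mulr_ge0 ?(ltW s0)// mulr_ge0 ?sqr_ge0// ltW.
- by apply/measurable_EFinP; apply: measurable_funM => //; exact: measurable_funM.
- by move=> x _; rewrite lee_fin mulr_ge0 ?invr_ge0 ?(ltW s0)// mulr_ge0 ?sqr_ge0// invr_ge0 ltW.
- by apply/measurable_EFinP; apply: measurable_funM => //; exact: measurable_funM.
rewrite ge0_integralZ_EFin; [|exact: ltW|exact: measurable_funM|by move=> x; rewrite mulr_ge0 ?sqr_ge0// ltW].
rewrite ge0_integralZ_EFin; [|by rewrite invr_ge0 ltW|exact: measurable_funM|by move=> x; rewrite mulr_ge0 ?sqr_ge0// invr_ge0 ltW].
rewrite -/B E EFinD !EFinM; apply: leeD => //; apply: lee_wpmul2l => //.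
by rewrite lee_fin ltW.
Qed.

End weighted_cauchy_schwarz.

Section weight.
Context {R : realType} {n : nat}.
Notation mu := (@leb R n).
Variables (a sigma : R).
Hypotheses (a0 : 0 < a) (sigma0 : 0 <= sigma).

(** Since 2 sigma = d lambda, its inverse is the weight in [g_log_star]. *)
Definition weight (y : 'rV[R]_n) : R := (1 + enorm y / a) `^ (2 * sigma).

Lemma weight_base_gt0 (y : 'rV[R]_n) : 0 < 1 + enorm y / a.
Proof. by rewrite ltr_pwDl// divr_ge0 ?enorm_ge0// ltW. Qed.

Lemma weight_gt0 y : 0 < weight y.
Proof. by rewrite powR_gt0// weight_base_gt0. Qed.

Lemma measurable_weight : measurable_fun setT weight.
Proof.
apply: (measurableT_comp (measurable_powR _)).
apply: measurable_funD => //; apply: measurable_funM => //.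
by apply: measurable_fun_enorm.
Qed.

(** Peetre's inequality: 1 + |u|/a <= (1 + |u + z|/a) (1 + |z|/a). *)
Lemma weight_submul u z : (weight (u + z))^-1 <= (weight u)^-1 * weight z.
Proof.
rewrite ler_pdivlMl ?weight_gt0// ler_pdivrMr ?weight_gt0//.
rewrite /weight -powRM ?(ltW (weight_base_gt0 _))//.
apply: ge0_ler_powR; rewrite ?nnegrE ?mulr_ge0 ?(ltW (weight_base_gt0 _))//.
have h : enorm u <= enorm (u + z) + enorm z.
  by rewrite -{1}[u](addrK z) (le_trans (ler_enormD _ _))// enormN.
have h1 := divr_ge0 (enorm_ge0 (u + z)) (ltW a0); have h2 := divr_ge0 (enorm_ge0 z) (ltW a0).
apply: (@le_trans _ _ (1 + (enorm (u + z) + enorm z) / a)).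
  by rewrite lerD2l ler_wpM2r// invr_ge0 ltW.
rewrite mulrDl; nra.
Qed.

Lemma integral_weight_shift (E : 'rV[R]_n -> R[i]) (z : 'rV[R]_n) : cmeasurable E ->
  (\int[mu]_y (normc (E (y - z)) ^+ 2 * (weight y)^-1)%:E <=
   (weight z)%:E * \int[mu]_y (normc (E y) ^+ 2 * (weight y)^-1)%:E)%E.
Proof.
move=> mE; have mnE := measurable_funX 2 (cmeasurable_normc mE).
have mwV : measurable_fun setT (fun y => (weight y)^-1).
  exact: measurable_inv_gt0 measurable_weight weight_gt0.
rewrite -ge0_integralZ_EFin; last 3 first.
- exact: ltW (weight_gt0 z).
- exact: measurable_funM.
- by move=> y; rewrite mulr_ge0 ?sqr_ge0// invr_ge0 ltW// weight_gt0.
have sh : measurable_fun setT (fun y : 'rV[R]_n => y - z) by exact: measurable_fun_rVB.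
rewrite -(ge0_integral_shift z (f := fun y => (normc (E (y - z)) ^+ 2 * (weight y)^-1)%:E)); last 2 first.
- apply/measurable_EFinP; apply: measurable_funM => //.
  exact: (measurable_funX 2 (cmeasurable_normc (cmeasurable_comp sh mE))).
- by move=> y; rewrite lee_fin mulr_ge0 ?sqr_ge0// invr_ge0 ltW// weight_gt0.
apply: ge0_le_integralT => y.
  by rewrite lee_fin mulr_ge0 ?sqr_ge0// invr_ge0 ltW// weight_gt0.
by rewrite lee_fin addrK mulrCA ler_wpM2l ?sqr_ge0// mulrC weight_submul.
Qed.

(** After Tonelli, the shift of [E] by [z] costs a factor [weight z], which is charged to [H]. *)
Lemma integral_weight_convolution (H E : 'rV[R]_n -> R[i]) : cmeasurable H -> cmeasurable E ->
  (\int[mu]_y \int[mu]_z (normc (H z) ^+ 2 * normc (E (y - z)) ^+ 2 * (weight y)^-1)%:E <=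
   (\int[mu]_z (normc (H z) ^+ 2 * weight z)%:E) *
   \int[mu]_y (normc (E y) ^+ 2 * (weight y)^-1)%:E)%E.
Proof.
move=> mH mE.
have mnH := measurable_funX 2 (cmeasurable_normc mH).
have mwV : measurable_fun setT (fun y => (weight y)^-1).
  exact: measurable_inv_gt0 measurable_weight weight_gt0.
have w0 y : 0 <= (weight y)^-1 by rewrite invr_ge0 ltW// weight_gt0.
rewrite (fubini_tonelli (m1 := mu) (m2 := mu)
  (fun p : 'rV[R]_n * 'rV[R]_n => (normc (H p.2) ^+ 2 * normc (E (p.1 - p.2)) ^+ 2 * (weight p.1)^-1)%:E)); last 2 first.
- apply/measurable_EFinP; apply: measurable_funM; last exact: (measurableT_comp mwV measurable_fst).
  apply: measurable_funM; first exact: (measurableT_comp mnH measurable_snd).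
  apply: (measurable_funX 2 (cmeasurable_normc (cmeasurable_comp _ mE))).
  by apply: measurable_fun_rVB; [exact: measurable_fst|exact: measurable_snd].
- by move=> p; rewrite lee_fin mulr_ge0// mulr_ge0 ?sqr_ge0.
rewrite -ge0_integralZr; last 4 first.
- exact: measurableT.
- by apply/measurable_EFinP; apply: measurable_funM => //; exact: measurable_weight.
- by move=> z _; rewrite lee_fin mulr_ge0 ?sqr_ge0// ltW// weight_gt0.
- by apply: integral_ge0 => y _; rewrite lee_fin mulr_ge0 ?sqr_ge0.
apply: ge0_le_integralT => z.
  by apply: integral_ge0 => y _; rewrite lee_fin mulr_ge0// mulr_ge0 ?sqr_ge0.
under eq_integral do rewrite /= -mulrA.
have mEz : cmeasurable (fun y : 'rV[R]_n => E (y - z)) by apply: (cmeasurable_comp _ mE); exact: measurable_fun_rVB.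
have mnEz := measurable_funX 2 (cmeasurable_normc mEz).
rewrite ge0_integralZ_EFin; [|exact: sqr_ge0|exact: measurable_funM|by move=> y; rewrite mulr_ge0 ?sqr_ge0].
rewrite [X in (_ <= X * _)%E]EFinM -muleA; apply: lee_wpmul2l; first by rewrite lee_fin sqr_ge0.
exact: integral_weight_shift.
Qed.

End weight.

Section cube.
Context {R : realType} {n : nat}.
Notation mu := (@leb R n).

(** Its measure factorises; Euclidean balls are only compared with cubes. *)
Definition cube (c : 'rV[R]_n) (r : R) : set 'rV[R]_n :=
  [set x | forall i, c ord0 i - r <= x ord0 i <= c ord0 i + r].

Lemma indic_cube c r x :
  \1_(cube c r) x = \prod_(i < n) \1_(`[c ord0 i - r, c ord0 i + r]%classic) (x ord0 i) :> R.
Proof.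
have [xc|xc] := pselect (cube c r x).
  rewrite indicE mem_set//= big1// => i _; rewrite indicE mem_set//=.
  by rewrite in_itv; exact: xc.
rewrite indicE memNset//=.
have [i xi] : exists i, ~ (c ord0 i - r <= x ord0 i <= c ord0 i + r) by exact/existsNP.
rewrite (bigD1 i)//= indicE memNset ?mul0r// => /=.
Qed.

Lemma measurable_cube c r : measurable (cube c r).
Proof.
have -> : cube c r = \bigcap_(i in [set: 'I_n]) ((fun x : 'rV[R]_n => x ord0 i) @^-1` `[c ord0 i - r, c ord0 i + r]).
  apply/seteqP; split => [x xc i _ /=|x h i]; first by rewrite in_itv/=; exact: xc.
  by have := h i I; rewrite /= in_itv.
apply: fin_bigcap_measurable => // i _; rewrite -[X in measurable X]setTI.
exact: measurable_coordrV.
Qed.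

Lemma leb_cube c r : 0 <= r -> mu (cube c r) = ((2 * r) ^+ n)%:E.
Proof.
move=> r0.
have -> : mu (cube c r) = (\int[mu]_x (\1_(cube c r) x)%:E)%E.
  by rewrite integral_indic// ?setIT//; exact: measurable_cube.
under eq_integral do rewrite indic_cube.
rewrite (ge0_integral_prod (f := fun i => \1_(`[c ord0 i - r, c ord0 i + r]%classic))); last 2 first.
- by move=> i; exact: measurable_indic.
- by move=> i s; rewrite indicE ler0n.
rewrite (eq_bigr (fun=> (2 * r)%:E)); last first.
  move=> i _; rewrite ge0_integral_leb1E; last 2 first.
  - by apply/measurable_EFinP; exact: measurable_indic.
  - by move=> s; rewrite lee_fin indicE ler0n.
  rewrite integral_indic// setIT; apply: (etrans (lebesgue_measure_itv _)) => /=.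
  case: ifPn; rewrite lte_fin => h; first by rewrite -EFinB; congr EFin; lra.
  by congr EFin; lra.
by rewrite prodEFin prodr_const card_ord.
Qed.

End cube.

Section core_constants.
Context {R : realType} {n : nat}.
Variable eps : R.
Hypothesis eps0 : 0 < eps.
Notation mu := (@leb R n).

(** Near 0 every factor of [cutoff] stays above half its value there, so a small cube already
    carries positive mass. *)
Lemma integral_cutoff_sqr_gt0 : exists2 c : R, 0 < c &
  (c%:E <= \int[mu]_x (cutoff eps x ^+ 2)%:E)%E.
Proof.
have b0 := bump0_gt0 eps0.
have [_ /posnumP[d] dB] : exists2 d : R, 0 < d & forall s, `|s| <= d -> sbump eps 0 0 / 2 <= sbump eps 0 s.
  have c : {for 0, continuous (sbump eps 0)}.
    apply: differentiable_continuous; apply/derivable1_diffP.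
    exact: (@ex_derive _ _ _ _ _ _ _ (is_derive_bump eps 0 0)).
  have : \forall s \near 0, sbump eps 0 0 / 2 < sbump eps 0 s.
    by move: (@lt_nbhsr R (sbump eps 0 0 / 2) (sbump eps 0 0)) => /(_ _)/c; apply; lra.
  move=> /nbhs_ballP[d /= d0 dB]; exists (d / 2); first by rewrite divr_gt0.
  move=> s sd; apply/ltW/dB; rewrite /ball/= sub0r normrN (le_lt_trans sd)//; lra.
exists ((sbump eps 0 0 / 2) ^+ n ^+ 2 * (2 * d%:num) ^+ n).
  have h2 : 0 < sbump eps 0 0 / 2 by exact: divr_gt0.
  by apply: mulr_gt0; do ?apply: exprn_gt0; last exact: mulr_gt0.
have -> : ((sbump eps 0 0 / 2) ^+ n ^+ 2 * (2 * d%:num) ^+ n)%:E =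
    (((sbump eps 0 0 / 2) ^+ n ^+ 2)%:E * \int[mu]_x (\1_(cube 0 d%:num) x)%:E)%E.
  rewrite EFinM -(@leb_cube _ _ 0)// integral_indic// ?setIT//; exact: measurable_cube.
rewrite -ge0_integralZ_EFin; last 3 first.
- exact: sqr_ge0.
- apply: measurable_indic; exact: measurable_cube.
- by move=> x; rewrite indicE ler0n.
apply: ge0_le_integralT => x; first by rewrite lee_fin mulr_ge0 ?sqr_ge0// indicE ler0n.
rewrite lee_fin indicE; case: (boolP (x \in _)) => [|_]; last by rewrite mulr0 sqr_ge0.
rewrite inE => xd; rewrite mulr1; apply: lerXn2r; rewrite ?nnegrE ?exprn_ge0 ?cutoff_ge0//.
  by rewrite divr_ge0// ltW.
rewrite -[n in X in X <= _]card_ord -prodr_const; apply: ler_prod => i _.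
rewrite divr_ge0 ?(ltW b0)//= dB// ler_norml.
by have := xd i; rewrite !mxE !add0r.
Qed.

Lemma integral_cutoff_kernel_weight (sigma : R) : 0 <= sigma -> exists2 c : R, 0 < c &
  (\int[mu]_z (normc (cutoff_kernel eps z) ^+ 2 * weight 1 sigma z)%:E <= c%:E)%E.
Proof.
move=> s0.
(* [N] exceeds 2 sigma, so the weight is at most (1 + |z|)^N. One of the two kernel factors is
   merely bounded, by [M2]; the other absorbs the weight and remains integrable. *)
pose N := (Num.truncn (2 * sigma)).+1.
have [M1 [M10 HM1]] := rapid_le (2 * n + N) (@rapid_cutoff_kernel R n eps eps0).
have [M2 HM2] := rapid_bounded (@rapid_cutoff_kernel R n eps eps0).
have M20 : 0 <= M2 by exact: le_trans (normc_ge0 _) (HM2 0).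
exists (1 + fine (\int[mu]_z (M2 * M1 * cauchyV z)%:E)%E).
  rewrite ltr_pwDl// fine_ge0// integral_ge0// => z _.
  by rewrite lee_fin !mulr_ge0// ltW// cauchyV_gt0.
have ci : mu.-integrable setT (EFin \o (fun z => M2 * M1 * cauchyV z)).
  exact: (integrableZl measurableT _ (cintegrable_Re (@cintegrable_cauchyV R n))).
apply: (@le_trans _ _ (\int[mu]_z (M2 * M1 * cauchyV z)%:E)%E); last first.
  rewrite EFinD fineK; last exact: (integrable_fin_num measurableT ci).
  by rewrite leeDr.
apply: ge0_le_integralT => z.
  by rewrite lee_fin mulr_ge0 ?sqr_ge0// ltW// weight_gt0.
rewrite lee_fin expr2 -!mulrA; apply: ler_pM => //; rewrite ?mulr_ge0 ?normc_ge0//; first by rewrite ltW// weight_gt0.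
apply: (@le_trans _ _ (M1 * (1 + enorm z) ^- (2 * n + N) * (1 + enorm z) ^+ N)).
  apply: ler_pM; rewrite ?normc_ge0//; first by rewrite ltW// weight_gt0.
  rewrite /weight divr1 -powR_mulrn ?(ltW (oneDenorm_gt0 _))//.
  apply: ler_powR; first exact: oneDenorm_ge1.
  by rewrite ltW// /N truncnS_gt.
rewrite -mulrA ler_wpM2l// exprD invfM divfK ?cauchyV_ge//.
by rewrite expf_neq0// gt_eqF// oneDenorm_gt0.
Qed.

End core_constants.

Section core.
Context {R : realType} {n : nat}.
Notation mu := (@leb R n).
Variables (eps a sigma A : R) (k : nat).
Hypotheses (eps0 : 0 < eps) (a0 : 0 < a) (sigma0 : 0 <= sigma).
Variables (m E : 'rV[R]_n -> R[i]).
Hypotheses (mm : cmeasurable m) (mA : forall x, normc (m x) <= A * (1 + enorm x) ^+ k).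
Hypotheses (Ei : cintegrable mu E) (fEr : rapid (fourier E)).
Variable M : R.
Hypothesis EM : forall x, normc (E x) <= M.

(** In the notation of the overview, [win xi] is h_a(xi - .), [Ha] is H_a, [h2a] is h_a^2 and
    [bk xi] is b_xi. Modulating [Ha] by [xi] moves its transform to the window at [xi]. *)
Let win (xi eta : 'rV[R]_n) : R[i] := (cutoff eps (a *: (eta - xi)))%:C.
Let Ha : 'rV[R]_n -> R[i] := dilation (cutoff_kernel eps) a.
Let mE eta := m eta * fourier E eta.
Let h2a (eta : 'rV[R]_n) : R[i] := (cutoff eps (a *: eta) ^+ 2)%:C.
Let U := convolution mE h2a.
Let bk (xi : 'rV[R]_n) := convolution (fun z => Ha z * expi (2 * pi * dotrV z xi)) E.

Lemma win_bumpV xi : win xi = bumpV eps 1 a xi (fun=> 0%N).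
Proof. by apply/funext => eta; rewrite cutoff_bumpV mul1r. Qed.

Lemma cintegrable_core_kernel : cintegrable mu Ha.
Proof.
apply: cintegrable_dilation => //; apply: rapid_integrable.
  exact: cmeasurable_cutoff_kernel.
exact: rapid_cutoff_kernel.
Qed.

Lemma cintegrable_core_modulated xi :
  cintegrable mu (fun z => Ha z * expi (2 * pi * dotrV z xi)).
Proof.
apply: cintegrable_expi; first exact: cintegrable_core_kernel.
apply: measurable_funM => //; exact: measurable_fun_dotrV.
Qed.

Lemma fourier_core_modulated xi eta :
  fourier (fun z => Ha z * expi (2 * pi * dotrV z xi)) eta = win xi eta.
Proof.
rewrite fourier_modulation fourier_dilation// ?fourier_cutoff_kernel//.
apply: rapid_integrable.
  exact: cmeasurable_cutoff_kernel.
exact: rapid_cutoff_kernel.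
Qed.

Lemma cintegrable_bounded_shift (v : 'rV[R]_n -> R[i]) y : cintegrable mu v ->
  cintegrable mu (fun z => v z * E (y - z)).
Proof.
move=> vi; under eq_fun do rewrite mulrC.
apply: (cintegrable_bounded_mul (M := M)) => //.
by apply: (cmeasurable_comp _ (proj1 Ei)); exact: measurable_fun_rVB.
Qed.

Lemma fourier_core_bk xi eta : fourier (bk xi) eta = win xi eta * fourier E eta.
Proof.
rewrite /bk fourier_convolution ?fourier_core_modulated//.
  exact: cintegrable_core_modulated.
by move=> y; apply: cintegrable_bounded_shift; exact: cintegrable_core_modulated.
Qed.

Lemma cintegrable_core_bk xi : cintegrable mu (bk xi).
Proof.
apply: cintegrable_convolution => //; first exact: cintegrable_core_modulated.
by move=> y; apply: cintegrable_bounded_shift; exact: cintegrable_core_modulated.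
Qed.

Lemma cintegrable_core_symbol xi : cintegrable mu (fun eta => m eta * win xi eta).
Proof.
apply: rapid_integrable.
  by apply: cmeasurableM => //; rewrite win_bumpV; exact: cmeasurable_bumpV.
by apply: (rapid_mul_growth mA); rewrite win_bumpV; exact: rapid_bumpV.
Qed.

(** One window factor of [h2a] is grouped with [m], the other with [fourier E], where it forms the
    transform of [bk xi]; evenness of [cutoff] identifies both with [win xi]. *)
Lemma core_UE xi : U xi = cintegral mu setT (fun y => fourier (fun eta => m eta * win xi eta) y * bk xi y).
Proof.
rewrite fourier_multiplication; last 2 first.
- exact: cintegrable_core_symbol.
- exact: cintegrable_core_bk.
rewrite /U /convolution; congr cintegral; apply/funext => eta.
rewrite fourier_core_bk /mE /h2a /win.
have -> : a *: (xi - eta) = - (a *: (eta - xi)) by rewrite -scalerN opprB.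
rewrite cutoffN expr2 rmorphM/=; ring.
Qed.

(** The bound [K] is demanded only when the window at [xi] meets the frequencies of [E]; otherwise
    the integrand defining [U xi] vanishes identically. This is what confines the use of the Miyachi
    condition to an annulus. *)
Lemma core_U_le (K : R) xi : 0 < K ->
  ((exists eta, fourier E eta != 0 /\ cutoff eps (a *: (eta - xi)) != 0) ->
   (\int[mu]_y (normc (fourier (fun eta => (m eta * (cutoff eps (a *: (eta - xi)))%:C)%R) y) ^+ 2 *
     weight a sigma y)%:E <= K%:E)%E) ->
  ((normc (U xi) ^+ 2)%:E <= K%:E * \int[mu]_y (normc (bk xi y) ^+ 2 * (weight a sigma y)^-1)%:E)%E.
Proof.
move=> K0 HK.
have [ex|nex] := pselect (exists eta, fourier E eta != 0 /\ cutoff eps (a *: (eta - xi)) != 0).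
  have mb := cintegrable_core_bk xi.
  have ms := cintegrable_core_symbol xi.
  rewrite core_UE; apply: weighted_cauchy_schwarz => //; last exact: HK.
  - apply: (cintegrable_bounded_mul (M := norm1 (fun eta => m eta * win xi eta))) => //.
      by apply: cmeasurable_fourier; case: ms.
    by move=> y; exact: normc_fourier_le.
  - by apply: cmeasurable_fourier; case: ms.
  - by case: mb.
  - exact: measurable_weight.
  - by move=> y; exact: weight_gt0.
have -> : U xi = 0.
  rewrite core_UE fourier_multiplication; last 2 first.
  - exact: cintegrable_core_symbol.
  - exact: cintegrable_core_bk.
  have -> : (fun eta => m eta * win xi eta * fourier (bk xi) eta) = (fun=> 0).
    apply/funext => eta; rewrite fourier_core_bk.
    have [->|e1] := eqVneq (fourier E eta) 0; first by rewrite !mulr0.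
    have [e2|e2] := eqVneq (cutoff eps (a *: (eta - xi))) 0; first by rewrite /win e2 rmorph0 mulr0 mul0r.
    by case: nex; exists eta.
  rewrite cintegralE/=.
  by rewrite /Rintegral (eq_integral (cst 0%E))// integral0.
rewrite Normc.normc0 expr0n; apply: mule_ge0; first by rewrite lee_fin ltW.
by apply: integral_ge0 => y _; rewrite lee_fin mulr_ge0 ?sqr_ge0// invr_ge0 ltW// weight_gt0.
Qed.

Lemma core_bk_le y :
  (\int[mu]_xi (normc (bk xi y) ^+ 2)%:E <=
    (@fejer_mass R n)%:E * \int[mu]_z (normc (Ha z) ^+ 2 * normc (E (y - z)) ^+ 2)%:E)%E.
Proof.
pose v z := Ha z * E (y - z).
have vi : cintegrable mu v by apply: cintegrable_bounded_shift; exact: cintegrable_core_kernel.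
have Ebk xi : bk xi y = fourier v (- xi).
  rewrite -inv_fourierE /bk /convolution /inv_fourier; congr cintegral.
  by apply/funext => z; rewrite /v mulrAC dotrVC.
under eq_integral do rewrite Ebk -sub0r.
rewrite (ge0_integral_reflect 0 (f := fun xi => (normc (fourier v xi) ^+ 2)%:E)); last 2 first.
- by apply: measurable_sqr_normc; apply: cmeasurable_fourier; case: vi.
- by move=> x; rewrite lee_fin sqr_ge0.
apply: le_trans (plancherel_le vi) _.
apply: lee_wpmul2l; first by rewrite lee_fin ltW// fejer_mass_gt0.
apply: ge0_le_integralT => z; first by rewrite lee_fin sqr_ge0.
by rewrite lee_fin /v Normc.normcM exprMn.
Qed.

(** Under z = a s the weight becomes the one at scale 1, [Ha] squared brings a^(-2n) and the measure
    a^n. *)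
Lemma integral_core_kernel_weight (c : R) :
  (\int[mu]_z (normc (cutoff_kernel eps z) ^+ 2 * weight 1 sigma z)%:E <= c%:E)%E ->
  (\int[mu]_z (normc (Ha z) ^+ 2 * weight a sigma z)%:E <= (a ^- n * c)%:E)%E.
Proof.
move=> hc.
have an0 : 0 < a ^+ n by rewrite exprn_gt0.
have mH : cmeasurable (cutoff_kernel eps : 'rV[R]_n -> R[i]) by exact: cmeasurable_cutoff_kernel.
have mHa : cmeasurable Ha by case: cintegrable_core_kernel.
rewrite -(ge0_integral_leb_affine (c := a) 0 (f := fun z => (normc (Ha z) ^+ 2 * weight a sigma z)%:E)) ?gt_eqF//; last 2 first.
- apply/measurable_EFinP; apply: measurable_funM; last exact: measurable_weight.
  exact: (measurable_funX 2 (cmeasurable_normc mHa)).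
- by move=> z; rewrite lee_fin mulr_ge0 ?sqr_ge0// ltW// weight_gt0.
have -> : (\int[leb n]_s (normc (Ha (a *: s + 0)%R) ^+ 2 * weight a sigma (a *: s + 0)%R)%:E =
    \int[mu]_s (((a ^- n) ^+ 2) * (normc (cutoff_kernel eps s) ^+ 2 * weight 1 sigma s))%:E)%E.
  apply: eq_integral => s _; congr EFin; rewrite addr0 /Ha /dilation.
  rewrite scalerA mulVf ?gt_eqF// scale1r Normc.normcM normc_realc ger0_norm ?invr_ge0 ?(ltW an0)//.
  rewrite exprMn -mulrA; congr (_ * (_ * _)).
  rewrite /weight enormZ (gtr0_norm a0) divr1; congr (_ `^ _); congr (_ + _); field.
  by rewrite gt_eqF.
rewrite ge0_integralZ_EFin; last 3 first.
- exact: sqr_ge0.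
- apply: measurable_funM; last exact: measurable_weight.
  exact: (measurable_funX 2 (cmeasurable_normc mH)).
- by move=> z; rewrite mulr_ge0 ?sqr_ge0// ltW// weight_gt0.
rewrite muleA -EFinM (gtr0_norm a0).
have -> : a ^+ n * (a ^- n) ^+ 2 = a ^- n by field; rewrite gt_eqF.
rewrite [leRHS]EFinM.
by apply: lee_wpmul2l => //; rewrite lee_fin invr_ge0 ltW.
Qed.

End core.

Lemma sqr_sqr_mul_ge0 {R : realDomainType} (p q r : R) : 0 <= r -> 0 <= p ^+ 2 * q ^+ 2 * r.
Proof. by move=> r0; rewrite mulr_ge0// mulr_ge0 ?sqr_ge0. Qed.

Section core_inequality.
Context {R : realType} {n : nat}.
Notation mu := (@leb R n).
Variable eps : R.
Hypothesis eps0 : 0 < eps.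
Hypothesis epsc : forall t : R, `|t| <= 2 * pi * (n%:R * eps) -> 2^-1 <= cos t.

Lemma tonelli_sqr_normc (B : 'rV[R]_n -> 'rV[R]_n -> R[i]) (w : 'rV[R]_n -> R) :
  cmeasurable (fun p : 'rV[R]_n * 'rV[R]_n => B p.1 p.2) -> measurable_fun setT w ->
  (forall y, 0 <= w y) ->
  (\int[mu]_x \int[mu]_y (normc (B x y) ^+ 2 * w y)%:E =
   \int[mu]_y \int[mu]_x (normc (B x y) ^+ 2 * w y)%:E)%E.
Proof.
move=> mB mw w0.
apply: (fubini_tonelli (m1 := mu) (m2 := mu)
  (fun p : 'rV[R]_n * 'rV[R]_n => (normc (B p.1 p.2) ^+ 2 * w p.2)%:E)).
- apply/measurable_EFinP; apply: measurable_funM; last exact: (measurableT_comp mw measurable_snd).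
  exact: (measurable_funX 2 (cmeasurable_normc mB)).
- by move=> p; rewrite lee_fin mulr_ge0 ?sqr_ge0.
Qed.

(** On the support of the window |eta| <= n eps / a, so for |y| <= a the phase is at most 2 pi n eps
    and [epsc] bounds the real part of the exponential from below by 1/2. Rescaling gives
    [a ^- n]. *)
Lemma inv_fourier_window_ge (a c : R) (y : 'rV[R]_n) : 0 < a -> 0 < c ->
  (c%:E <= \int[mu]_x (cutoff eps x ^+ 2)%:E)%E -> enorm y <= a ->
  2^-1 * (a ^- n * c) <= normc (inv_fourier (fun eta : 'rV[R]_n => (cutoff eps (a *: eta) ^+ 2)%:C) y).
Proof.
move=> a0 c0 hc ya.
have an : a != 0 by rewrite gt_eqF.
pose h (x : 'rV[R]_n) : R[i] := (cutoff eps x ^+ 2)%:C.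
have mh : measurable_fun setT (fun x : 'rV[R]_n => cutoff eps x ^+ 2).
  by apply: measurable_funX; exact: measurable_cutoff.
have hi : cintegrable mu h.
  have [M M0 MB] := @cutoff_bounded R n eps.
  have := cintegrable_bounded_mul (M := M) (@cmeasurable_cutoff R n eps) (@cintegrable_cutoff R n eps eps0).
  have -> : h = (fun x => (cutoff eps x)%:C * (cutoff eps x)%:C).
    by apply/funext => x; rewrite /h expr2 rmorphM.
  by apply => x; rewrite normc_realc ger0_norm ?cutoff_ge0.
have hai : cintegrable mu (fun eta : 'rV[R]_n => (cutoff eps (a *: eta) ^+ 2)%:C).
  have := cintegrable_affine 0 an hi; rewrite /h; congr cintegrable.
  by apply/funext => x; rewrite addr0.
have hki : cintegrable mu (fun eta : 'rV[R]_n => (cutoff eps (a *: eta) ^+ 2)%:C * expi (2 * pi * dotrV y eta)).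
  apply: cintegrable_expi => //; apply: measurable_funM => //; exact: measurable_fun_dotrV.
apply: le_trans (Re_le_normc _).
rewrite /inv_fourier cintegralE/=.
have ri := cintegrable_Re hki.
rewrite -lee_fin /Rintegral fineK; last exact: (integrable_fin_num measurableT ri).
apply: (@le_trans _ _ (\int[mu]_eta (2^-1 * cutoff eps (a *: eta) ^+ 2)%:E)%E).
  have mha : measurable_fun setT (fun eta : 'rV[R]_n => cutoff eps (a *: eta) ^+ 2).
    by apply: (measurableT_comp mh); exact: measurable_fun_rVZ.
  rewrite ge0_integralZ_EFin; [|by []|exact: mha|by move=> x; exact: sqr_ge0].
  rewrite EFinM; apply: lee_wpmul2l; first by rewrite lee_fin invr_ge0.
  have := ge0_integral_leb_affine (c := a) 0 (f := fun x : 'rV[R]_n => (cutoff eps x ^+ 2)%:E) an.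
  rewrite (gtr0_norm a0) => hh; rewrite EFinM.
  rewrite -(@lee_pmul2l _ (a ^+ n)%:E) ?lte_fin ?exprn_gt0//.
  rewrite muleA -[X in (X * _ <= _)%E]EFinM divff ?expf_neq0// mul1e.
  have -> : (\int[mu]_x (cutoff eps (a *: x) ^+ 2)%:E = \int[leb n]_s (cutoff eps (a *: s + 0) ^+ 2)%:E)%E.
    by apply: eq_integral => x _; rewrite addr0.
  rewrite hh//; first by apply/measurable_EFinP.
  by move=> x; rewrite lee_fin sqr_ge0.
apply: le_integral => //.
- exact: (integrableZl measurableT 2^-1 (cintegrable_Re hai)).
- move=> eta _; rewrite lee_fin mul0r subr0 mulrC.
  have [->|hn] := eqVneq (cutoff eps (a *: eta)) 0; first by rewrite expr0n !mul0r.
  rewrite ler_wpM2l ?sqr_ge0//; apply: epsc.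
  rewrite normrM ger0_norm ?mulr_ge0 ?pi_ge0// ler_wpM2l ?mulr_ge0 ?pi_ge0//.
  apply: (le_trans (abs_dotrV_le _ _)).
  have : enorm eta <= n%:R * (eps / a).
    apply: enorm_le_coord => i; have := cutoff_ball hn i; rewrite !mxE normrM gtr0_norm//.
    by rewrite ler_pdivlMr// mulrC.
  move=> he; apply: (@le_trans _ _ (a * (n%:R * (eps / a)))).
    by apply: ler_pM; rewrite ?enorm_ge0.
  by rewrite [leLHS](_ : _ = n%:R * eps)//; field.
Qed.

(** [C] is fixed before the scale, the symbol and the function, so it serves all [t] at once. *)
Theorem core_inequality (sigma : R) : 0 <= sigma -> exists2 C : R, 0 < C &
  forall (a A : R) (k : nat) (m E : 'rV[R]_n -> R[i]) (M K : R),
  0 < a -> 0 < K -> cmeasurable m ->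
  (forall x, normc (m x) <= A * (1 + enorm x) ^+ k) ->
  cintegrable mu E -> rapid (fourier E) -> (forall x, normc (E x) <= M) ->
  (forall xi, (exists eta, fourier E eta != 0 /\ cutoff eps (a *: (eta - xi)) != 0) ->
   (\int[mu]_y (normc (fourier (fun eta => (m eta * (cutoff eps (a *: (eta - xi)))%:C)%R) y) ^+ 2 *
     weight a sigma y)%:E <= K%:E)%E) ->
  (\int[mu]_(y in [set y | (enorm y <= a)%R])
      (normc (inv_fourier (fun eta => (m eta * fourier E eta)%R) y) ^+ 2)%:E <=
    (C * a ^+ n * K)%:E * \int[mu]_y (normc (E y) ^+ 2 * (weight a sigma y)^-1)%:E)%E.
Proof.
move=> sigma0.
have [c c0 hc] := integral_cutoff_sqr_gt0 (n := n) eps0.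
have [cH cH0 hH] := integral_cutoff_kernel_weight (n := n) eps0 sigma0.
have F0 := @fejer_mass_gt0 R n.
(* The factor 4 / c^2 comes from the lower bound for the squared window, one [fejer_mass] from each
   of the two L^2 bounds, and [cH] from the weighted kernel. *)
exists (4 * @fejer_mass R n ^+ 2 * cH / c ^+ 2).
  by rewrite divr_gt0 ?mulr_gt0 ?exprn_gt0.
move=> a A k m E M K a0 K0 mm mA Ei fEr EM HK.
have an0 : 0 < a ^+ n by rewrite exprn_gt0.
have an : a != 0 by rewrite gt_eqF.
pose mE eta := m eta * fourier E eta.
pose h2a (eta : 'rV[R]_n) : R[i] := (cutoff eps (a *: eta) ^+ 2)%:C.
pose U := convolution mE h2a.
pose Ha : 'rV[R]_n -> R[i] := dilation (cutoff_kernel eps) a.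
pose bk (xi : 'rV[R]_n) := convolution (fun z => Ha z * expi (2 * pi * dotrV z xi)) E.
have mHa : cmeasurable Ha by case: (cintegrable_core_kernel (n := n) eps0 a0).
have mfE : cmeasurable (fourier E) by apply: cmeasurable_fourier; case: Ei.
have rmE : rapid mE by exact: rapid_mul_growth mA fEr.
have mEi : cintegrable mu mE by apply: rapid_integrable => //; exact: cmeasurableM.
have rh2 : rapid h2a.
  have := @rapid_bumpV R n eps eps0 1 a 0 (fun=> 0%N) a0.
  have [Mb Mb0 MB] := @cutoff_bounded R n eps.
  move=> /(rapid_mul_bounded (m := fun eta => (cutoff eps (a *: eta))%:C) (A := Mb)).
  have -> : h2a = (fun x => (cutoff eps (a *: x))%:C * bumpV eps 1 a 0 (fun=> 0%N) x).
    by apply/funext => x; rewrite /h2a cutoff_bumpV mul1r subr0 expr2 rmorphM.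
  by apply => x; rewrite normc_realc ger0_norm ?cutoff_ge0.
have mh2 : cmeasurable h2a.
  apply: cmeasurable_real; apply: measurable_funX.
  by apply: (measurableT_comp (@measurable_cutoff R n eps)); exact: measurable_fun_rVZ.
have h2i : cintegrable mu h2a by exact: rapid_integrable.
have cvi y : cintegrable mu (fun z => mE z * h2a (y - z)).
  have [Mb MB] := rapid_bounded rh2.
  under eq_fun do rewrite mulrC.
  apply: (cintegrable_bounded_mul (M := Mb)) => //.
  by apply: (cmeasurable_comp _ mh2); exact: measurable_fun_rVB.
have Ui : cintegrable mu U by exact: cintegrable_convolution.
have GU y : inv_fourier U y = inv_fourier mE y * inv_fourier h2a y.
  by rewrite !inv_fourierE /U fourier_convolution.
set I := (X in (_ <= _ * X)%E).
have I0 : (0 <= I)%E.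
  by apply: integral_ge0 => y _; rewrite lee_fin mulr_ge0 ?sqr_ge0// invr_ge0 ltW// weight_gt0.
pose q := (2^-1 * (a ^- n * c)) ^+ 2.
have q0 : 0 < q by rewrite exprn_gt0// !mulr_gt0// invr_gt0.
have mD : measurable [set y : 'rV[R]_n | (enorm y <= a)%R].
  have -> : [set y : 'rV[R]_n | (enorm y <= a)%R] = setT `&` (@enorm R n) @^-1` `]-oo, a].
    by rewrite setTI; apply/seteqP; split => y /=; rewrite in_itv.
  exact: (measurable_fun_enorm (@measurable_id _ _ _)).
have mfU : cmeasurable (fourier U) by apply: cmeasurable_fourier; case: Ui.
(* On the ball the squared modulus of the inverse transform of [h2a] is at least [q]; dividing by it
   passes from [mE] to [U], after which the ball is enlarged to the whole space. *)
have S1 : (\int[mu]_(y in [set y | (enorm y <= a)%R]) (normc (inv_fourier mE y) ^+ 2)%:E <=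
    q^-1%:E * \int[mu]_y (normc (fourier U y) ^+ 2)%:E)%E.
  rewrite -(ge0_integral_reflect 0 (f := fun y => (normc (fourier U y) ^+ 2)%:E)); last 2 first.
  - exact: measurable_sqr_normc.
  - by move=> y; rewrite lee_fin sqr_ge0.
  apply: (@le_trans _ _ (\int[mu]_(y in [set y | (enorm y <= a)%R]) (q^-1%:E * (normc (fourier U (0 - y)%R) ^+ 2)%:E))%E).
    apply: ge0_le_integralS => y ya; first by rewrite lee_fin sqr_ge0.
    rewrite -EFinM lee_fin ler_pdivlMl// sub0r -inv_fourierE GU Normc.normcM exprMn.
    rewrite mulrC ler_wpM2l ?sqr_ge0//; apply: lerXn2r; rewrite ?nnegrE ?normc_ge0//.
      by rewrite mulr_ge0// mulr_ge0 ?invr_ge0// ltW.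
    exact: inv_fourier_window_ge.
  apply: (@le_trans _ _ (q^-1%:E * \int[mu]_(y in [set y | (enorm y <= a)%R]) (normc (fourier U (0 - y)%R) ^+ 2)%:E)%E).
    apply: ge0_integralZl_leS; first by rewrite invr_gt0.
    by move=> y _; rewrite lee_fin sqr_ge0.
  apply: lee_wpmul2l; first by rewrite lee_fin invr_ge0 ltW.
  apply: ge0_subset_integral => //.
  - apply: measurable_sqr_normc; apply: (cmeasurable_comp _ mfU); exact: measurable_fun_rVB.
  - by move=> y _; rewrite lee_fin sqr_ge0.
have mE' : cmeasurable E by case: Ei.
have wV0 (y : 'rV[R]_n) : 0 <= (weight a sigma y)^-1 by rewrite invr_ge0 ltW// weight_gt0.
have mwV : measurable_fun setT (fun y : 'rV[R]_n => (weight a sigma y)^-1).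
  apply: measurable_inv_gt0; first exact: measurable_weight.
  by move=> y; exact: weight_gt0.
have mbk : cmeasurable (fun p : 'rV[R]_n * 'rV[R]_n => bk p.1 p.2).
  apply: (@cmeasurable_cintegral _ _ _ _ R mu (fun p : ('rV[R]_n * 'rV[R]_n) * 'rV[R]_n =>
    Ha p.2 * expi (2 * pi * dotrV p.2 p.1.1) * E (p.1.2 - p.2))).
  apply: cmeasurableM.
    apply: cmeasurableM; first exact: (cmeasurable_comp measurable_snd mHa).
    apply: cmeasurable_inv_fourier_kernel; first exact: measurable_snd.
    exact: (measurableT_comp measurable_fst measurable_fst).
  apply: (cmeasurable_comp _ mE'); apply: measurable_fun_rVB; last exact: measurable_snd.
  exact: (measurableT_comp measurable_snd measurable_fst).
(* Weighted Cauchy-Schwarz at each [xi], then Tonelli, so that [core_bk_le] integrates [xi] out for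
   fixed [y]. *)
have S2 : (\int[mu]_y (normc (U y) ^+ 2)%:E <= K%:E * ((@fejer_mass R n)%:E *
   \int[mu]_y \int[mu]_z (normc (Ha z) ^+ 2 * normc (E (y - z)) ^+ 2 * (weight a sigma y)^-1)%:E))%E.
  apply: (@le_trans _ _ (\int[mu]_xi (K%:E * \int[mu]_y (normc (bk xi y) ^+ 2 * (weight a sigma y)^-1)%:E))%E).
    apply: ge0_le_integralT => xi; first by rewrite lee_fin sqr_ge0.
    exact: (@core_U_le R n eps a sigma A k eps0 a0 m E mm mA Ei M EM K xi K0 (HK xi)).
  have inn xi : (0 <= \int[mu]_y (normc (bk xi y) ^+ 2 * (weight a sigma y)^-1)%:E)%E.
    by apply: integral_ge0 => y _; rewrite lee_fin mulr_ge0 ?sqr_ge0.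
  have ZK : (\int[mu]_xi (K%:E * \int[mu]_y (normc (bk xi y) ^+ 2 / weight a sigma y)%:E) <=
      K%:E * \int[mu]_x \int[mu]_y (normc (bk x y) ^+ 2 / weight a sigma y)%:E)%E.
    exact: (ge0_integralZl_leS mu K0 (fun xi _ => inn xi)).
  apply: le_trans ZK _.
  apply: lee_wpmul2l; first by rewrite lee_fin ltW.
  have FT : (\int[mu]_x \int[mu]_y (normc (bk x y) ^+ 2 / weight a sigma y)%:E =
      \int[mu]_y \int[mu]_x (normc (bk x y) ^+ 2 / weight a sigma y)%:E)%E.
    exact: (@tonelli_sqr_normc bk (fun y => (weight a sigma y)^-1) mbk mwV wV0).
  rewrite [leLHS]FT.
  have in2 y : (0 <= \int[mu]_z (normc (Ha z) ^+ 2 * normc (E (y - z)) ^+ 2 * (weight a sigma y)^-1)%:E)%E.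
    by apply: integral_ge0 => z _; rewrite lee_fin; exact: sqr_sqr_mul_ge0 (wV0 y).
  apply: le_trans (ge0_integralZl_leS mu F0 (fun y _ => in2 y)).
  apply: ge0_le_integralT => y; first by apply: integral_ge0 => xi _; rewrite lee_fin mulr_ge0 ?sqr_ge0.
  have w0 : 0 < (weight a sigma y)^-1 by rewrite invr_gt0 weight_gt0.
  apply: (@le_trans _ _ (\int[mu]_xi ((weight a sigma y)^-1%:E * (normc (bk xi y) ^+ 2)%:E))%E).
    apply: ge0_le_integralT => xi; first by rewrite lee_fin mulr_ge0 ?sqr_ge0.
    by rewrite -EFinM lee_fin mulrC.
  have in3 xi : (0 <= (normc (bk xi y) ^+ 2)%:E)%E by rewrite lee_fin sqr_ge0.
  apply: le_trans (ge0_integralZl_leS mu w0 (fun xi _ => in3 xi)) _.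
  apply: le_trans (lee_wpmul2l _ (core_bk_le eps0 a0 Ei EM y)) _; first by rewrite lee_fin.
  rewrite muleCA; apply: lee_wpmul2l; first by rewrite lee_fin ltW.
  rewrite -ge0_integralZ_EFin; [|by []| |by move=> z; rewrite mulr_ge0 ?sqr_ge0]; last first.
    apply: measurable_funM; first exact: (measurable_funX 2 (cmeasurable_normc mHa)).
    apply: measurable_funX; apply: cmeasurable_normc; apply: (cmeasurable_comp _ mE').
    exact: measurable_fun_rVB.
  apply: ge0_le_integralT => z.
    by rewrite lee_fin mulrC; exact: sqr_sqr_mul_ge0 (wV0 y).
  by rewrite lee_fin mulrC.
have S3 : (\int[mu]_y \int[mu]_z (normc (Ha z) ^+ 2 * normc (E (y - z)) ^+ 2 * (weight a sigma y)^-1)%:E <=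
    (a ^- n * cH)%:E * I)%E.
  apply: le_trans (integral_weight_convolution a0 sigma0 mHa mE') _.
  by apply: lee_wpmul2r => //; exact: (integral_core_kernel_weight eps0 a0 hH).
apply: le_trans S1 _.
have -> : (4 * @fejer_mass R n ^+ 2 * cH / c ^+ 2 * a ^+ n * K)%:E =
    (q^-1%:E * ((@fejer_mass R n)%:E * (K%:E * ((@fejer_mass R n)%:E * (a ^- n * cH)%:E))))%E.
  by rewrite -!EFinM; congr EFin; rewrite /q; field; rewrite !gt_eqF.
rewrite -!muleA; apply: lee_wpmul2l; first by rewrite lee_fin invr_ge0 ltW.
apply: le_trans (plancherel_le Ui) _; apply: lee_wpmul2l; first by rewrite lee_fin ltW.
apply: le_trans S2 _; apply: lee_wpmul2l; first by rewrite lee_fin ltW.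
by apply: lee_wpmul2l S3; rewrite lee_fin ltW.
Qed.

End core_inequality.

(** * Balls and scales *)

Section borel_version.
Context {R : realType} {n : nat}.
Notation mu := (@leb R n).

Lemma cintegral_ae_eq (f g : 'rV[R]_n -> R[i]) : {ae mu, forall x, f x = g x} ->
  cintegral mu setT f = cintegral mu setT g.
Proof.
move=> fg; rewrite /cintegral /Rintegral; congr (fine _ +i* fine _).
  by apply: ae_eq_integralT; apply: filterS fg => x ->.
by apply: ae_eq_integralT; apply: filterS fg => x ->.
Qed.

(** The growth bound is known almost everywhere only; setting the Borel function to 0 where it fails
    makes it hold everywhere and changes only a null set. *)
Lemma borel_version (m : 'rV[R]_n -> R[i]) : lebesgue_measurable m -> polynomial_growth m ->
  exists (m' : 'rV[R]_n -> R[i]) (A : R) (k : nat),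
    [/\ cmeasurable m', forall x, normc (m' x) <= A * (1 + enorm x) ^+ k &
     {ae mu, forall x, m x = m' x}].
Proof.
move=> [g [gr gi mg]] [A [k mA]].
pose D := [set x : 'rV[R]_n | normc (g x) <= A * (1 + enorm x) ^+ k].
have mgc : cmeasurable g by split.
have mD : measurable D.
  pose h (x : 'rV[R]_n) := A * (1 + enorm x) ^+ k - normc (g x).
  have mh : measurable_fun setT h.
    apply: measurable_funB; last exact: cmeasurable_normc.
    apply: measurable_funM => //; apply: measurable_funX; apply: measurable_funD => //.
    exact: measurable_fun_enorm.
  have -> : D = setT `&` h @^-1` `[0, +oo[.
    by rewrite setTI; apply/seteqP; split => x /=; rewrite in_itv/= andbT subr_ge0.
  exact: mh.
exists (fun x => (\1_D x)%:C * g x), `|A|, k; split.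
- by apply: cmeasurableM => //; apply: cmeasurable_real; exact: measurable_indic.
- move=> x; rewrite Normc.normcM normc_realc indicE.
  have p0 : 0 <= (1 + enorm x) ^+ k by rewrite exprn_ge0// ltW// oneDenorm_gt0.
  have [|_] := boolP (x \in D); last by rewrite normr0 mul0r mulr_ge0.
  rewrite inE /D/= => h; rewrite normr1 mul1r (le_trans h)//.
  by rewrite ler_wpM2r// ler_norm.
- apply: filterS2 mg mA => x mgx; rewrite mgx => h.
  by rewrite indicE mem_set// mul1r.
Qed.

End borel_version.

(** * Convolution with an inverse transform *)

Section multiplier_convolution.
Context {R : realType} {n : nat}.
Notation mu := (@leb R n).

Lemma inv_fourier_multiplication (u v : 'rV[R]_n -> R[i]) : cintegrable mu u -> cintegrable mu v ->
  cintegral mu setT (fun x => inv_fourier u x * v x) =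
  cintegral mu setT (fun x => u x * fourier (fun z => v (- z)) x).
Proof.
move=> ui vi; apply: etrans (fourier_multiplication ui (cintegrable_opp vi)).
have gi : cintegrable mu (fun x => fourier u x * v (- x)).
  apply: (cintegrable_bounded_mul (M := norm1 u)); last by move=> x; exact: normc_fourier_le.
    by apply: cmeasurable_fourier; case: ui.
  exact: cintegrable_opp.
rewrite -(cintegralN gi); congr cintegral; apply/funext => x.
by rewrite inv_fourierE opprK.
Qed.

(** [inv_fourier u] is not known to be integrable, so [fourier_convolution] cannot be applied to it;
    the multiplication formula moves the transform onto the reflected translate of [v] instead. *)
Lemma convolution_inv_fourier (u v : 'rV[R]_n -> R[i]) y : cintegrable mu u -> cintegrable mu v ->
  convolution (inv_fourier u) v y = inv_fourier (fun xi => u xi * fourier v xi) y.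
Proof.
move=> ui vi.
have vyi : cintegrable mu (fun z => v (y - z)).
  have := cintegrable_opp (cintegrable_shift y vi); congr cintegrable.
  by apply/funext => z; rewrite addrC.
apply: etrans (inv_fourier_multiplication ui vyi) _.
rewrite /inv_fourier; congr cintegral; apply/funext => xi.
have -> : (fun z => v (y - - z)) = (fun z => v (z + y)).
  by apply/funext => z; rewrite opprK addrC.
by rewrite fourier_shift// mulrCA mulrC.
Qed.

Lemma inv_fourier_shift (u : 'rV[R]_n -> R[i]) (x y : 'rV[R]_n) :
  inv_fourier u (y + x) = inv_fourier (fun xi => u xi * expi (2 * pi * dotrV x xi)) y.
Proof.
rewrite /inv_fourier; congr cintegral; apply/funext => xi.
by rewrite dotrVDl mulrDr expiD mulrA mulrAC.
Qed.

End multiplier_convolution.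

Section balls.
Context {R : realType} {n : nat}.
Notation mu := (@leb R n).

Lemma measurable_eball (c : 'rV[R]_n) (r : R) : measurable (eball c r).
Proof.
have -> : eball c r = setT `&` (fun x => enorm (x - c)) @^-1` `]-oo, r[.
  by rewrite setTI; apply/seteqP; split => y /=; rewrite in_itv.
have mB : measurable_fun setT (fun x : 'rV[R]_n => x - c) by exact: measurable_fun_rVB.
exact: (measurable_fun_enorm mB).
Qed.

Lemma leb_eball (c : 'rV[R]_n) (r : R) : (0 < n)%N -> 0 < r ->
  exists2 b : R, 0 < b <= (2 * r) ^+ n & mu (eball c r) = b%:E.
Proof.
move=> n0 r0.
have n0' : 0 < n%:R :> R by rewrite ltr0n.
have up : (mu (eball c r) <= ((2 * r) ^+ n)%:E)%E.
  rewrite -(leb_cube c (ltW r0)); apply: le_measure; rewrite ?inE.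
  - exact: measurable_eball.
  - exact: measurable_cube.
  - move=> x /= xr i; have := abs_coord_le (x - c) i; rewrite !mxE => h.
    have := le_lt_trans h xr; rewrite ltr_norml => /andP[h1 h2].
    by apply/andP; split; lra.
(* The cube of this half-side lies in the ball, since [enorm_le_coord] bounds the distance to the
   centre by r/2. *)
have s0 : 0 < r / (2 * n%:R) by rewrite divr_gt0// mulr_gt0.
have lo : (((2 * (r / (2 * n%:R))) ^+ n)%:E <= mu (eball c r))%E.
  rewrite -(leb_cube c (ltW s0)); apply: le_measure; rewrite ?inE.
  - exact: measurable_cube.
  - exact: measurable_eball.
  - move=> x xc; apply: (@le_lt_trans _ _ (n%:R * (r / (2 * n%:R)))).
      by apply: enorm_le_coord => i; have := xc i; rewrite !mxE ler_norml => /andP[h1 h2]; apply/andP; split; lra.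
    by rewrite [ltLHS](_ : _ = r / 2); [lra|field; rewrite gt_eqF].
case E : (mu (eball c r)) => [b| |]; last 2 first.
- by move: up; rewrite E.
- by move: lo; rewrite E.
exists b => //; move: up lo; rewrite E !lee_fin => -> h; rewrite andbT.
by apply: lt_le_trans h; rewrite exprn_gt0// mulr_gt0.
Qed.

(** The ball is open, so the infimum is approached along the segment from [c] to 0, at points of
    distance [r - s] from [c] with small [s]. *)
Lemma dist0_eball (c : 'rV[R]_n) (r : R) : 0 < r -> r <= enorm c ->
  dist0 (eball c r) = enorm c - r.
Proof.
move=> r0 rc; have c0 : 0 < enorm c by exact: lt_le_trans rc.
have lb : lbound [set enorm y | y in eball c r] (enorm c - r).
  move=> _ [y /= yr <-]; have := ler_enormD y (c - y); rewrite addrC subrK => h.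
  have : enorm (c - y) < r by rewrite -enormN opprB.
  by lra.
apply/eqP; rewrite eq_le; apply/andP; split.
  apply/ler_addgt0Pr => e e0.
  pose s := Num.min (e / 2) (r / 2).
  have s0 : 0 < s by rewrite lt_min !divr_gt0.
  have se : s <= e by rewrite ge_min (_ : e / 2 <= e)//; lra.
  have sr : s < r by rewrite (@le_lt_trans _ _ (r / 2)) ?ge_min ?lexx ?orbT//; lra.
  pose y := (1 - (r - s) / enorm c) *: c.
  have ey : enorm y = enorm c - r + s.
    rewrite enormZ ger0_norm; first by field; rewrite gt_eqF.
    by rewrite subr_ge0 ler_pdivrMr// mul1r; lra.
  apply: (@le_trans _ _ (enorm y)); last by rewrite ey; lra.
  apply: ge_inf; first by exists (enorm c - r).
  exists y; last by [].
  have yc : y - c = - ((r - s) / enorm c *: c) by rewrite /y scalerBl scale1r addrAC subrr add0r.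
  rewrite /eball /= yc enormN enormZ.
  rewrite ger0_norm ?divfK ?gt_eqF//; first lra.
  by rewrite divr_ge0 ?(ltW c0)//; lra.
apply: lb_le_inf => //; exists (enorm c), c => //.
by rewrite /eball/= subrr enorm0.
Qed.

End balls.

(** * Comparison of scales *)

Section scales.
Context {R : realType}.
Implicit Types (T u s x y q c : R).

(** A negative exponent exchanges the roles of [x] and [y]; both signs occur because [beta] is an
    arbitrary real. *)
Lemma powR_comparable x y q : 0 < x -> 0 < y -> y <= 2 * x -> x <= 2 * y ->
  x `^ q <= 2 `^ `|q| * y `^ q.
Proof.
move=> x0 y0 yx xy; have [q0|q0] := leP 0 q.
  rewrite ger0_norm// -powRM ?(ltW y0)//; apply: ge0_ler_powR => //; rewrite nnegrE.
    exact: ltW.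
  by rewrite mulr_ge0// ltW.
rewrite ltr0_norm//; have r0 : 0 <= - q by rewrite oppr_ge0 ltW.
move: r0; rewrite -{2 4}[q]opprK; move: (- q) => r r0.
rewrite !powRN ler_pdivlMr ?powR_gt0// mulrC ler_pdivrMr ?powR_gt0// -powRM ?(ltW x0)//.
by apply: ge0_ler_powR => //; rewrite nnegrE ?mulr_ge0// ltW.
Qed.

Lemma rho_gt0 gamma u : 1 < u -> 0 < rho gamma u.
Proof.
by move=> u1; rewrite divr_gt0 ?powR_gt0 ?ln_gt0// (lt_trans _ u1).
Qed.

(** Intermediate values. At the left end 2s/3 the requirement is c0 rho(u) <= u/2, that is 2 c0 <=
    (ln u)^(gamma-1), and the lower bound on [R0] is made for that. *)
Lemma subdyadic_radius gamma c0 R0 s : 1 < gamma -> 0 < c0 ->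
  expR ((2 * c0) `^ (gamma - 1)^-1) <= R0 -> 1 < R0 -> R0 <= 2 / 3 * s ->
  exists2 u : R, 2 / 3 * s <= u <= s & u + c0 * rho gamma u = s.
Proof.
move=> g1 c00 hR0 R01 hs; have p0 : 0 < gamma - 1 by rewrite subr_gt0.
have s0 : 0 < s by lra.
(* The power of the logarithm is spelled out through [expR] and [ln] to read off continuity; it
   agrees with the one in [rho] for u > 1. *)
pose f u := u + c0 * (u * (expR ((gamma - 1) * ln (ln u)))^-1).
have fE u : 1 < u -> f u = u + c0 * rho gamma u.
  by move=> u1; rewrite /f /rho /powR gt_eqF// ln_gt0.
have lnge u : 2 / 3 * s <= u -> (2 * c0) `^ (gamma - 1)^-1 <= ln u.
  move=> hu; rewrite -[leLHS]expRK; rewrite ler_ln ?posrE ?expR_gt0//; lra.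
have [] := @IVT R f (2 / 3 * s) s s.
- by lra.
- apply: continuous_in_subspaceT => u; rewrite inE/= in_itv/= => /andP[hu _].
  have u1 : 1 < u by lra.
  apply: cvgD; first exact: cvg_id.
  apply: cvgM; first exact: cvg_cst.
  apply: cvgM; first exact: cvg_id.
  apply: cvgV; first by rewrite gt_eqF// expR_gt0.
  apply: (@continuous_comp _ _ _ (fun u => (gamma - 1) * ln (ln u)) expR); last exact: continuous_expR.
  apply: cvgM; first exact: cvg_cst.
  apply: (@continuous_comp _ _ _ (@ln R) (@ln R)).
    by apply: continuous_ln; lra.
  by apply: continuous_ln; rewrite ln_gt0.
- rewrite ge_min le_max; apply/andP; split; last first.
    by rewrite fE ?lerDl ?mulr_ge0 ?(ltW c00) ?(ltW (rho_gt0 _ _)) ?orbT//; lra.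
  apply/orP; left; rewrite fE; last lra.
  have h := lnge _ (lexx _).
  have h2 : 2 * c0 <= ln (2 / 3 * s) `^ (gamma - 1).
    have c2 : 0 <= 2 * c0 by rewrite mulr_ge0// ltW.
    have e : 2 * c0 = ((2 * c0) `^ (gamma - 1)^-1) `^ (gamma - 1).
      by rewrite -powRrM mulVf ?gt_eqF// powRr1.
    rewrite [leLHS]e; apply: ge0_ler_powR; rewrite ?nnegrE ?powR_ge0 ?(ltW p0)//.
    exact: le_trans (powR_ge0 _ _) h.
  rewrite /rho mulrA -lerBrDl ler_pdivrMr; last by apply: lt_le_trans h2; rewrite mulr_gt0.
  nra.
- move=> u; rewrite in_itv/= => hu fu; exists u => //.
  by rewrite -fE//; lra.
Qed.

(** The two comparisons say T <= u^2 and u <= T^2; 16 is the value from which (T/4)^2 >= T. *)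
Lemma ln_comparable T u : 16 <= T -> T / 4 <= u -> u <= 17 / 8 * T ->
  0 < ln T /\ ln T <= 2 * ln u /\ ln u <= 2 * ln T.
Proof.
move=> T16 u1 u2; have T0 : 0 < T by lra.
have u0 : 0 < u by lra.
split; first by rewrite ln_gt0//; lra.
have sq x : 0 < x -> 2 * ln x = ln (x ^+ 2) by move=> x0; rewrite expr2 lnM ?posrE//; ring.
by split; rewrite sq//; rewrite ler_ln ?posrE ?exprn_gt0//; nra.
Qed.

(** The product is (u/T) (ln T / ln u)^(gamma-1): the first factor lies in [1/4, 3], and the second
    is within a factor 2^(gamma-1) of 1. *)
Lemma scale_comparable gamma T u : 1 < gamma -> 16 <= T -> T / 4 <= u -> u <= 17 / 8 * T ->
  (2 `^ (gamma - 1))^-1 / 4 <= a_scale gamma T^-1 * rho gamma u <= 3 * 2 `^ (gamma - 1).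
Proof.
move=> g1 T16 u1 u2; have p0 : 0 <= gamma - 1 by rewrite subr_ge0 ltW.
have [L0 [L1 L2]] := ln_comparable T16 u1 u2.
have T0 : 0 < T by lra.
have l0 : 0 < ln u by lra.
rewrite /a_scale /rho invrK.
set P := ln T `^ _; set Q := ln u `^ _; set S := 2 `^ _.
have P0 : 0 < P by exact: powR_gt0.
have Q0 : 0 < Q by exact: powR_gt0.
have S0 : 0 < S by exact: powR_gt0.
have PQ : P <= S * Q.
  rewrite -powRM ?(ltW l0)//; apply: ge0_ler_powR => //; rewrite nnegrE ?mulr_ge0// ltW//.
have QP : Q <= S * P.
  rewrite -powRM ?(ltW L0)//; apply: ge0_ler_powR => //; rewrite nnegrE ?mulr_ge0// ltW//.
have -> : T^-1 * P * (u / Q) = (u / T) * (P / Q) by field; rewrite !gt_eqF.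
have b1 : 4^-1 <= u / T by rewrite ler_pdivlMr//; lra.
have b2 : u / T <= 3 by rewrite ler_pdivrMr//; lra.
have b3 : S^-1 <= P / Q by rewrite ler_pdivlMr// ler_pdivrMl.
have b4 : P / Q <= S by rewrite ler_pdivrMr.
apply/andP; split.
  by rewrite mulrC; apply: ler_pM => //; rewrite ?invr_ge0 ltW.
by apply: ler_pM => //; rewrite ?divr_ge0 ?(ltW P0) ?(ltW Q0)//; lra.
Qed.

(** A multi-index of degree at most [N] has entries at most [N], so only finitely many occur; the
    reciprocal of 1 plus the sum of all 1/B lies below each of them. *)
Lemma exists_le_finite (d N : nat) (B : {ffun 'I_d -> nat} -> R) : (forall nu, 0 < B nu) ->
  exists2 c : R, 0 < c & forall nu, (mdeg nu <= N)%N -> c <= B nu.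
Proof.
move=> B0.
pose val (f : {ffun 'I_d -> 'I_N.+1}) : {ffun 'I_d -> nat} := [ffun i => f i : nat].
pose S := \sum_(f : {ffun 'I_d -> 'I_N.+1}) (B (val f))^-1.
have S0 : 0 <= S by apply: sumr_ge0 => f _; rewrite invr_ge0 ltW.
exists (1 + S)^-1; first by rewrite invr_gt0 ltr_pwDl.
move=> nu hnu; rewrite -[leRHS]invrK lef_pV2 ?posrE ?invr_gt0 ?ltr_pwDl//.
pose f : {ffun 'I_d -> 'I_N.+1} := [ffun i => inord (nu i)].
have nuf : nu = val f.
  apply/ffunP => i; rewrite !ffunE inordK// ltnS (leq_trans _ hnu)//.
  by rewrite /mdeg (bigD1 i)//= leq_addr.
rewrite nuf /S (bigD1 f)//= addrCA lerDl addr_ge0//.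
by apply: sumr_ge0 => g _; rewrite invr_ge0 ltW.
Qed.

End scales.

Section hsobolev_bound.
Context {R : realType} {n : nat}.
Notation mu := (@leb R n).

(** The Miyachi condition squared, with [p] its factor in R_B and [b] the measure of the ball. As
    the sign of [Cm] is not prescribed, [|Cm| + 1] stands in as a positive constant. *)
Lemma hsobolev_le (theta p b Cm : R) (g : 'rV[R]_n -> R[i]) : 0 < p -> 0 < b ->
  (p%:E * b%:E `^ (- 2^-1) * hsobolev theta g <= Cm%:E)%E ->
  (\int[mu]_xi ((enorm xi `^ theta * normc (fourier g xi)) ^+ 2)%:E <=
    ((`|Cm| + 1) ^+ 2 * b * p ^- 2)%:E)%E.
Proof.
move=> p0 b0; rewrite /hsobolev.
set I := (X in (X `^ 2^-1)%E) => hI; change (I <= ((`|Cm| + 1) ^+ 2 * b * p ^- 2)%:E)%E; move: hI.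
have I0 : (0 <= I)%E by apply: integral_ge0 => xi _; rewrite lee_fin sqr_ge0.
have q0 : 0 < p * b `^ (- 2^-1) by rewrite mulr_gt0// powR_gt0.
rewrite poweR_EFin -EFinM.
case: I I0 => [i| |]//; last first.
  by rewrite poweRyr ?invr_neq0// gt0_muley ?lte_fin// leye_eq.
rewrite lee_fin => i0; rewrite poweR_EFin -EFinM !lee_fin powR12_sqrt// => h.
have h1 : Num.sqrt i <= (`|Cm| + 1) / (p * b `^ (- 2^-1)).
  rewrite ler_pdivlMr// mulrC (le_trans h)// (le_trans (ler_norm _))// lerDl//.
rewrite -(@sqr_sqrtr _ i)//.
have -> : (`|Cm| + 1) ^+ 2 * b * p ^- 2 = ((`|Cm| + 1) / (p * b `^ (- 2^-1))) ^+ 2.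
  rewrite powRN powR12_sqrt ?(ltW b0)// -{1}[b]sqr_sqrtr ?(ltW b0)//.
  by field; rewrite !gt_eqF ?sqrtr_gt0.
apply: lerXn2r; rewrite ?nnegrE ?sqrtr_ge0//.
by rewrite divr_ge0 ?addr_ge0 ?(ltW q0).
Qed.

(** Reduces the weight to the Sobolev exponents 0 and [sigma]; the cases are v <= 1 and v > 1. *)
Lemma sqr_one_plus_powR_le (sigma v : R) : 0 <= sigma -> 0 <= v ->
  (1 + v) `^ (2 * sigma) <= 2 `^ (2 * sigma) * (1 + (v `^ sigma) ^+ 2).
Proof.
move=> s0 v0; have p0 : 0 <= 2 * sigma by rewrite mulr_ge0.
have E : (v `^ sigma) ^+ 2 = v `^ (2 * sigma).
  by rewrite -powR_mulrn ?powR_ge0// -powRrM mulrC.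
have [v1|v1] := leP v 1.
  apply: (@le_trans _ _ (2 `^ (2 * sigma))).
    by apply: ge0_ler_powR => //; rewrite ?nnegrE ?addr_ge0//; lra.
  by rewrite ler_peMr ?powR_ge0// lerDl sqr_ge0.
rewrite E; apply: (@le_trans _ _ (2 `^ (2 * sigma) * v `^ (2 * sigma))).
  rewrite -powRM//; apply: ge0_ler_powR => //; rewrite ?nnegrE ?addr_ge0 ?mulr_ge0//; lra.
by rewrite ler_wpM2l ?powR_ge0// lerDr.
Qed.

End hsobolev_bound.

(** * From the Miyachi condition to a fixed scale *)

Section miyachi_window.
Context {R : realType} {n : nat}.
Notation mu := (@leb R n).

(** With T >= 4 R0 and R0 >= e^2 this yields the T >= 16 of [ln_comparable]. *)
Lemma expR2_ge4 : 4 <= expR 2 :> R.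
Proof.
have -> : expR 2 = expR 1 ^+ 2 :> R by rewrite -expRM_natl mulr1.
have h : 2 <= expR 1 :> R by have := expR_ge1Dx (1 : R); lra.
by rewrite expr2; nra.
Qed.

Lemma sqr_powR_inv (x q : R) : (x `^ q) ^- 2 = x `^ (- (2 * q)).
Proof. by rewrite powRN -powR_mulrn ?powR_ge0// -powRrM mulrC. Qed.

Lemma fourier_scale (c : R) (u : 'rV[R]_n -> R[i]) xi : cintegrable mu u ->
  fourier (fun x => c%:C * u x) xi = c%:C * fourier u xi.
Proof.
move=> ui; rewrite !fourierE -(cintegralZ _ (cintegrable_fourier_integrand xi ui)).
by congr cintegral; apply/funext => x; rewrite mulrA.
Qed.

(** A derivative costs a factor [a], which is at most [xmax / r]; the small factor [delta] then
    brings the bump below the prescribed [Cnu]. *)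
Lemma adapted_window (C1 : R) (Cnu : {ffun 'I_n -> nat} -> R) (N : nat) (eps a r delta xmax : R)
    (M : {ffun 'I_n -> nat} -> R) (xi : 'rV[R]_n) :
  (0 < n)%N -> 0 < eps -> 0 < a -> 0 < r -> 0 < delta -> 0 <= xmax ->
  n%:R * eps < C1 * (a * r) -> a * r <= xmax ->
  (forall (nu : {ffun 'I_n -> nat}) c b (x y : 'rV[R]_n), normc (bumpV eps c b x nu y) <= `|c| * `|b| ^+ mdeg nu * M nu) ->
  (forall nu, 0 < M nu) ->
  (forall nu, (mdeg nu <= N)%N -> delta * (xmax ^+ mdeg nu * M nu) <= Cnu nu) ->
  adapted_bump C1 Cnu N xi r (bumpV eps delta a xi (fun=> 0%N)).
Proof.
move=> n0 eps0 a0 r0 d0 x0 hs hx MB M0 hd; split.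
- exact: smooth_bumpV.
- exact: compact_supp_bumpV.
- move=> x sx; rewrite /eball/=.
  apply: (@le_lt_trans _ _ (n%:R * (eps / a))).
    by apply: enorm_le_coord => i; rewrite !mxE; exact: (supp_bumpV a0 sx).
  by rewrite mulrA ltr_pdivrMr// -mulrA [r * a]mulrC.
- move=> nu hnu x; rewrite mderiv_bumpV (le_trans (MB _ _ _ _ _))//.
  rewrite (gtr0_norm d0) (gtr0_norm a0) ler_pdivlMr ?exprn_gt0//.
  apply: le_trans (hd nu hnu).
  rewrite [leLHS](_ : _ = delta * ((a * r) ^+ mdeg nu * M nu)); last by rewrite exprMn; ring.
  rewrite ler_wpM2l ?(ltW d0)// ler_wpM2r ?(ltW (M0 _))//.
  by apply: lerXn2r; rewrite ?nnegrE ?mulr_ge0 ?(ltW a0) ?(ltW r0).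
Qed.

(** [sqr_one_plus_powR_le] splits the weight between the two hypotheses, and [delta ^- 2] undoes the
    normalisation of the bump. *)
Lemma weighted_window_le (m : 'rV[R]_n -> R[i]) (a sigma delta B0 B1 : R) (w : 'rV[R]_n -> R[i]) :
  0 < a -> 0 <= sigma -> 0 < delta -> cintegrable mu (fun eta => m eta * w eta) ->
  (\int[mu]_y ((enorm y `^ 0 * normc (fourier (fun eta => (m eta * (delta%:C * w eta))%R) y)) ^+ 2)%:E <= B0%:E)%E ->
  (\int[mu]_y ((enorm y `^ sigma * normc (fourier (fun eta => (m eta * (delta%:C * w eta))%R) y)) ^+ 2)%:E <= B1%:E)%E ->
  (\int[mu]_y (normc (fourier (fun eta => (m eta * w eta)%R) y) ^+ 2 * weight a sigma y)%:E <=
    (2 `^ (2 * sigma) * delta ^- 2 * (B0 + (a^-1 `^ sigma) ^+ 2 * B1))%:E)%E.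
Proof.
move=> a0 s0 d0 mwi h0 h1.
pose V y := fourier (fun eta => m eta * w eta) y.
pose D y := fourier (fun eta => m eta * (delta%:C * w eta)) y.
have DV y : normc (D y) = delta * normc (V y).
  have -> : D y = delta%:C * V y.
    by rewrite -fourier_scale//; congr fourier; apply/funext => eta; rewrite mulrCA.
  by rewrite Normc.normcM normc_realc gtr0_norm.
have mV : cmeasurable V by apply: cmeasurable_fourier; case: mwi.
have mnD : measurable_fun setT (fun y => normc (D y)).
  have -> : (fun y => normc (D y)) = (fun y => delta * normc (V y)) by apply/funext.
  by apply: measurable_funM => //; exact: cmeasurable_normc.
have me q : measurable_fun setT (fun y : 'rV[R]_n => enorm y `^ q).
  by apply: (measurableT_comp (measurable_powR _)); exact: measurable_fun_enorm.
pose q := 2 `^ (2 * sigma) * delta ^- 2.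
have q0 : 0 <= q by rewrite mulr_ge0 ?powR_ge0// invr_ge0 sqr_ge0.
have mg p : measurable_fun setT (fun y : 'rV[R]_n => (enorm y `^ p * normc (D y)) ^+ 2).
  by apply: measurable_funX; exact: measurable_funM.
pose s2 := (a^-1 `^ sigma) ^+ 2.
apply: (@le_trans _ _ (\int[mu]_y ((q * (enorm y `^ 0 * normc (D y)) ^+ 2)%:E +
    (q * s2 * (enorm y `^ sigma * normc (D y)) ^+ 2)%:E))%E).
  apply: ge0_le_integralT => y.
    by rewrite lee_fin mulr_ge0 ?sqr_ge0// ltW// weight_gt0.
  rewrite -EFinD lee_fin -/(V y) DV powRr0 mul1r /q /s2 /weight.
  have v0 : 0 <= enorm y / a by rewrite divr_ge0 ?enorm_ge0 ?(ltW a0).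
  have hw := sqr_one_plus_powR_le s0 v0.
  apply: (le_trans (ler_wpM2l (sqr_ge0 (normc (V y))) hw)).
  have -> : (enorm y / a) `^ sigma = enorm y `^ sigma * a^-1 `^ sigma.
    by rewrite powRM ?enorm_ge0 ?invr_ge0 ?(ltW a0).
  rewrite le_eqVlt; apply/orP; left; apply/eqP; field.
  by rewrite gt_eqF.
rewrite ge0_integralD; last 5 first.
- exact: measurableT.
- by move=> y _; rewrite lee_fin mulr_ge0 ?sqr_ge0.
- by apply/measurable_EFinP; exact: measurable_funM.
- by move=> y _; rewrite lee_fin mulr_ge0 ?sqr_ge0// mulr_ge0 ?sqr_ge0.
- by apply/measurable_EFinP; exact: measurable_funM.
rewrite mulrDr EFinD; apply: leeD.
  rewrite ge0_integralZ_EFin; [|by []|exact: mg|by move=> y; exact: sqr_ge0].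
  by rewrite [leRHS]EFinM; apply: lee_wpmul2l.
rewrite ge0_integralZ_EFin; [|by rewrite mulr_ge0// sqr_ge0|exact: mg|by move=> y; exact: sqr_ge0].
rewrite mulrA [leRHS]EFinM; apply: lee_wpmul2l; last exact: h1.
by rewrite lee_fin mulr_ge0// sqr_ge0.
Qed.

(** A ball centred at [xi] with radius comparable to 1/a contributes [a ^- n] through its measure,
    its logarithm is comparable to that of [T], and the a^(-sigma) of the weight compensates the
    rho^sigma of the condition. [K0] is fixed before [R0], [T], [m] and [xi]. *)
Theorem miyachi_window (gamma beta sigma c0 C0 C1 : R) (Cnu : {ffun 'I_n -> nat} -> R)
    (N : nat) (eps Cm : R) :
  (0 < n)%N -> 1 < gamma -> 0 <= sigma -> 0 < c0 -> c0 < C0 -> 0 < C1 ->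
  (forall nu, 0 < Cnu nu) -> 0 < eps ->
  n%:R * eps < C1 * (c0 * ((2 `^ (gamma - 1))^-1 / 4)) ->
  exists2 K0 : R, 0 < K0 & forall (R0 T A : R) (k : nat) (m : 'rV[R]_n -> R[i]) (xi : 'rV[R]_n),
  cmeasurable m -> (forall x, normc (m x) <= A * (1 + enorm x) ^+ k) ->
  log_miyachi gamma beta sigma R0 c0 C0 C1 Cnu N Cm m ->
  expR ((2 * c0) `^ (gamma - 1)^-1) <= R0 -> expR 2 <= R0 -> 4 * R0 <= T ->
  3 / 8 * T <= enorm xi <= 17 / 8 * T ->
  (\int[mu]_y (normc (fourier (fun eta => (m eta * (cutoff eps (a_scale gamma T^-1 *: (eta - xi)))%:C)%R) y) ^+ 2 *
     weight (a_scale gamma T^-1) sigma y)%:E <=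
   (K0 * a_scale gamma T^-1 ^- n * ln T `^ (- (2 * beta)))%:E)%E.
Proof.
move=> n0 g1 s0 c00 c0C C10 Cnu0 eps0 heps.
set kap1 := (2 `^ (gamma - 1))^-1 / 4 in heps *.
pose kap2 : R := 3 * 2 `^ (gamma - 1).
have k10 : 0 < kap1 by rewrite divr_gt0// invr_gt0 powR_gt0.
have k20 : 0 < kap2 by rewrite mulr_gt0// powR_gt0.
have BM (nu : {ffun 'I_n -> nat}) : exists M : R, 0 < M /\
    forall c b (x y : 'rV[R]_n), normc (bumpV eps c b x nu y) <= `|c| * `|b| ^+ mdeg nu * M.
  by have [M M0 MB] := @bumpV_le R n eps nu; exists M.
have [M MB] := choice BM.
(* One [delta] for all multi-indices of degree at most [N]; [c0 * kap2] is an upper bound for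
   [a * r]. *)
have [|delta d0 hd] := @exists_le_finite R n N (fun nu => Cnu nu / ((c0 * kap2) ^+ mdeg nu * M nu)).
  move=> nu; apply: divr_gt0 => //; apply: mulr_gt0; last by case: (MB nu).
  by rewrite exprn_gt0// mulr_gt0.
pose K0 := 2 `^ (2 * sigma) * delta ^- 2 * ((`|Cm| + 1) ^+ 2 * (2 * (c0 * kap2)) ^+ n *
  (2 `^ `|- (2 * beta)| * (1 + (kap1^-1 `^ sigma) ^+ 2))).
have Cm0 : 0 < `|Cm| + 1 by rewrite ltr_pwDr.
exists K0.
  have e1 : 0 < 1 + (kap1^-1 `^ sigma) ^+ 2 by rewrite ltr_pwDl// sqr_ge0.
  by rewrite /K0 !mulr_gt0 ?powR_gt0 ?exprn_gt0 ?invr_gt0 ?exprn_gt0 ?mulr_gt0.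
move=> R0 T A k m xi mm mA miy hR1 hR2 hT /andP[hx1 hx2].
have R04 : 4 <= R0 by exact: le_trans expR2_ge4 hR2.
have T16 : 16 <= T by lra.
set a := a_scale gamma T^-1.
set s := enorm xi in hx1 hx2.
(* A log-subdyadic ball of radius [c0 rho(u)] centred at [xi] has distance [u] to 0
   exactly when [u + c0 rho(u) = |xi|]. *)
have R01 : 1 < R0 by lra.
(* The constants fit exactly: 2/3 of 3/8 of 4 R0 is R0, and 2/3 of 3/8 T is the T/4 that
   [ln_comparable] requires of [u]. *)
have hs : R0 <= 2 / 3 * s by lra.
have [u /andP[us1 us2] hu] := subdyadic_radius g1 c00 hR1 R01 hs.
have uT : T / 4 <= u by lra.
have uT2 : u <= 17 / 8 * T by lra.
have u1 : 1 < u by lra.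
have rh0 := rho_gt0 gamma u1.
set rh := rho gamma u in hu rh0.
have [ar1 ar2] : kap1 <= a * rh /\ a * rh <= kap2.
  by have /andP[] := scale_comparable g1 T16 uT uT2.
have [LT0 [LT1 LT2]] := ln_comparable T16 uT uT2.
have a0 : 0 < a by rewrite -(pmulr_lgt0 _ rh0); exact: lt_le_trans ar1.
pose r := c0 * rh.
have r0 : 0 < r by rewrite mulr_gt0.
have ds : dist0 (eball xi r) = u by rewrite dist0_eball// -/s -hu /r; lra.
have sub : log_subdyadic gamma R0 c0 C0 xi r.
  rewrite /log_subdyadic ds; split => //; first lra.
  by rewrite -/rh lexx /r ler_wpM2r ?ltW.
have ad : adapted_bump C1 Cnu N xi r (bumpV eps delta a xi (fun=> 0%N)).
  apply: (adapted_window (xmax := c0 * kap2) (M := M)) => //.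
  - by rewrite mulr_ge0 ?ltW.
  - rewrite (lt_le_trans heps)// ler_wpM2l ?(ltW C10)//.
    by rewrite /r [a * (c0 * rh)]mulrCA ler_wpM2l ?(ltW c00).
  - by rewrite /r [a * (c0 * rh)]mulrCA ler_wpM2l ?(ltW c00).
  - by move=> nu; case: (MB nu).
  - by move=> nu; case: (MB nu).
  - move=> nu hnu; have := hd nu hnu; rewrite ler_pdivlMr//.
    by apply: mulr_gt0; [rewrite exprn_gt0// mulr_gt0|case: (MB nu)].
have [b /andP[b0 bU] bE] := leb_eball xi n0 r0.
have miy' theta := miy xi r (bumpV eps delta a xi (fun=> 0%N)) theta sub ad.
pose w eta := (cutoff eps (a *: (eta - xi)))%:C : R[i].
have Bw : bumpV eps delta a xi (fun=> 0%N) = (fun eta => delta%:C * w eta).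
  by apply/funext => eta; rewrite cutoff_bumpV rmorphM.
have lnu0 : 0 < ln u by lra.
have step theta : 0 <= theta <= sigma ->
    (\int[mu]_y ((enorm y `^ theta * normc (fourier (fun eta => (m eta * (delta%:C * w eta))%R) y)) ^+ 2)%:E <=
    ((`|Cm| + 1) ^+ 2 * b * (ln u `^ beta * rh `^ theta) ^- 2)%:E)%E.
  move=> ht; have := miy' theta ht; rewrite /= ds -/rh.
  have -> : lebesgue_rV n (eball xi r) = b%:E by exact: bE.
  rewrite Bw => h; apply: hsobolev_le => //.
  by rewrite mulr_gt0// powR_gt0.
have ss : 0 <= sigma <= sigma by rewrite s0 lexx.
have s00 : 0 <= (0 : R) <= sigma by apply/andP; split.
have wi : cintegrable mu (fun eta => m eta * w eta).
  exact: (cintegrable_core_symbol eps0 a0 mm mA xi).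
apply: le_trans (weighted_window_le a0 s0 d0 wi (step 0 s00) (step sigma ss)) _.
rewrite lee_fin powRr0 mulr1.
set lu := (ln u `^ beta) ^- 2.
have luE : lu <= 2 `^ `|- (2 * beta)| * ln T `^ (- (2 * beta)).
  rewrite /lu sqr_powR_inv; exact: powR_comparable.
have lu0 : 0 <= lu by rewrite invr_ge0 sqr_ge0.
have hb : b <= (2 * (c0 * kap2)) ^+ n * a ^- n.
  apply: (le_trans bU); rewrite -exprVn -exprMn.
  apply: lerXn2r; rewrite ?nnegrE; [by rewrite mulr_ge0// ltW|by rewrite !mulr_ge0 ?invr_ge0 ?ltW|].
  rewrite -mulrA ler_wpM2l// /r -mulrA ler_wpM2l ?(ltW c00)//.
  by rewrite ler_pdivlMr// mulrC.
(* The left side is (a rho)^(-sigma), and a rho is at least [kap1]. *)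
have hk : a^-1 `^ sigma * (rh `^ sigma)^-1 <= kap1^-1 `^ sigma.
  have -> : (rh `^ sigma)^-1 = rh^-1 `^ sigma.
    by rewrite -[in RHS]powR_inv1 ?(ltW rh0)// -powRrM mulN1r powRN.
  rewrite -powRM ?invr_ge0 ?(ltW a0) ?(ltW rh0)//.
  apply: ge0_ler_powR => //; rewrite ?nnegrE ?mulr_ge0 ?invr_ge0 ?(ltW a0) ?(ltW rh0) ?(ltW k10)//.
  by rewrite -invfM lef_pV2 ?posrE ?k10 ?(mulr_gt0 a0 rh0).
have hk2 : (a^-1 `^ sigma * (rh `^ sigma)^-1) ^+ 2 <= (kap1^-1 `^ sigma) ^+ 2.
  by apply: lerXn2r; rewrite ?nnegrE ?mulr_ge0 ?invr_ge0 ?powR_ge0.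
have -> : K0 * a ^- n * ln T `^ (- (2 * beta)) = 2 `^ (2 * sigma) * delta ^- 2 *
   ((`|Cm| + 1) ^+ 2 * (((2 * (c0 * kap2)) ^+ n * a ^- n) *
     ((2 `^ `|- (2 * beta)| * ln T `^ (- (2 * beta))) * (1 + (kap1^-1 `^ sigma) ^+ 2)))).
  by rewrite /K0; ring.
apply: ler_wpM2l; first by rewrite mulr_ge0 ?powR_ge0// invr_ge0 sqr_ge0.
rewrite [leLHS](_ : _ = (`|Cm| + 1) ^+ 2 * (b * (lu * (1 + (a^-1 `^ sigma * (rh `^ sigma)^-1) ^+ 2)))); last first.
  by rewrite /lu; field; rewrite !gt_eqF ?powR_gt0.
apply: ler_wpM2l; first exact: sqr_ge0.
have e2 : 0 <= 1 + (a^-1 `^ sigma * (rh `^ sigma)^-1) ^+ 2 by rewrite addr_ge0// sqr_ge0.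
apply: ler_pM => //; [exact: ltW|by rewrite mulr_ge0|].
by apply: ler_pM => //; rewrite lerD2l.
Qed.

End miyachi_window.

Section scale_inequality.
Context {R : realType} {n : nat}.
Notation mu := (@leb R n).

Lemma ge0_integral_ball_shift (x : 'rV[R]_n) (a : R) (f : 'rV[R]_n -> \bar R) :
  measurable_fun setT f -> (forall y, 0 <= f y)%E ->
  (\int[mu]_(y in [set y | (enorm (y - x) <= a)%R]) f y =
   \int[mu]_(y in [set y | (enorm y <= a)%R]) f (y + x)%R)%E.
Proof.
move=> mf f0; rewrite integral_mkcond [RHS]integral_mkcond.
have mB : measurable_fun setT (fun y : 'rV[R]_n => y - x) by exact: measurable_fun_rVB.
have mD : measurable [set y : 'rV[R]_n | enorm (y - x) <= a].
  have -> : [set y : 'rV[R]_n | enorm (y - x) <= a] = setT `&` (fun y => enorm (y - x)) @^-1` `]-oo, a].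
    by rewrite setTI; apply/seteqP; split => y /=; rewrite in_itv.
  exact: (measurable_fun_enorm mB).
rewrite -(ge0_integral_shift x (f := f \_ [set y : 'rV[R]_n | enorm (y - x) <= a])).
- apply: eq_integral => y _; rewrite /patch; congr (if _ then _ else _).
  by apply/idP/idP; rewrite !inE /= addrK.
- exact/(measurable_restrictT _ mD)/(measurable_funS measurableT).
- by move=> y; rewrite /patch; case: ifP.
Qed.

Lemma fourier_dilation_support (phi : 'rV[R]_n -> R[i]) (t : R) (eta : 'rV[R]_n) : 0 < t ->
  supp (fourier phi) `<=` [set xi | 2^-1 <= enorm xi <= 2] -> fourier phi (t *: eta) != 0 ->
  2^-1 * t^-1 <= enorm eta <= 2 * t^-1.
Proof.
move=> t0 sp h; have /sp/= : supp (fourier phi) (t *: eta) by exact: subset_closure.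
by rewrite enormZ (gtr0_norm t0) ler_pdivrMr// ler_pdivlMr// [enorm eta * t]mulrC.
Qed.

Lemma weighted_integral_shift (F : 'rV[R]_n -> R[i]) (x : 'rV[R]_n) (a sigma c : R) :
  0 < c -> 0 < a -> 0 <= sigma -> cmeasurable F ->
  (c%:E * \int[mu]_y (normc (F (y + x)%R) ^+ 2 * (weight a sigma y)^-1)%:E =
   \int[mu]_y (c * (normc (F y) ^+ 2 * (weight a sigma (y - x))^-1))%:E)%E.
Proof.
move=> c0 a0 s0 mF.
have mw : measurable_fun setT (fun y : 'rV[R]_n => (weight a sigma y)^-1).
  apply: measurable_inv_gt0; first exact: measurable_weight.
  by move=> y; exact: weight_gt0.
have mn : measurable_fun setT (fun y => normc (F y) ^+ 2).
  by apply: measurable_funX; exact: cmeasurable_normc.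
have mwx : measurable_fun setT (fun y : 'rV[R]_n => (weight a sigma (y - x))^-1).
  by apply: (measurableT_comp mw); exact: measurable_fun_rVB.
have mnx : measurable_fun setT (fun y : 'rV[R]_n => normc (F (y + x)) ^+ 2).
  by apply: (measurableT_comp mn); exact: measurable_fun_rVD.
have w0 y : 0 <= (weight a sigma y)^-1 by rewrite invr_ge0 ltW// weight_gt0.
have p0 (y : 'rV[R]_n) : 0 <= normc (F (y + x)) ^+ 2 * (weight a sigma y)^-1 by rewrite mulr_ge0 ?sqr_ge0.
rewrite -(ge0_integralZ_EFin mu (ltW c0) (measurable_funM mnx mw) p0).
rewrite -[RHS](ge0_integral_shift x (f := fun y => (c * (normc (F y) ^+ 2 * (weight a sigma (y - x))^-1))%:E)).
- by apply: eq_integral => y _; rewrite addrK.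
- by apply/measurable_EFinP; apply: measurable_funM => //; exact: measurable_funM.
- by move=> y; rewrite lee_fin mulr_ge0 ?(ltW c0)// mulr_ge0 ?sqr_ge0.
Qed.

(** The factor (ln 1/t)^(-2 beta) of the window bound cancels the (ln 1/t)^(2 beta) of the left
    side, which leaves exponent 0 on the right; [n%:R * lambda = 2 * sigma] matches the two spatial
    weights. *)
Lemma scale_inequality (gamma beta sigma lambda eps C K0 A t R0 : R) (k : nat)
    (m phi f : 'rV[R]_n -> R[i]) (x : 'rV[R]_n) :
  (0 < n)%N -> 1 < gamma -> 0 <= sigma -> n%:R * lambda = 2 * sigma ->
  0 < eps -> n%:R * eps <= 8^-1 -> 0 < C -> 0 < K0 ->
  (forall (a A : R) (k : nat) (m E : 'rV[R]_n -> R[i]) (M K : R),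
    0 < a -> 0 < K -> cmeasurable m ->
    (forall x, normc (m x) <= A * (1 + enorm x) ^+ k) ->
    cintegrable mu E -> rapid (fourier E) -> (forall x, normc (E x) <= M) ->
    (forall xi, (exists eta, fourier E eta != 0 /\ cutoff eps (a *: (eta - xi)) != 0) ->
     (\int[mu]_y (normc (fourier (fun eta => (m eta * (cutoff eps (a *: (eta - xi)))%:C)%R) y) ^+ 2 *
       weight a sigma y)%:E <= K%:E)%E) ->
    (\int[mu]_(y in [set y | (enorm y <= a)%R])
        (normc (inv_fourier (fun eta => (m eta * fourier E eta)%R) y) ^+ 2)%:E <=
      (C * a ^+ n * K)%:E * \int[mu]_y (normc (E y) ^+ 2 * (weight a sigma y)^-1)%:E)%E) ->
  cmeasurable m -> (forall x, normc (m x) <= A * (1 + enorm x) ^+ k) ->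
  (forall xi, 3 / 8 * t^-1 <= enorm xi <= 17 / 8 * t^-1 ->
    (\int[mu]_y (normc (fourier (fun eta => (m eta * (cutoff eps (a_scale gamma t *: (eta - xi)))%:C)%R) y) ^+ 2 *
       weight (a_scale gamma t) sigma y)%:E <=
     (K0 * a_scale gamma t ^- n * ln t^-1 `^ (- (2 * beta)))%:E)%E) ->
  0 < t -> expR 2 <= t^-1 ->
  schwartz phi -> supp (fourier phi) `<=` [set xi | 2^-1 <= enorm xi <= 2] -> schwartz f ->
  (\int[mu]_(y in [set y | (enorm (y - x) <= a_scale gamma t)%R])
     (normc (convolution (multiplier m f) (dilation phi t) y) ^+ 2 / a_scale gamma t ^+ n
        * ln t^-1 `^ (2 * beta) / t)%:E <=
   (C * K0)%:E * \int[mu]_y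
     (normc (convolution f (dilation phi t) y) ^+ 2
         * (1 + enorm (x - y) / a_scale gamma t) `^ (- (n%:R * lambda))
         / a_scale gamma t ^+ n
         * ln t^-1 `^ (2 * 0) / t)%:E)%E.
Proof.
move=> n0 g1 s0 lam eps0 heps C0 K00 core mm mA win t0 ht sphi hsupp sf.
have T0 : 0 < t^-1 by rewrite invr_gt0.
have L2 : 2 <= ln t^-1 by rewrite -[leLHS](expRK 2) ler_ln// posrE expR_gt0.
have L0 : 0 < ln t^-1 by lra.
(* Holds because ln(1/t) >= 1; it bounds the window radius n eps / a by 1/(8t). *)
have at_ : t <= a_scale gamma t.
  rewrite /a_scale ler_peMr ?(ltW t0)// -[leLHS](powRr0 (ln t^-1)).
  by apply: ler_powR; [lra|rewrite subr_ge0 ltW].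
set a := a_scale gamma t in core win at_ *.
have a0 : 0 < a by exact: lt_le_trans at_.
have an0 : 0 < a ^+ n by rewrite exprn_gt0.
have fi := schwartz_integrable sf.
have ffr := schwartz_fourier_rapid sf.
have phii := schwartz_integrable sphi.
pose phit := dilation phi t.
have phiti : cintegrable mu phit by exact: cintegrable_dilation.
have mphit : cmeasurable phit by case: phiti.
have [P HP] : exists P : R, forall z, normc (phit z) <= P.
  have [P HP] := rapid_bounded (schwartz_rapid sphi); exists (t ^- n * P) => z.
  rewrite /phit /dilation Normc.normcM normc_realc ger0_norm ?invr_ge0 ?exprn_ge0 ?(ltW t0)//.
  by rewrite ler_wpM2l// invr_ge0 exprn_ge0 ?(ltW t0).
have fpi y : cintegrable mu (fun z => f z * phit (y - z)).
  under eq_fun do rewrite mulrC.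
  apply: (cintegrable_bounded_mul (M := P)) => //.
  by apply: (cmeasurable_comp _ mphit); exact: measurable_fun_rVB.
pose F := convolution f phit.
have Fi : cintegrable mu F by exact: cintegrable_convolution.
have FM y : normc (F y) <= \int[mu]_z (P * normc (f z)).
  rewrite /F /convolution; apply: (@normc_cintegral_le_mul _ _ _ mu _ (fun z => P * normc (f z))).
  - by case: (fpi y).
  - exact: (integrableZl measurableT P (cintegrable_normc fi)).
  - by move=> z; rewrite Normc.normcM mulrC ler_wpM2r ?normc_ge0.
pose E y := F (y + x).
have Ei : cintegrable mu E by exact: cintegrable_shift.
have EM y : normc (E y) <= \int[mu]_z (P * normc (f z)) by exact: FM.
have fE xi : fourier E xi = expi (2 * pi * dotrV x xi) * fourier phi (t *: xi) * fourier f xi.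
  have e1 : fourier E xi = expi (2 * pi * dotrV x xi) * fourier F xi by exact: (@fourier_shift R n F x xi Fi).
  have e2 : fourier F xi = fourier f xi * fourier phit xi by exact: (@fourier_convolution R n f phit xi fi phiti fpi).
  have e3 : fourier phit xi = fourier phi (t *: xi) by exact: (@fourier_dilation R n phi t xi t0 phii).
  by rewrite e1 e2 e3 [fourier f xi * _]mulrC mulrA.
have fEr : rapid (fourier E).
  have -> : fourier E = (fun xi => expi (2 * pi * dotrV x xi) * fourier phi (t *: xi) * fourier f xi) by exact/funext.
  apply: (rapid_mul_bounded (A := norm1 phi)) => // xi.
  by rewrite Normc.normcM normc_expi mul1r normc_fourier_le.
pose K := K0 * a ^- n * ln t^-1 `^ (- (2 * beta)).
have K_0 : 0 < K by rewrite !mulr_gt0 ?invr_gt0 ?powR_gt0.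
have HK xi : (exists eta, fourier E eta != 0 /\ cutoff eps (a *: (eta - xi)) != 0) ->
     (\int[mu]_y (normc (fourier (fun eta => (m eta * (cutoff eps (a *: (eta - xi)))%:C)%R) y) ^+ 2 *
       weight a sigma y)%:E <= K%:E)%E.
  move=> [eta [e1 e2]]; apply: win.
  have p0 : fourier phi (t *: eta) != 0.
    by apply: contraNneq e1 => e; rewrite fE e mulr0 mul0r.
  have /andP[h1 h2] := fourier_dilation_support t0 hsupp p0.
  (* As |eta| lies between 1/(2t) and 2/t, a displacement of at most 1/(8t) puts |xi| between 3/8
     and 17/8 of 1/t. *)
  have h3 : enorm (eta - xi) <= 8^-1 * t^-1.
    apply: (@le_trans _ _ (n%:R * (eps / a))).
      apply: enorm_le_coord => i; have := cutoff_ball e2 i.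
      by rewrite mxE normrM (gtr0_norm a0) ler_pdivlMr// mulrC.
    by rewrite mulrA; apply: ler_pM => //; rewrite ?mulr_ge0 ?invr_ge0 ?(ltW eps0) ?(ltW a0)// lef_pV2 ?posrE.
  have h4 := ler_enormD eta (xi - eta); have h5 := ler_enormD xi (eta - xi).
  rewrite [eta + _]addrC subrK in h4; rewrite [xi + _]addrC subrK in h5.
  have h6 : enorm (xi - eta) = enorm (eta - xi) by rewrite -enormN opprB.
  by apply/andP; split; lra.
have coreE := core a A k m E _ K a0 K_0 mm mA Ei fEr EM HK.
pose G := convolution (multiplier m f) phit.
pose u xi := m xi * fourier f xi.
have ui : cintegrable mu u.
  apply: rapid_integrable; last exact: rapid_mul_growth mA ffr.
  by apply: cmeasurableM => //; apply: cmeasurable_fourier; case: fi.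
have GE y : G (y + x) = inv_fourier (fun eta => m eta * fourier E eta) y.
  rewrite /G /multiplier convolution_inv_fourier// inv_fourier_shift.
  rewrite /inv_fourier; congr cintegral; apply/funext => xi.
  by rewrite fE fourier_dilation// /u; ring.
have mG : cmeasurable G.
  have -> : G = (fun y => fourier (fun xi => u xi * fourier phit xi) (- y)).
    by apply/funext => y; rewrite /G /multiplier convolution_inv_fourier// inv_fourierE.
  have mo : measurable_fun setT (fun y : 'rV[R]_n => - y).
    have -> : (fun y : 'rV[R]_n => - y) = (fun y => (-1) *: y) by apply/funext => y; rewrite scaleN1r.
    exact: measurable_fun_rVZ.
  apply: (cmeasurable_comp mo); apply: cmeasurable_fourier; apply: cmeasurableM; first by case: ui.
  exact: cmeasurable_fourier.
have mF : cmeasurable F by case: Fi.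
pose c1 := a ^- n * ln t^-1 `^ (2 * beta) / t.
have c10 : 0 < c1 by rewrite !mulr_gt0 ?invr_gt0 ?powR_gt0.
apply: (@le_trans _ _ (c1%:E * \int[mu]_(y in [set y | (enorm (y - x) <= a)%R]) (normc (G y) ^+ 2)%:E)%E).
  apply: (@le_trans _ _ (\int[mu]_(y in [set y | (enorm (y - x) <= a)%R]) (c1%:E * (normc (G y) ^+ 2)%:E))%E).
    apply: ge0_le_integralS => y _.
      by rewrite lee_fin divr_ge0 ?(ltW t0)// mulr_ge0 ?powR_ge0// divr_ge0 ?sqr_ge0 ?(ltW an0).
    by rewrite -EFinM lee_fin /c1 le_eqVlt; apply/orP; left; apply/eqP; rewrite -/G; ring.
  by apply: ge0_integralZl_leS => // y _; rewrite lee_fin sqr_ge0.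
rewrite ge0_integral_ball_shift; last 2 first.
- exact: measurable_sqr_normc.
- by move=> y; rewrite lee_fin sqr_ge0.
have -> : (\int[mu]_(y in [set y | (enorm y <= a)%R]) (normc (G (y + x)%R) ^+ 2)%:E =
    \int[mu]_(y in [set y | (enorm y <= a)%R]) (normc (inv_fourier (fun eta => (m eta * fourier E eta)%R) y) ^+ 2)%:E)%E.
  by apply: eq_integral => y _; rewrite GE.
apply: le_trans (lee_wpmul2l _ coreE) _; first by rewrite lee_fin ltW.
set J := (\int[mu]_y (normc (E y) ^+ 2 * (weight a sigma y)^-1)%:E)%E.
pose c2 := a ^- n / t.
have c20 : 0 < c2 by rewrite mulr_gt0 ?invr_gt0.
have JE : (c2%:E * J <= \int[mu]_y
     (normc (convolution f (dilation phi t) y) ^+ 2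
         * (1 + enorm (x - y) / a) `^ (- (n%:R * lambda)) / a ^+ n
         * ln t^-1 `^ (2 * 0) / t)%:E)%E.
  have h := weighted_integral_shift (F := F) x c20 a0 s0 mF.
  apply: (@le_trans _ _ (\int[mu]_y (c2 * (normc (F y) ^+ 2 * (weight a sigma (y - x))^-1))%:E)%E).
    by rewrite -[leRHS]h; exact: lexx.
  apply: ge0_le_integralT => y.
    by rewrite lee_fin mulr_ge0 ?(ltW c20)// mulr_ge0 ?sqr_ge0// invr_ge0 ltW// weight_gt0.
  rewrite lee_fin mulr0 powRr0 mulr1 lam powRN /weight.
  have -> : enorm (x - y) = enorm (y - x) by rewrite -enormN opprB.
  by rewrite le_eqVlt; apply/orP; left; apply/eqP; rewrite /c2 -/F; ring.
apply: le_trans (lee_wpmul2l _ JE); last by rewrite lee_fin mulr_ge0 ?ltW.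
rewrite !muleA -!EFinM.
(* The a^n of the core inequality cancels the a^(-n) of the window bound, and the powers of the
   logarithm cancel. *)
have -> : c1 * (C * a ^+ n * K) = C * K0 * c2; last exact: lexx.
rewrite /c1 /c2 /K powRN; field.
by rewrite !gt_eqF// powR_gt0.
Qed.

End scale_inequality.

(** * Integration over the scales *)

Section assembly.
Context {R : realType} {n : nat}.

Lemma cos_ge_half : exists2 e : R, 0 < e & forall t : R, `|t| <= e -> 2^-1 <= cos t.
Proof.
have c : {for 0, continuous (@cos R)} by exact: continuous_cos.
have : \forall t \near (0 : R), 2^-1 < cos t.
  have : \forall s \near cos (0 : R), 2^-1 < s by apply: lt_nbhsr; rewrite cos0; lra.
  by move=> /c.
move=> /nbhs_ballP[e /= e0 he]; exists (e / 2); first by rewrite divr_gt0.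
move=> t te; apply/ltW/he; rewrite /ball/= sub0r normrN (le_lt_trans te)//; lra.
Qed.

(** Every condition is an upper bound on the single number n eps, so a minimum of three thresholds
    settles them. *)
Lemma exists_window_width (kappa : R) : (0 < n)%N -> 0 < kappa ->
  exists eps : R, [/\ 0 < eps, n%:R * eps <= 8^-1, n%:R * eps < kappa &
    forall t : R, `|t| <= 2 * pi * (n%:R * eps) -> 2^-1 <= cos t].
Proof.
move=> n0 k0; have [e e0 he] := cos_ge_half.
have nR : 0 < n%:R :> R by rewrite ltr0n.
pose s : R := Num.min 8^-1 (Num.min (kappa / 2) (e / (2 * pi))).
have s0 : 0 < s by rewrite !lt_min invr_gt0 ltr0n /= !divr_gt0// mulr_gt0 ?pi_gt0.
exists (s / n%:R); rewrite divr_gt0// mulrC divfK ?gt_eqF//; split => //.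
- by rewrite ge_min lexx.
- by apply: (@le_lt_trans _ _ (kappa / 2)); [rewrite /s !ge_min lexx orbT|lra].
- move=> t ht; apply: he; apply: (le_trans ht).
  rewrite mulrC -ler_pdivlMr ?mulr_gt0 ?pi_gt0//.
  by rewrite /s !ge_min lexx !orbT.
Qed.

(** The condition sees the symbol only through the integrals that define the transform of [m * Psi],
    and these ignore null sets. *)
Lemma log_miyachi_ae_eq (gamma beta sigma R0 c0 C0 C1 : R) (Cnu : {ffun 'I_n -> nat} -> R)
    (N : nat) (Cm : R) (m m' : 'rV[R]_n -> R[i]) :
  {ae leb n, forall x, m x = m' x} ->
  log_miyachi gamma beta sigma R0 c0 C0 C1 Cnu N Cm m ->
  log_miyachi gamma beta sigma R0 c0 C0 C1 Cnu N Cm m'.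
Proof.
move=> mm' miy c r Psi theta sub ad ht; have := miy c r Psi theta sub ad ht.
rewrite /= /hsobolev.
have -> : fourier (fun xi => m xi * Psi xi) = fourier (fun xi => m' xi * Psi xi) => //.
apply/funext => xi; apply: (@cintegral_ae_eq R n).
by apply: filterS mm' => x ->.
Qed.

Lemma multiplier_ae_eq (m m' f : 'rV[R]_n -> R[i]) : {ae leb n, forall x, m x = m' x} ->
  multiplier m f = multiplier m' f.
Proof.
move=> mm'; apply/funext => y; apply: (@cintegral_ae_eq R n).
by apply: filterS mm' => x ->.
Qed.

Lemma poweR_half_le (c : R) (I J : \bar R) : 0 < c -> (0 <= I)%E -> (0 <= J)%E ->
  (I <= c%:E * J)%E -> (I `^ 2^-1 <= (Num.sqrt c)%:E * J `^ 2^-1)%E.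
Proof.
move=> c0 I0 J0 IJ.
have cJ0 : (0 <= c%:E * J)%E by rewrite mule_ge0// lee_fin ltW.
apply: (@le_trans _ _ ((c%:E * J) `^ 2^-1)%E).
  by apply: gt0_ler_poweR => //; rewrite in_itv/= ?I0 ?cJ0 leey.
by rewrite poweRM ?lee_fin ?(ltW c0)// poweR_EFin powR12_sqrt ?(ltW c0).
Qed.

End assembly.

Theorem theorem4p2 (R : realType) (d : nat) (gamma beta sigma lambda : R)
    (d_ge1 : (1 <= d)%N) (gamma_gt1 : 1 < gamma)
    (sigma_gt : d%:R / 2 < sigma) (lambdaE : lambda = 2 * sigma / d%:R) :
  exists N0 : nat,
  forall (N : nat) (c0 C0 C1 : R) (Cnu : {ffun 'I_d -> nat} -> R),
    (N0 <= N)%N -> 0 < c0 -> c0 < C0 -> 0 < C1 -> (forall nu, 0 < Cnu nu) ->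
  exists Rmin : R,
  forall (R0 : R) (k0 k1 : nat) (phi : 'rV[R]_d -> R[i]) (Cm : R),
    Rmin <= R0 -> expR 2 <= R0 :> R ->
    R0 <= 2 ^+ k0 -> (k0 + 2 <= k1)%N -> 2 ^- k1 < expR (-1) :> R ->
    lp_function phi ->
  exists C : R, 0 < C /\
  forall m : 'rV[R]_d -> R[i],
    lebesgue_measurable m -> polynomial_growth m ->
    log_miyachi gamma beta sigma R0 c0 C0 C1 Cnu N Cm m ->
  forall (f : 'rV[R]_d -> R[i]) (x : 'rV[R]_d), schwartz f ->
    (g_log gamma phi (2 ^- k1) beta (multiplier m f) x
      <= C%:E * g_log_star gamma phi (2 ^- k1) 0 lambda f x)%E.
Proof.
have s0 : 0 <= sigma by rewrite ltW// (le_lt_trans _ sigma_gt)// divr_ge0.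
have lam : d%:R * lambda = 2 * sigma.
  by rewrite lambdaE mulrC divfK// pnatr_eq0 -lt0n.
exists 0%N => N c0 C0 C1 Cnu _ c00 c0C C10 Cnu0.
have kappa0 : 0 < C1 * (c0 * ((2 `^ (gamma - 1))^-1 / 4)).
  by rewrite !mulr_gt0 ?invr_gt0 ?powR_gt0.
have [eps [eps0 eps8 epsk epsc]] := exists_window_width d_ge1 kappa0.
(* The threshold of [subdyadic_radius], which provides a ball of the right radius around each
   relevant frequency. *)
exists (expR ((2 * c0) `^ (gamma - 1)^-1)) => R0 k0 k1 phi Cm hR hR2 hk0 hk1 _ [sphi _ hsupp _].
have [C Cp core] := core_inequality eps0 epsc s0.
have [K0 K0p win] := miyachi_window beta N Cm d_ge1 gamma_gt1 s0 c00 c0C C10 Cnu0 eps0 epsk.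
have CK0 : 0 < C * K0 by exact: mulr_gt0.
exists (Num.sqrt (C * K0)); split; first by rewrite sqrtr_gt0.
move=> m lm pm miy f x sf.
have [m' [A [k [mm mA mae]]]] := borel_version lm pm.
rewrite (multiplier_ae_eq f mae); have miy' := log_miyachi_ae_eq mae miy.
have R0p : 0 < R0 by exact: lt_le_trans (expR_gt0 _) hR2.
have a_ge0 t : 0 <= t -> 0 <= a_scale gamma t by move=> t0; rewrite mulr_ge0// powR_ge0.
have int0 (t : R) : 0 < t ->
  (0 <= \int[lebesgue_rV d]_y
     (normc (convolution f (dilation phi t) y) ^+ 2
         * (1 + enorm (x - y) / a_scale gamma t) `^ (- (d%:R * lambda))
         / a_scale gamma t ^+ d
         * ln t^-1 `^ (2 * 0) / t)%:E)%E.
  move=> t0; apply: integral_ge0 => y _; rewrite lee_fin divr_ge0 ?(ltW t0)// mulr_ge0 ?powR_ge0//.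
  by rewrite divr_ge0 ?exprn_ge0 ?a_ge0 ?(ltW t0)// mulr_ge0 ?sqr_ge0 ?powR_ge0.
have int1 (t : R) : 0 < t ->
  (0 <= \int[lebesgue_rV d]_(y in [set y | (enorm (y - x) <= a_scale gamma t)%R])
     (normc (convolution (multiplier m' f) (dilation phi t) y) ^+ 2
        / a_scale gamma t ^+ d * ln t^-1 `^ (2 * beta) / t)%:E)%E.
  move=> t0; apply: integral_ge0 => y _; rewrite lee_fin divr_ge0 ?(ltW t0)// mulr_ge0 ?powR_ge0//.
  by rewrite divr_ge0 ?sqr_ge0// exprn_ge0// a_ge0// ltW.
have itv_gt0 (t : R) : `]0, 2 ^- k1[%classic t -> 0 < t by rewrite /= in_itv/= => /andP[].
rewrite /g_log /g_log_star; apply: poweR_half_le => //.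
- by apply: integral_ge0 => t /itv_gt0; exact: int1.
- by apply: integral_ge0 => t /itv_gt0; exact: int0.
(* The constant is pulled out by an inequality valid for arbitrary nonnegative integrands, since
   measurability in [t] of the inner integral has not been established. *)
apply: le_trans (ge0_integralZl_leS _ CK0 _); last by move=> t /itv_gt0; exact: int0.
apply: ge0_le_integralS => t ht; first exact: int1 (itv_gt0 _ ht).
have t0 : 0 < (t : R) by exact: itv_gt0.
have t1 : (t : R) < 2 ^- k1 by move: ht; rewrite /= in_itv/= => /andP[].
(* The two extra powers of 2 in [k0 + 2 <= k1] give the factor 4. *)
have T4 : 4 * R0 <= t^-1.
  apply: (@le_trans _ _ (2 ^+ k1)); last first.
    by rewrite -[leLHS]invrK lef_pV2 ?posrE ?invr_gt0 ?exprn_gt0// ltW.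
  apply: (@le_trans _ _ (2 ^+ (k0 + 2))); last by rewrite ler_eXn2l// ltr1n.
  by have -> : 2 ^+ (k0 + 2) = 4 * 2 ^+ k0 :> R; [rewrite exprD; ring|lra].
have T2 : expR 2 <= t^-1 by lra.
apply: (@scale_inequality R d gamma beta sigma lambda eps C K0 A t R0 k m' phi f x) => //.
by move=> xi hxi; have := win R0 t^-1 A k m' xi mm mA miy' hR hR2 T4 hxi; rewrite invrK.
Qed.
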